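(* Let $(\Lambda(t),N(t))_{t\ge 0}$ be the intensity and the number of customers of the Markovian Hawkes-fed infinite-server queue with parameters $\lambda_\infty,r,\mu>0$ and mark $B$ (with $\mathbb{P}(B>0)=1$), with $\Lambda(0)=\lambda_\infty$ and $N(0)=0$. Write $\beta(s):=\mathbb{E}\,e^{-sB}$ and $\zeta(t,z,s):=\mathbb{E}\big[z^{N(t)}e^{-s\Lambda(t)}\big]$. Then for all $t\ge 0$, $|z|\le 1$ and $\mathrm{Re}\, s\ge 0$, $$\zeta(t,z,s)=e^{-s(t)\lambda_\infty}\exp\left(-\lambda_\infty r\int_0^t s(u)\,\mathrm{d}u\right),$$ where the function $s(\cdot)$ (with values in the closed right half-plane) solves the ODE $$s'(u)+r\,s(u)+\big(1+(z-1)e^{-\mu u}\big)\beta(s(u))-1=0,\qquad 0\le u\le t,$$ with boundary condition $s(0)=s$.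
   Context: Markovian Hawkes-fed infinite-server queue: fix $\lambda_\infty>0$, $r>0$, $\mu>0$ and a random variable $B$ with $\mathbb{P}(B>0)=1$; let $B_1,B_2,\dots$ be i.i.d. copies of $B$. The arrival process $(M(t))_{t\ge0}$ is a Hawkes process: a (finite-valued) counting process with arrival epochs $t_1<t_2<\cdots$ and associated filtration $\mathscr{F}(t)$ such that, as $\Delta t\downarrow 0$, $\mathbb{P}(M(t+\Delta t)-M(t)=1\mid\mathscr{F}(t))=\Lambda(t)\Delta t+o(\Delta t)$, the conditional probability of more than one arrival is $o(\Delta t)$, and that of no arrival is $1-\Lambda(t)\Delta t+o(\Delta t)$, where $\Lambda(t)=\lambda_\infty+\sum_{t_i<t}B_i e^{-r(t-t_i)}$. In particular $\Lambda(0)=\lambda_\infty$. Each arrival is a customer that is taken into service immediately on arrival; service requirements are i.i.d. exponential with rate $\mu$ (mean $1/\mu$), independent of everything else, and a customer leaves when its service is completed. $N(t)$ is the number of customers in the system at time $t$. *)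

(* Defs.v *)
From HB Require Import structures.
From mathcomp Require Import all_boot all_order all_algebra finmap.
From mathcomp Require Import all_classical all_reals all_analysis.
From mathcomp.real_closed Require Import complex.

Set Implicit Arguments.
Unset Strict Implicit.
Unset Printing Implicit Defensive.

Import Order.TTheory GRing.Theory Num.Theory.
Import numFieldNormedType.Exports.

Local Open Scope classical_set_scope.
Local Open Scope complex_scope.
Local Open Scope ring_scope.

Section complex_valued.
Context {R : realType}.

Definition cexp (z : R[i]) : R[i] :=
  (expR (complex.Re z))%:C * (cos (complex.Im z) +i* sin (complex.Im z)).

Definition cexpectation d (T : measurableType d) (P : probability T R)
    (X : T -> R[i]) : R[i] :=
  fine 'E_P[fun w => complex.Re (X w)] +i*
  fine 'E_P[fun w => complex.Im (X w)].

Definition cintegral (t : R) (f : R -> R[i]) : R[i] :=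
  (\int[lebesgue_measure]_(u in `[0, t]) complex.Re (f u)) +i*
  (\int[lebesgue_measure]_(u in `[0, t]) complex.Im (f u)).

(* The derivative of [f] at [u] relative to [D]: one-sided at the endpoints
   when [D] is a closed interval. *)
Definition cderiv_within (D : set R) (f : R -> R[i]) (u : R) (l : R[i]) : Prop :=
  ((v - u)^-1 * (complex.Re (f v) - complex.Re (f u)) @[v --> within D u^']
     --> complex.Re l) /\
  ((v - u)^-1 * (complex.Im (f v) - complex.Im (f u)) @[v --> within D u^']
     --> complex.Im l).

End complex_valued.

Section independence.
Context d (T : measurableType d) (R : realType) (P : probability T R).

Definition gen_sigma (X : set (T -> R)) : set_system T :=
  <<s \bigcup_(f in X) preimage_set_system setT f measurable >>.

Definition independent_sigma (G H : set_system T) : Prop :=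
  forall A B, G A -> H B -> P (A `&` B) = (P A * P B)%E.

Definition mutually_independent (X : nat -> {RV P >-> R}) : Prop :=
  forall (J : {fset nat}) (Y : nat -> set R), (forall j, measurable (Y j)) ->
    P (\bigcap_(j in [set` J]) (X j @^-1` Y j)) =
    (\prod_(j <- J) P (X j @^-1` Y j))%E.

Definition iid (X : nat -> {RV P >-> R}) (nu : set R -> \bar R) : Prop :=
  (forall j (Y : set R), measurable Y -> distribution P (X j) Y = nu Y) /\
  mutually_independent X.

(* [f] is a version of the conditional probability of [E] given the
   sigma-algebra [G]. *)
Definition cond_prob (G : set_system T) (E : set T) (f : T -> R) : Prop :=
  [/\ forall Y : set R, measurable Y -> G (f @^-1` Y),
      P.-integrable setT (EFin \o f) &
      forall A, G A -> (\int[P]_(w in A) (f w)%:E)%E = P (A `&` E)].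

End independence.

Section model.
Context d (T : measurableType d) (R : realType) (P : probability T R).
Variables (lam r : R).
(* [arr i] is the epoch of the arrival number [i] (counted from 0), [mark i] and
   [serv i] are its mark and its service requirement. *)
Variables (arr mark serv : nat -> {RV P >-> R}).

Definition arrivals (t : R) (w : T) : nat :=
  #|` fset_set [set i | arr i w <= t] |.

Definition intensity (t : R) (w : T) : R :=
  lam + \sum_(i \in [set i | arr i w < t]) mark i w * expR (- r * (t - arr i w)).

Definition in_system (t : R) (w : T) : nat :=
  #|` fset_set [set i | arr i w <= t < arr i w + serv i w] |.

(* The arrival epochs are positive, strictly increasing, and finitely many of
   them fall in any bounded interval. *)
Definition counting_process : Prop :=
  forall w, [/\ 0 < arr 0%N w, forall i, arr i w < arr i.+1 w &
    forall t, finite_set [set i | arr i w <= t]].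

(* The history up to time [t] of the marked arrival process. *)
Definition history (t : R) : set_system T :=
  <<s [set A | exists i (u : R) (Y : set R), [/\ u <= t, measurable Y &
         A = [set w | arr i w <= u /\ Y (mark i w)]]] >>.

(* All that is known just before the mark number [i] is drawn, [arr i] included. *)
Definition before_mark (i : nat) : set_system T :=
  gen_sigma ([set (arr j : T -> R) | j in [set j | (j <= i)%N]] `|`
             [set (mark j : T -> R) | j in [set j | (j < i)%N]]).

(* P(E t h | F(t)) = q t h + o(h) as h decreases to 0. The remainder is uniform
   for t in a bounded interval: pointwise in t, the expansions would not see
   additional arrivals at fixed times. It is uniform in w only where the
   intensity is bounded: the remainder of a Hawkes process is of the order of
   (intensity * h)^2 and the intensity is unbounded, possibly not integrable. *)
Definition cond_prob_expansion (E : R -> R -> set T) (q : R -> R -> T -> R)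
    : Prop :=
  forall t_max K eps : R, 0 < eps -> \forall h \near 0^'+,
    forall t, 0 <= t <= t_max -> exists f : T -> R,
      cond_prob P (history t) (E t h) f /\
      {ae P, forall w, intensity t w <= K -> `|f w - q t h w| <= eps * h}.

Definition markovian_hawkes (B : {RV P >-> R}) : Prop :=
  [/\ counting_process,
      iid mark (distribution P B),
      (forall i, independent_sigma P (gen_sigma [set (mark i : T -> R)])
                                     (before_mark i)) &
      [/\ cond_prob_expansion
            (fun t h => [set w | (arrivals (t + h) w - arrivals t w = 1)%N])
            (fun t h w => intensity t w * h),
          cond_prob_expansion
            (fun t h => [set w | (1 < arrivals (t + h) w - arrivals t w)%N])
            (fun _ _ _ => 0) &
          cond_prob_expansion
            (fun t h => [set w | (arrivals (t + h) w - arrivals t w = 0)%N])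
            (fun t h w => 1 - intensity t w * h)]].

Definition exponential_services (mu : R) : Prop :=
  iid serv (exponential_prob mu) /\
  independent_sigma P (gen_sigma (range (fun i => serv i : T -> R)))
    (gen_sigma (range (fun i => arr i : T -> R) `|`
                range (fun i => mark i : T -> R))).

Lemma intensity0 : counting_process -> forall w, intensity 0 w = lam.
Proof.
move=> cp w; have [a0 ai _] := cp w.
have pos i : 0 < arr i w by elim: i => // i /lt_trans; apply.
rewrite /intensity [X in \sum_(i \in X) _](_ : _ = set0) ?fsbig_set0 ?addr0//.
by apply/seteqP; split => // i /= /lt_trans/(_ (pos i)); rewrite ltxx.
Qed.

Lemma in_system0 : counting_process -> forall w, in_system 0 w = 0%N.
Proof.
move=> cp w; have [a0 ai _] := cp w.
have pos i : 0 < arr i w by elim: i => // i /lt_trans; apply.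
rewrite /in_system [X in fset_set X](_ : _ = set0) ?fset_set0 ?cardfs0//.
apply/seteqP; split => // i /= /andP[/le_lt_trans/(_ (pos i))].
by rewrite ltxx.
Qed.

End model.

Section transforms.
Context d (T : measurableType d) (R : realType) (P : probability T R).

Definition beta (B : {RV P >-> R}) (s : R[i]) : R[i] :=
  cexpectation P (fun w => cexp (- s * (B w)%:C)).

Definition zeta (lam r : R) (arr mark serv : nat -> {RV P >-> R})
    (t : R) (z s : R[i]) : R[i] :=
  cexpectation P (fun w => z ^+ in_system arr serv t w *
    cexp (- s * (intensity lam r arr mark t w)%:C)).

Definition solves_ode (r mu : R) (B : {RV P >-> R}) (z s : R[i]) (t : R)
    (sol : R -> R[i]) : Prop :=
  [/\ sol 0 = s,
      forall u, 0 <= u <= t -> 0 <= complex.Re (sol u) &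
      forall u, 0 <= u <= t -> exists2 l : R[i],
        cderiv_within `[0, t] sol u l &
        l + r%:C * sol u
          + (1 + (z - 1) * (expR (- mu * u))%:C) * beta B (sol u) - 1 = 0].

End transforms.

(* Main.v *)
(* Given a solution [sol] of the ODE, put g(u) = 1 + (z - 1) e^(-mu u) and
     M(v) = prod_(arr i <= v) g(t - arr i)
            * e^(- sol(t - v) Lambda(v)) * e^(- lam r int_0^(t - v) sol).
   The ODE says exactly that the drift of M vanishes, so E M(t) = M(0), which is
   the right-hand side of the claim. The conditional probabilities of arrivals
   are known up to o(h) only, uniformly where Lambda <= K; so the increments of M
   over a grid are added up to the first exit from Lambda <= K, an event of small
   probability for large K, on which |M| <= 1 suffices. The version of Lambda that
   counts an arrival at the current time differs from the given one on a null set
   only, since there are almost surely no arrivals at a fixed time.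
   Given the epochs, the customer i is present at t with probability
   e^(-mu (t - arr i)), independently of the others, so z^N(t) may be replaced by
   prod_i g(t - arr i); this is proved by approximating the epochs on a grid.
   B may have infinite mean, so the vector field of the ODE is continuous but not
   Lipschitz: a solution is the limit along an ultrafilter of Euler polygons,
   which stay in the right half-plane because |g beta| <= 1 there. *)
Require Import Defs.
From HB Require Import structures.
From mathcomp Require Import all_boot all_order all_algebra finmap.
From mathcomp Require Import all_classical all_reals all_analysis.
From mathcomp.real_closed Require Import complex.
From mathcomp Require Import measurable_realfun.
From mathcomp Require Import ring lra.

Set Implicit Arguments.
Unset Strict Implicit.
Unset Printing Implicit Defensive.

Import Order.TTheory GRing.Theory Num.Theory.
Import numFieldNormedType.Exports.

Local Open Scope classical_set_scope.
Local Open Scope complex_scope.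
Local Open Scope ring_scope.

(** Conditional probabilities are available only as integrals over sets of the history. No
    conditional expectation is formed: a bounded history-measurable weight is cut into its level
    sets, so a bound valid for every history set passes to the weight at the cost of a constant
    factor. The marks cause two obstacles. They are positive almost surely only, so the transforms
    are built from their positive parts, which makes |M| <= 1 hold at every sample point. And the
    next arrival after a fixed time v has a random index, while independence is given for each fixed
    index; the number of arrivals up to v is therefore fixed first. As the marks may have no
    moments, every cut-off comes from the tail of a finite random variable. On a step of length h
    the accuracy o(h) is required without arrival, o(1) with one arrival and a bounded mark, and
    O(1) otherwise, because these events have probability of order 1, of order h, and small compared
    with h. *)

Local Notation normc := ComplexField.Normc.normc.

(** * Bounded random variables *)

Section bounded_expectation.
Context d (T : measurableType d) (R : realType) (P : probability T R).
Implicit Types (X Y : T -> R) (A : set T).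

(** A class closed under all the operations below and integrable for every probability, so that
    integrability becomes a matter of closure. Over a coarser measurable type with the same carrier
    it expresses measurability with respect to a sub-sigma-algebra. *)
Definition bmeas X := measurable_fun setT X /\ exists C : R, forall w, `|X w| <= C.

Lemma bmeas_integrable X : bmeas X -> P.-integrable setT (EFin \o X).
Proof.
move=> [mX [C hC]]; apply: measurable_bounded_integrable => //.
  by rewrite (le_lt_trans (probability_le1 _ _)) ?ltry.
exists C; split; first by rewrite num_real.
by move=> x Cx w _ /=; apply: le_trans (hC w) (ltW Cx).
Qed.

Lemma bmeas_cst c : bmeas (fun=> c).
Proof. by split; [exact: measurable_cst|exists `|c|]. Qed.

Lemma bmeasD X Y : bmeas X -> bmeas Y -> bmeas (fun w => X w + Y w).
Proof.
move=> [mX [C hC]] [mY [D hD]]; split; first exact: measurable_funD.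
by exists (C + D) => w; rewrite (le_trans (ler_normD _ _))// lerD.
Qed.

Lemma bmeasN X : bmeas X -> bmeas (fun w => - X w).
Proof.
move=> [mX [C hC]]; split; first exact: measurable_funN.
by exists C => w; rewrite normrN.
Qed.

Lemma bmeasB X Y : bmeas X -> bmeas Y -> bmeas (fun w => X w - Y w).
Proof. by move=> hX hY; apply: bmeasD => //; exact: bmeasN. Qed.

Lemma bmeasM X Y : bmeas X -> bmeas Y -> bmeas (fun w => X w * Y w).
Proof.
move=> [mX [C hC]] [mY [D hD]]; split; first exact: measurable_funM.
by exists (C * D) => w; rewrite normrM ler_pM.
Qed.

Lemma bmeas_indic A : measurable A -> bmeas (\1_A : T -> R).
Proof.
move=> mA; split; first exact: measurable_indic.
by exists 1 => w; rewrite indicE ger0_norm ?ler0n// lern1 leq_b1.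
Qed.

Lemma bmeas_sum (I : Type) (s : seq I) (p : pred I) (F : I -> T -> R) :
  (forall i, bmeas (F i)) -> bmeas (fun w => \sum_(i <- s | p i) F i w).
Proof.
move=> hF; elim: s => [|i s IH].
  by under eq_fun do rewrite big_nil; exact: bmeas_cst.
under eq_fun do rewrite big_cons.
by case: (p i) => //; exact: bmeasD.
Qed.

Definition Ex X : R := \int[P]_w X w.

Lemma ExD X Y : bmeas X -> bmeas Y -> Ex (fun w => X w + Y w) = Ex X + Ex Y.
Proof. by move=> hX hY; rewrite /Ex RintegralD//; exact: bmeas_integrable. Qed.

Lemma ExB_integrable X Y : P.-integrable setT (EFin \o X) ->
  P.-integrable setT (EFin \o Y) -> Ex (fun w => X w - Y w) = Ex X - Ex Y.
Proof. by move=> hX hY; rewrite /Ex RintegralB. Qed.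

Lemma ExB X Y : bmeas X -> bmeas Y -> Ex (fun w => X w - Y w) = Ex X - Ex Y.
Proof. by move=> hX hY; rewrite /Ex RintegralB//; exact: bmeas_integrable. Qed.

Lemma ExZl c X : bmeas X -> Ex (fun w => c * X w) = c * Ex X.
Proof. by move=> hX; rewrite /Ex RintegralZl//; exact: bmeas_integrable. Qed.

Lemma ExZr c X : bmeas X -> Ex (fun w => X w * c) = Ex X * c.
Proof. by move=> hX; rewrite /Ex RintegralZr//; exact: bmeas_integrable. Qed.

Lemma eq_Ex X Y : X =1 Y -> Ex X = Ex Y.
Proof. by move=> XY; congr Ex; apply/funext. Qed.

Lemma ExN X : bmeas X -> Ex (fun w => - X w) = - Ex X.
Proof.
by move=> hX; rewrite -mulN1r -ExZl//; apply: eq_Ex => w; rewrite mulN1r.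
Qed.

Lemma Ex_cst c : Ex (fun=> c) = c.
Proof. rewrite /Ex Rintegral_cst// [fine _](_ : _ = 1) ?mulr1//.
by have /= := probability_setT P => /(congr1 fine). Qed.

Lemma Ex_indic A : measurable A -> Ex \1_A = fine (P A).
Proof. by move=> mA; rewrite /Ex /Rintegral integral_indic// setIT. Qed.

Lemma le_Ex X Y : bmeas X -> bmeas Y -> (forall w, X w <= Y w) -> Ex X <= Ex Y.
Proof.
by move=> hX hY XY; apply: le_Rintegral => //; exact: bmeas_integrable.
Qed.

Lemma Ex_sum (I : Type) (s : seq I) (p : pred I) (F : I -> T -> R) :
  (forall i, bmeas (F i)) ->
  Ex (fun w => \sum_(i <- s | p i) F i w) = \sum_(i <- s | p i) Ex (F i).
Proof.
move=> hF; elim: s => [|i s IH].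
  by rewrite big_nil -[RHS]Ex_cst; apply: eq_Ex => w; rewrite big_nil.
rewrite big_cons -IH; case: ifPn => pi.
  by rewrite -ExD//; [apply: eq_Ex => w; rewrite big_cons pi|exact: bmeas_sum].
by apply: eq_Ex => w; rewrite big_cons (negbTE pi).
Qed.

Lemma Ex_norm X Y : bmeas X -> bmeas Y -> (forall w, `|X w| <= Y w) ->
  `|Ex X| <= Ex Y.
Proof.
move=> hX hY XY; rewrite ler_norml -ExN//; apply/andP; split.
  by apply: le_Ex => //; [exact: bmeasN|move=> w; have := XY w; rewrite ler_norml => /andP[]].
by apply: le_Ex => // w; have := XY w; rewrite ler_norml => /andP[].
Qed.

Lemma Ex_ae X Y : bmeas X -> bmeas Y -> {ae P, forall w, X w = Y w} ->
  Ex X = Ex Y.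
Proof.
move=> hX hY XY; rewrite /Ex /Rintegral; congr fine.
apply: ae_eq_integral => //.
- by apply/measurable_EFinP; case: hX.
- by apply/measurable_EFinP; case: hY.
- by apply: filterS XY => w -> _.
Qed.

End bounded_expectation.

Lemma indic_setE (T : Type) (R : pzRingType) (p : T -> bool) w :
  \1_[set w | p w] w = (p w)%:R :> R.
Proof.
rewrite indicE; case: (boolP (p w)) => pw; first by rewrite mem_set.
by rewrite memNset//; exact/negP.
Qed.

(** The sum counts the positive integers up to [x], so it is the integer part of [x]. *)
Lemma truncn_layers (R : realType) (N : nat) (x : R) : 0 <= x <= N%:R ->
  `|x - \sum_(k < N) (k.+1%:R <= x)%R%:R| <= 1.
Proof.
move=> /andP[x0 xN]; set n := Num.truncn x.
have /andP[nx xn] := truncn_itv x0.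
have nN : (n <= N)%N by rewrite -(ler_nat R) (le_trans nx).
rewrite [X in x - X](_ : _ = n%:R); last first.
  have -> : n%:R = \sum_(k < n) 1 :> R by rewrite sumr_const card_ord.
  rewrite (big_ord_widen _ (fun=> 1 : R) nN) [RHS]big_mkcond/=.
  apply: eq_bigr => k _; case: (ltnP k n) => kn.
    by rewrite (_ : _ <= x) ?(le_trans _ nx)// ler_nat.
  by rewrite leNgt (lt_le_trans xn)// ler_nat ltnS.
by rewrite ger0_norm ?subr_ge0// lerBlDl -natr1 in xn *; exact: ltW.
Qed.

(** * Level sets: from indicators to bounded weights *)

Section layers.
Context d (T : measurableType d) (R : realType) (P : probability T R).
Implicit Types (X Y Z : T -> R) (A : set T) (G H : set_system T).
Local Notation Ex := (Ex P).

Lemma level_measurable Z x : bmeas Z -> measurable [set w | x <= Z w].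
Proof.
by move=> [mZ _]; rewrite -[X in measurable X]setTI -preimage_itvcy; exact: mZ.
Qed.

(** A weight with values in [0,1] is nearly the average of [N] of its level indicators, and an
    average of numbers of modulus at most [c] has modulus at most [c]. *)
Lemma layer_bound01 Z Y (c : R) : bmeas Z -> bmeas Y -> (forall w, 0 <= Z w <= 1) ->
  (forall x, `|Ex (fun w => \1_[set w | x <= Z w] w * Y w)| <= c) ->
  `|Ex (fun w => Z w * Y w)| <= c.
Proof.
move=> bZ bY Z01 hc.
have [_ [C hC]] := bY.
apply/ler_addgt0Pr => /= e e0.
(* The levels are spaced [1/N], so [ZN] is within [1/N] of [Z] and the error against [Y] is at most
   [C / N <= e]. *)
pose N := (Num.truncn (C / e)).+1.
have N0 : 0 < N%:R :> R by rewrite ltr0n.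
have CN : C / N%:R <= e.
  rewrite ler_pdivrMr// mulrC -ler_pdivrMr//.
  by have /ltW := truncnS_gt (C / e).
pose ZN w : R := N%:R^-1 * \sum_(k < N) \1_[set w | k.+1%:R / N%:R <= Z w] w.
have bI k : bmeas (\1_[set w | k.+1%:R / N%:R <= Z w] : T -> R).
  exact/bmeas_indic/level_measurable.
have bZN : bmeas ZN.
  by apply: bmeasM; [exact: bmeas_cst|apply: bmeas_sum => k; exact: bI].
have ZZN w : `|Z w - ZN w| <= N%:R^-1.
  have := @truncn_layers R N (N%:R * Z w).
  have /andP[Z0 Z1] := Z01 w.
  rewrite mulr_ge0//= ger_pMr// Z1 => /(_ isT) h.
  rewrite -(ler_pM2l N0) divff ?gt_eqF// -[X in X * _]gtr0_norm// -normrM mulrBr.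
  rewrite /ZN mulrA divff ?gt_eqF// mul1r (le_trans _ h)// le_eqVlt; apply/orP; left.
  apply/eqP; congr `|_ - _|; apply: eq_bigr => k _.
  by rewrite indic_setE ler_pdivrMr// [Z w * _]mulrC.
have -> : Ex (fun w => Z w * Y w) =
    Ex (fun w => (Z w - ZN w) * Y w) + Ex (fun w => ZN w * Y w).
  rewrite -ExD; first by apply: eq_Ex => w; ring.
  - by apply: bmeasM => //; exact: bmeasB.
  - exact: bmeasM.
rewrite (le_trans (ler_normD _ _))// addrC lerD//; last first.
  apply: (le_trans _ CN); rewrite -(Ex_cst P (C / N%:R)); apply: Ex_norm.
  - by apply: bmeasM => //; exact: bmeasB.
  - exact: bmeas_cst.
  - by move=> w; rewrite normrM mulrC ler_pM.
have -> : Ex (fun w => ZN w * Y w) = N%:R^-1 *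
    \sum_(k < N) Ex (fun w => \1_[set w | k.+1%:R / N%:R <= Z w] w * Y w).
  rewrite -Ex_sum; last by move=> k; exact: bmeasM.
  rewrite -ExZl; last by apply: bmeas_sum => k; exact: bmeasM.
  by apply: eq_Ex => w; rewrite /ZN -mulrA big_distrl.
rewrite normrM gtr0_norm ?invr_gt0// ler_pdivrMl//.
rewrite (le_trans (ler_norm_sum _ _ _))//.
apply: (le_trans (ler_sum _ (fun k _ => hc _))).
by rewrite sumr_const card_ord mulr_natl.
Qed.

(** [Z] is rescaled to [U = (Z + C) / (2 C)] with values in [0,1]. Undoing this costs [2 C c] for
    the slope and [C c] for the shift: the level [- C] is the whole space, so [Ex Y] itself is
    bounded by [c]. *)
Lemma layer_bound Z Y (c C : R) : bmeas Z -> bmeas Y -> (forall w, `|Z w| <= C) ->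
  0 < C ->
  (forall x, `|Ex (fun w => \1_[set w | x <= Z w] w * Y w)| <= c) ->
  `|Ex (fun w => Z w * Y w)| <= 3 * C * c.
Proof.
move=> bZ bY hZ C0 hc.
pose U w : R := (2 * C)^-1 * (Z w + C).
have bU : bmeas U.
  by apply: bmeasM; [exact: bmeas_cst|apply: bmeasD => //; exact: bmeas_cst].
have C20 : 0 < 2 * C by rewrite mulr_gt0.
have hU : `|Ex (fun w => U w * Y w)| <= c.
  apply: layer_bound01 => // [w|x].
    have := hZ w; rewrite ler_norml => /andP[h1 h2].
    apply/andP; split; last by rewrite ler_pdivrMl//; lra.
    by apply: mulr_ge0; [rewrite invr_ge0 ltW|lra].
  rewrite [X in \1_X](_ : _ = [set w | x * (2 * C) - C <= Z w])//.
  by apply/seteqP; split => w /=; rewrite /U [_^-1 * _]mulrC ler_pdivlMr// lerBlDr.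
have hY : `|Ex Y| <= c.
  rewrite (_ : Ex Y = Ex (fun w => \1_[set w | - C <= Z w] w * Y w))//.
  apply: eq_Ex => w; rewrite indicE mem_set ?mul1r//=.
  by have := hZ w; rewrite ler_norml => /andP[].
have -> : Ex (fun w => Z w * Y w) = 2 * C * Ex (fun w => U w * Y w) - C * Ex Y.
  rewrite -!ExZl//; last exact: bmeasM.
  rewrite -ExB; last 2 first.
  - by apply: bmeasM; [exact: bmeas_cst|exact: bmeasM].
  - by apply: bmeasM => //; exact: bmeas_cst.
  by apply: eq_Ex => w; rewrite /U; field; rewrite gt_eqF.
rewrite (le_trans (ler_normB _ _))// !normrM (gtr0_norm C0) (gtr0_norm (ltr0n R 2)).
have -> : 3 * C * c = 2 * C * c + C * c by ring.
by rewrite lerD// ler_pM2l.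
Qed.

Lemma layer_orthogonal Z Y : bmeas Z -> bmeas Y ->
  (forall x, Ex (fun w => \1_[set w | x <= Z w] w * Y w) = 0) ->
  Ex (fun w => Z w * Y w) = 0.
Proof.
move=> bZ bY h; have [_ [C hC]] := bZ.
apply/eqP; rewrite -normr_le0 -(mulr0 (3 * (`|C| + 1))).
apply: layer_bound => // [w|x]; last by rewrite h normr0.
by rewrite (le_trans (hC w))// (le_trans (ler_norm _))// lerDl.
Qed.

(** Subtracting the means turns the product formula into an orthogonality, which level sets reduce
    to events: first those of [Y] against a fixed set of [G], then those of [X]. *)
Lemma ExM_indep G H X Y : independent_sigma P G H -> bmeas X -> bmeas Y ->
  (forall x, G [set w | x <= X w]) -> (forall x, H [set w | x <= Y w]) ->
  Ex (fun w => X w * Y w) = Ex X * Ex Y.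
Proof.
move=> GH bX bY GX HY.
have key A : measurable A -> G A ->
    Ex (fun w => \1_A w * Y w) = fine (P A) * Ex Y.
  move=> mA GA; apply/eqP; rewrite -subr_eq0 -ExZl// -ExB//; last 2 first.
  - by apply: bmeasM => //; exact: bmeas_indic.
  - by apply: bmeasM => //; exact: bmeas_cst.
  rewrite (@eq_Ex _ _ _ _ _ (fun w => Y w * (\1_A w - fine (P A)))); last first.
    by move=> w; ring.
  apply/eqP/layer_orthogonal => // [|x].
    by apply: bmeasB; [exact: bmeas_indic|exact: bmeas_cst].
  have mx := level_measurable x bY.
  rewrite (@eq_Ex _ _ _ _ _
    (fun w => \1_(A `&` [set w | x <= Y w]) w - fine (P A) * \1_[set w | x <= Y w] w)); last first.
    by move=> w; rewrite indicI/=; ring.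
  rewrite ExB; last 2 first.
  - by apply: bmeas_indic; exact: measurableI.
  - by apply: bmeasM; [exact: bmeas_cst|exact: bmeas_indic].
  rewrite ExZl; last exact: bmeas_indic.
  rewrite !Ex_indic//; last exact: measurableI.
  rewrite GH// fineM ?subrr//; exact: fin_num_measure.
apply/eqP; rewrite -subr_eq0 -ExZr// -ExB//; last 2 first.
- exact: bmeasM.
- by apply: bmeasM => //; exact: bmeas_cst.
rewrite (@eq_Ex _ _ _ _ _ (fun w => X w * (Y w - Ex Y))); last first.
  by move=> w; ring.
apply/eqP/layer_orthogonal => // [|x].
  by apply: bmeasB => //; exact: bmeas_cst.
have mx := level_measurable x bX.
rewrite (@eq_Ex _ _ _ _ _ (fun w => \1_[set w | x <= X w] w * Y w -
    \1_[set w | x <= X w] w * Ex Y)); last by move=> w; ring.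
have bi : bmeas (\1_[set w | x <= X w] : T -> R) by exact: bmeas_indic.
rewrite ExB; last 2 first.
- exact: bmeasM.
- by apply: bmeasM => //; exact: bmeas_cst.
by rewrite ExZr// Ex_indic// key// subrr.
Qed.

End layers.

(** * Real and complex bounds *)

Section real_bounds.
Variable R : realType.
Implicit Types (x y : R).

Lemma mean_value_bound (f df : R -> R) (K a b : R) :
  (forall x, is_derive x 1 f (df x)) -> a <= b ->
  (forall x, a <= x <= b -> `|df x| <= K) -> `|f b - f a| <= K * (b - a).
Proof.
move=> fdf ab dfK.
have [|c cab ->] := @MVT_segment R f df a b ab.
  apply: continuous_subspaceT => x.
  apply/differentiable_continuous/derivable1_diffP.
  exact: (@ex_derive _ _ _ _ _ _ _ (fdf x)).
by rewrite normrM (ger0_norm (_ : 0 <= b - a)) ?subr_ge0// ler_wpM2r ?subr_ge0// dfK.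
Qed.

Lemma lipschitz_of_derive (f df : R -> R) (K : R) :
  (forall x, is_derive x 1 f (df x)) -> (forall x, `|df x| <= K) ->
  forall x y, `|f x - f y| <= K * `|x - y|.
Proof.
move=> fdf dfK; suff h (x y : R) : x <= y -> `|f y - f x| <= K * (y - x).
  move=> x y; have [xy|/ltW yx] := leP x y.
    by rewrite distrC (distrC x) (ger0_norm (_ : 0 <= y - x)) ?subr_ge0// h.
  by rewrite (ger0_norm (_ : 0 <= x - y)) ?subr_ge0// h.
by move=> xy; apply: mean_value_bound.
Qed.

Lemma sin_lip x y : `|sin x - sin y| <= `|x - y|.
Proof.
by rewrite -[leRHS]mul1r; apply: (@lipschitz_of_derive _ cos) => // z; exact: cos_max.
Qed.

Lemma cos_lip x y : `|cos x - cos y| <= `|x - y|.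
Proof.
rewrite -[leRHS]mul1r; apply: (@lipschitz_of_derive _ (fun x => - sin x)) => // z.
by rewrite normrN sin_max.
Qed.

(** The mean value theorem on [0, z], where the sine is at most [z]. The cubic bound for the sine
    below follows from this one in the same way. *)
Lemma cosB1_bound y : `|cos y - 1| <= `|y| ^+ 2.
Proof.
suff h (z : R) : 0 <= z -> `|cos z - 1| <= z ^+ 2.
  have [y0|/ltW y0] := leP 0 y; first by rewrite (ger0_norm y0); exact: h.
  by rewrite (ler0_norm y0) -cosN; apply: h; rewrite oppr_ge0.
move=> z0; have := @mean_value_bound cos (fun x => - sin x) z 0 z (fun=> _) z0.
rewrite cos0 subr0 -expr2; apply => x /andP[x0 xz].
by rewrite normrN; have := sin_lip x 0; rewrite sin0 !subr0 (ger0_norm x0) => /le_trans; apply.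
Qed.

Lemma sinBid_bound y : `|sin y - y| <= `|y| ^+ 3.
Proof.
suff h (z : R) : 0 <= z -> `|sin z - z| <= z ^+ 3.
  have [y0|/ltW y0] := leP 0 y; first by rewrite (ger0_norm y0); exact: h.
  rewrite (ler0_norm y0) -normrN (_ : - (sin y - y) = sin (- y) - (- y)).
    by apply: h; rewrite oppr_ge0.
  by rewrite sinN; ring.
move=> z0; have := @mean_value_bound (fun x => sin x - x) (fun x => cos x - 1) (z ^+ 2) 0 z (fun=> _) z0.
rewrite sin0 !subr0 -exprSr; apply => x /andP[x0 xz].
by rewrite (le_trans (cosB1_bound x))// lerXn2r ?nnegrE// ger0_norm.
Qed.

Lemma expR_lip x y : x <= 0 -> y <= 0 -> `|expR x - expR y| <= `|x - y|.
Proof.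
suff h (a b : R) : a <= b -> b <= 0 -> `|expR b - expR a| <= b - a.
  move=> x0 y0; have [xy|/ltW yx] := leP x y.
    by rewrite distrC (distrC x) (ger0_norm (_ : 0 <= y - x)) ?subr_ge0// h.
  by rewrite (ger0_norm (_ : 0 <= x - y)) ?subr_ge0// h.
move=> ab b0; rewrite -[leRHS]mul1r.
apply: (@mean_value_bound expR expR) => // c /andP[_ cb].
by rewrite ger0_norm ?expR_ge0// expR_le1 (le_trans cb).
Qed.

(** From [expR (- x) >= 1 - x] follows [expR x * (1 - x) <= 1], hence
    [(expR x - 1 - x) * (1 - x) <= x ^+ 2], and [1 - x] is at least one half. *)
Lemma expR_bound2 x : `|x| <= 2^-1 -> `|expR x - 1 - x| <= 2 * `|x| ^+ 2.
Proof.
move=> hx; have /andP[x1 x2] : - 2^-1 <= x <= 2^-1 by rewrite -ler_norml.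
have h1 := expR_ge1Dx x.
have h2 := expR_ge1Dx (- x).
have h3 : expR x * expR (- x) = 1 by rewrite -expRD subrr expR0.
have e0 := expR_gt0 x.
have h4 : expR x * (1 - x) <= expR x * expR (- x) by rewrite ler_pM2l.
rewrite h3 in h4.
rewrite ger0_norm; last by lra.
rewrite real_normK ?num_real//.
have : (expR x - 1 - x) * (1 - x) <= x ^+ 2 by nra.
have : 0 <= expR x - 1 - x by lra.
by nra.
Qed.

End real_bounds.

Section complex_bounds.
Variable R : realType.
Implicit Types (a b x y : R[i]).

Lemma normc_ge_Re x : `|complex.Re x| <= normc x.
Proof.
case: x => u v /=; rewrite -[leLHS]ger0_norm// -sqrtr_sqr ler_wsqrtr//.
by rewrite real_normK ?num_real// lerDl sqr_ge0.
Qed.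

Lemma normc_ge_Im x : `|complex.Im x| <= normc x.
Proof.
case: x => u v /=; rewrite -[leLHS]ger0_norm// -sqrtr_sqr ler_wsqrtr//.
by rewrite real_normK ?num_real// lerDr sqr_ge0.
Qed.

Lemma normc_le_ReIm x : normc x <= `|complex.Re x| + `|complex.Im x|.
Proof.
case: x => u v /=.
have uv0 : 0 <= `|u| + `|v| by rewrite addr_ge0.
rewrite -(ger0_norm uv0) -sqrtr_sqr ler_wsqrtr// sqrrD.
by rewrite !real_normK ?num_real// -addrA lerD2l lerDr mulrn_wge0//.
Qed.

Lemma normc_ge0 x : 0 <= normc x.
Proof. by rewrite (le_trans _ (normc_ge_Re x)). Qed.

Lemma normc_real (r : R) : normc r%:C = `|r|.
Proof. by rewrite /= expr0n/= addr0 sqrtr_sqr. Qed.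

Lemma normcE_norm x : `|x| = (normc x)%:C.
Proof. by []. Qed.

Lemma normcX x n : normc (x ^+ n) = normc x ^+ n.
Proof.
elim: n => [|n IH]; first by rewrite !expr0 ComplexField.Normc.normc1.
by rewrite !exprS ComplexField.Normc.normcM IH.
Qed.

Lemma normcBC x y : normc (x - y) = normc (y - x).
Proof. by rewrite -normcN opprB. Qed.

Lemma le_normcB x y : normc (x - y) <= normc x + normc y.
Proof. by rewrite (le_trans (le_normcD _ _))// normcN. Qed.

Lemma cexp0 : cexp (0 : R[i]) = 1.
Proof. by rewrite /cexp/= expR0 cos0 sin0 mul1r. Qed.

Lemma cexpD x y : cexp (x + y) = cexp x * cexp y.
Proof.
case: x => a b; case: y => c d; rewrite /cexp /= expRD cosD sinD.
by apply/eqP; rewrite eq_complex/=; apply/andP; split; apply/eqP; ring.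
Qed.

Lemma normc_cexp x : normc (cexp x) = expR (complex.Re x).
Proof.
rewrite /cexp ComplexField.Normc.normcM normc_real ger0_norm ?expR_ge0//.
by rewrite /= cos2Dsin2 sqrtr1 mulr1.
Qed.

Lemma normc_cexp_le1 x : complex.Re x <= 0 -> normc (cexp x) <= 1.
Proof. by rewrite normc_cexp expR_le1. Qed.

Lemma ReD x y : complex.Re (x + y) = complex.Re x + complex.Re y.
Proof. by case: x; case: y. Qed.

Lemma ImD x y : complex.Im (x + y) = complex.Im x + complex.Im y.
Proof. by case: x; case: y. Qed.

Lemma ReB x y : complex.Re (x - y) = complex.Re x - complex.Re y.
Proof. by case: x; case: y. Qed.

Lemma ImB x y : complex.Im (x - y) = complex.Im x - complex.Im y.
Proof. by case: x; case: y. Qed.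

Lemma cReN x : complex.Re (- x) = - complex.Re x.
Proof. by case: x. Qed.

Lemma cImN x : complex.Im (- x) = - complex.Im x.
Proof. by case: x. Qed.

Lemma cReM x y : complex.Re (x * y) =
  complex.Re x * complex.Re y - complex.Im x * complex.Im y.
Proof. by case: x; case: y. Qed.

Lemma cImM x y : complex.Im (x * y) =
  complex.Re x * complex.Im y + complex.Im x * complex.Re y.
Proof. by case: x; case: y. Qed.

Lemma ReMr x (r : R) : complex.Re (x * r%:C) = complex.Re x * r.
Proof. by rewrite cReM/= mulr0 subr0. Qed.

Lemma ImMr x (r : R) : complex.Im (x * r%:C) = complex.Im x * r.
Proof. by rewrite cImM/= mulr0 add0r. Qed.

(** The constant 3 is 1 for the change of modulus plus 1 each for the cosine and the sine. *)
Lemma cexp_lip a b : complex.Re a <= 0 -> complex.Re b <= 0 ->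
  normc (cexp a - cexp b) <= 3 * normc (a - b).
Proof.
move: a b => [u v] [u' v'] u0 u'0; rewrite /= in u0 u'0.
have -> : cexp (u +i* v) - cexp (u' +i* v') =
    (expR u - expR u')%:C * (cos v +i* sin v) +
    (expR u')%:C * ((cos v - cos v') +i* (sin v - sin v')).
  by rewrite /cexp/=; apply/eqP; rewrite eq_complex/=; apply/andP; split; apply/eqP; ring.
rewrite (le_trans (le_normcD _ _))// !ComplexField.Normc.normcM !normc_real.
rewrite (_ : normc (cos v +i* sin v) = 1) ?mulr1; last first.
  by rewrite /= cos2Dsin2 sqrtr1.
have h1 := le_trans (expR_lip u0 u'0) (normc_ge_Re ((u +i* v) - (u' +i* v'))).
have h2 := normc_ge_Im ((u +i* v) - (u' +i* v')).
rewrite /= in h2.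
set n := normc _ in h1 h2 *; rewrite (_ : 3 * n = n + 1 * (2 * n)); last by ring.
rewrite lerD// ler_pM ?normr_ge0 ?normc_ge0//.
  by rewrite ger0_norm ?expR_ge0// expR_le1.
rewrite (le_trans (normc_le_ReIm _))// mulr_natl mulr2n lerD//=.
  by rewrite (le_trans (cos_lip _ _)).
by rewrite (le_trans (sin_lip _ _)).
Qed.

(** The constant 7 collects 2 + 2 from the real part (the real exponential, then the cosine with
    [expR x <= 2]) and 2 + 1 from the imaginary part ([expR x - 1] times the sine, then the cubic
    remainder of the sine). *)
Lemma cexp_bound2 a : normc a <= 2^-1 ->
  normc (cexp a - 1 - a) <= 7 * normc a ^+ 2.
Proof.
move=> ha.
have hx := le_trans (normc_ge_Re a) ha.
have hy := le_trans (normc_ge_Im a) ha.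
have nx := normc_ge_Re a; have ny := normc_ge_Im a.
case: a ha hx hy nx ny => x y; set n := normc _ => ha hx hy nx ny.
rewrite [complex.Re _]/= in hx nx; rewrite [complex.Im _]/= in hy ny.
have E1 := expR_bound2 hx.
have C1 := cosB1_bound y.
have S1 := sinBid_bound y.
have S0 : `|sin y| <= `|y| by have := sin_lip y 0; rewrite sin0 !subr0.
have n0 : 0 <= n by exact: normc_ge0.
have x2 : `|x| ^+ 2 <= n ^+ 2 by rewrite lerXn2r ?nnegrE.
have y2 : `|y| ^+ 2 <= n ^+ 2 by rewrite lerXn2r ?nnegrE.
have Ex2 : `|expR x| <= 2.
  rewrite ger0_norm ?expR_ge0//; move: E1 hx.
  rewrite !ler_norml => /andP[_ E1] /andP[h1 h2]; move: E1.
  by rewrite real_normK ?num_real//; nra.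
have ReE : complex.Re (cexp (x +i* y) - 1 - (x +i* y)) =
    (expR x - 1 - x) + expR x * (cos y - 1).
  by rewrite /cexp/=; ring.
have ImE : complex.Im (cexp (x +i* y) - 1 - (x +i* y)) =
    (expR x - 1) * sin y + (sin y - y).
  by rewrite /cexp/=; ring.
rewrite (le_trans (normc_le_ReIm _))// ReE ImE.
have -> : 7 * n ^+ 2 = (2 * n ^+ 2 + 2 * n ^+ 2) + (2 * n * n + n ^+ 2) by ring.
have E2 : `|expR x - 1| <= 2 * n.
  rewrite (_ : expR x - 1 = (expR x - 1 - x) + x); last by ring.
  by rewrite (le_trans (ler_normD _ _))//; nra.
rewrite lerD// (le_trans (ler_normD _ _))// lerD//.
- by rewrite (le_trans E1)// ler_pM2l.
- by rewrite normrM ler_pM// (le_trans C1).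
- by rewrite normrM ler_pM// (le_trans S0).
- rewrite (le_trans S1)// exprSr (le_trans _ y2)// ler_piMr ?sqr_ge0//.
  by rewrite (le_trans hy)//; lra.
Qed.

End complex_bounds.

(** * Complex-valued random variables and their means *)

Section complex_expectation.
Context d (T : measurableType d) (R : realType).
Implicit Types (X Y : T -> R[i]) (A : set T).

Definition cbmeas X :=
  bmeas (fun w => complex.Re (X w)) /\ bmeas (fun w => complex.Im (X w)).

Lemma cbmeas_cst c : cbmeas (fun=> c).
Proof. by split; exact: bmeas_cst. Qed.

Lemma cbmeasD X Y : cbmeas X -> cbmeas Y -> cbmeas (fun w => X w + Y w).
Proof.
move=> [X1 X2] [Y1 Y2]; split.
  by under eq_fun do rewrite ReD; exact: bmeasD.
by under eq_fun do rewrite ImD; exact: bmeasD.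
Qed.

Lemma cbmeasN X : cbmeas X -> cbmeas (fun w => - X w).
Proof.
move=> [X1 X2]; split.
  by under eq_fun do rewrite cReN; exact: bmeasN.
by under eq_fun do rewrite cImN; exact: bmeasN.
Qed.

Lemma cbmeasB X Y : cbmeas X -> cbmeas Y -> cbmeas (fun w => X w - Y w).
Proof. by move=> hX hY; apply: cbmeasD => //; exact: cbmeasN. Qed.

Lemma cbmeasM X Y : cbmeas X -> cbmeas Y -> cbmeas (fun w => X w * Y w).
Proof.
move=> [X1 X2] [Y1 Y2]; split.
  by under eq_fun do rewrite cReM; apply: bmeasB; exact: bmeasM.
by under eq_fun do rewrite cImM; apply: bmeasD; exact: bmeasM.
Qed.

Lemma cbmeas_real (X : T -> R) : bmeas X -> cbmeas (fun w => (X w)%:C).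
Proof. by move=> hX; split => //=; exact: bmeas_cst. Qed.

Lemma cbmeas_indic A : measurable A -> cbmeas (fun w => (\1_A w)%:C).
Proof. by move=> mA; apply: cbmeas_real; exact: bmeas_indic. Qed.

Lemma cbmeas_sum (I : Type) (s : seq I) (p : pred I) (F : I -> T -> R[i]) :
  (forall i, cbmeas (F i)) -> cbmeas (fun w => \sum_(i <- s | p i) F i w).
Proof.
move=> hF; elim: s => [|i s IH].
  by under eq_fun do rewrite big_nil; exact: cbmeas_cst.
under eq_fun do rewrite big_cons.
by case: (p i) => //; exact: cbmeasD.
Qed.

Lemma cbmeas_prod (I : Type) (s : seq I) (p : pred I) (F : I -> T -> R[i]) :
  (forall i, cbmeas (F i)) -> cbmeas (fun w => \prod_(i <- s | p i) F i w).
Proof.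
move=> hF; elim: s => [|i s IH].
  by under eq_fun do rewrite big_nil; exact: cbmeas_cst.
under eq_fun do rewrite big_cons.
by case: (p i) => //; exact: cbmeasM.
Qed.

(** Boundedness is dropped because the transform of the actual marks may be unbounded on the null
    set where a mark is negative; [Ec_ae] then compares it with a bounded one. *)
Definition cmeas X := measurable_fun setT (fun w => complex.Re (X w)) /\
  measurable_fun setT (fun w => complex.Im (X w)).

Lemma cmeasM X Y : cmeas X -> cmeas Y -> cmeas (fun w => X w * Y w).
Proof.
move=> [X1 X2] [Y1 Y2]; split.
  under eq_fun do rewrite cReM.
  by apply: measurable_funB; exact: measurable_funM.
under eq_fun do rewrite cImM.
by apply: measurable_funD; exact: measurable_funM.
Qed.

Lemma cbmeasP X (C : R) : cmeas X -> (forall w, normc (X w) <= C) -> cbmeas X.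
Proof.
move=> [X1 X2] XC; split; split=> //; exists C => w.
  exact: le_trans (normc_ge_Re _) (XC w).
exact: le_trans (normc_ge_Im _) (XC w).
Qed.

Lemma cmeas_cexp X : cmeas X -> cmeas (fun w => cexp (X w)).
Proof.
move=> [mU mV].
have mE : measurable_fun setT (fun w => expR (complex.Re (X w))).
  exact: measurableT_comp.
have mc : measurable_fun setT (fun w => cos (complex.Im (X w))).
  apply: (@measurableT_comp _ _ _ _ _ _ cos) => //.
  by apply: continuous_measurable_fun; exact: continuous_cos.
have ms : measurable_fun setT (fun w => sin (complex.Im (X w))).
  apply: (@measurableT_comp _ _ _ _ _ _ sin) => //.
  by apply: continuous_measurable_fun; exact: continuous_sin.
split.
  rewrite (_ : (fun _ => _) = (fun w => expR (complex.Re (X w)) * cos (complex.Im (X w)))).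
    exact: measurable_funM.
  by apply/funext => w; rewrite /cexp cReM/= mul0r subr0.
rewrite (_ : (fun _ => _) = (fun w => expR (complex.Re (X w)) * sin (complex.Im (X w)))).
  exact: measurable_funM.
by apply/funext => w; rewrite /cexp cImM/= mul0r addr0.
Qed.

Lemma cmeas_scale (s : R[i]) (L : T -> R) : measurable_fun setT L ->
  cmeas (fun w => s * (L w)%:C).
Proof.
move=> mL; split.
  under eq_fun do rewrite ReMr.
  by apply: measurable_funM => //; exact: measurable_cst.
under eq_fun do rewrite ImMr.
by apply: measurable_funM => //; exact: measurable_cst.
Qed.

Lemma cbmeas_cexpNM (s : R[i]) (L : T -> R) : 0 <= complex.Re s ->
  measurable_fun setT L -> (forall w, 0 <= L w) ->
  cbmeas (fun w => cexp (- s * (L w)%:C)).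
Proof.
move=> s0 mL L0; apply: (@cbmeasP _ 1).
  exact/cmeas_cexp/cmeas_scale.
move=> w; apply: normc_cexp_le1.
by rewrite ReMr cReN mulNr oppr_le0 mulr_ge0.
Qed.

Variable P : probability T R.
Local Notation Ex := (Ex P).
Local Notation Ec := (cexpectation P).

Lemma EcE X : Ec X = Ex (fun w => complex.Re (X w)) +i* Ex (fun w => complex.Im (X w)).
Proof. by rewrite /cexpectation unlock. Qed.

Lemma eq_Ec X Y : X =1 Y -> Ec X = Ec Y.
Proof. by move=> XY; congr cexpectation; apply/funext. Qed.

Lemma EcD X Y : cbmeas X -> cbmeas Y -> Ec (fun w => X w + Y w) = Ec X + Ec Y.
Proof.
move=> [X1 X2] [Y1 Y2]; rewrite !EcE.
apply/eqP; rewrite eq_complex/=; apply/andP; split; apply/eqP.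
  by rewrite -ExD//; apply: eq_Ex => w; rewrite ReD.
by rewrite -ExD//; apply: eq_Ex => w; rewrite ImD.
Qed.

Lemma EcN X : cbmeas X -> Ec (fun w => - X w) = - Ec X.
Proof.
move=> [X1 X2]; rewrite !EcE.
apply/eqP; rewrite eq_complex/=; apply/andP; split; apply/eqP.
  by rewrite -ExN//; apply: eq_Ex => w; rewrite cReN.
by rewrite -ExN//; apply: eq_Ex => w; rewrite cImN.
Qed.

Lemma EcB X Y : cbmeas X -> cbmeas Y -> Ec (fun w => X w - Y w) = Ec X - Ec Y.
Proof. by move=> hX hY; rewrite EcD ?EcN//; exact: cbmeasN. Qed.

Lemma EcZr c X : cbmeas X -> Ec (fun w => X w * c) = Ec X * c.
Proof.
move=> [X1 X2]; rewrite !EcE.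
apply/eqP; rewrite eq_complex; apply/andP; split; apply/eqP.
  rewrite cReM/= -!ExZr// -ExB//; try by apply: bmeasM => //; exact: bmeas_cst.
  by apply: eq_Ex => w; rewrite cReM.
rewrite cImM/= -!ExZr// -ExD//; try by apply: bmeasM => //; exact: bmeas_cst.
by apply: eq_Ex => w; rewrite cImM.
Qed.

Lemma EcZl c X : cbmeas X -> Ec (fun w => c * X w) = c * Ec X.
Proof.
by move=> hX; rewrite mulrC -EcZr//; apply: eq_Ec => w; rewrite mulrC.
Qed.

Lemma Ec_cst c : Ec (fun=> c) = c.
Proof. by rewrite EcE !Ex_cst; case: c. Qed.

Lemma Ec_real (X : T -> R) : Ec (fun w => (X w)%:C) = (Ex X)%:C.
Proof. by rewrite EcE/= Ex_cst. Qed.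

Lemma Ec_sum (I : Type) (s : seq I) (p : pred I) (F : I -> T -> R[i]) :
  (forall i, cbmeas (F i)) ->
  Ec (fun w => \sum_(i <- s | p i) F i w) = \sum_(i <- s | p i) Ec (F i).
Proof.
move=> hF; elim: s => [|i s IH].
  by rewrite big_nil -[RHS]Ec_cst; apply: eq_Ec => w; rewrite big_nil.
rewrite big_cons -IH; case: ifPn => pi.
  by rewrite -EcD//; [apply: eq_Ec => w; rewrite big_cons pi|exact: cbmeas_sum].
by apply: eq_Ec => w; rewrite big_cons (negbTE pi).
Qed.

(* Pairing with the conjugate of the mean itself gives the sharp constant. *)
Lemma normc_Ec X (Y : T -> R) : cbmeas X -> bmeas Y ->
  (forall w, normc (X w) <= Y w) -> normc (Ec X) <= Ex Y.
Proof.
move=> bX bY XY; set c := Ec X.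
have [->|c0] := eqVneq c 0.
  rewrite ComplexField.Normc.normc0; have := @le_Ex _ _ _ P (fun=> 0) Y.
  rewrite Ex_cst; apply => // [|w]; first exact: bmeas_cst.
  by rewrite (le_trans _ (XY w))// normc_ge0.
have nc0 : 0 < normc c.
  rewrite lt_neqAle normc_ge0 andbT; apply: contra_neq c0 => /esym.
  exact: ComplexField.Normc.eq0_normc.
have nJ : normc (conjc c) = normc c by case: (c) => u v /=; rewrite sqrrN.
have cc : complex.Re (conjc c * c) = normc c * normc c.
  by rewrite -expr2; case: (c) => u v /=; rewrite sqr_sqrtr ?addr_ge0 ?sqr_ge0//; ring.
rewrite -(ler_pM2l nc0) -cc -EcZl// EcE/= -ExZl//.
have bJX : cbmeas (fun w => conjc c * X w).
  by apply: cbmeasM => //; exact: cbmeas_cst.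
apply: le_Ex => [||w]; first by case: bJX.
- by apply: bmeasM => //; exact: bmeas_cst.
- rewrite (le_trans (ler_norm _))// (le_trans (normc_ge_Re _))//.
  by rewrite ComplexField.Normc.normcM nJ ler_pM2l.
Qed.

Lemma Ec_ae X Y : cmeas X -> cbmeas Y ->
  {ae P, forall w, X w = Y w} -> Ec X = Ec Y.
Proof.
move=> [mX1 mX2] [[mY1 _] [mY2 _]] XY; rewrite !EcE /Ex /Rintegral.
congr (fine _ +i* fine _); apply: ae_eq_integral => //.
all: try exact/measurable_EFinP.
all: by apply: filterS XY => w -> _.
Qed.

(** The complementary distribution function of a real random variable vanishes at infinity. This
    stands in for Markov's inequality, in the absence of moments. *)
Lemma tail_small (F : T -> R) (e : R) : measurable_fun setT F -> 0 < e ->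
  exists2 K : R, 0 < K & Ex \1_[set w | K < F w] <= e.
Proof.
move=> mF e0; have mF' := mF.
pose X : {RV P >-> R} := HB.pack F (isMeasurableFun.Build _ _ _ _ F mF).
have := cvg_ccdfy0 X => /fine_cvgP[_ /cvgrPdist_le/(_ e e0)].
move=> /(filterI (nbhs_pinfty_gt (num_real (0 : R)))) [M [_ hM]].
have M1 : M < M + 1 by rewrite ltrDl.
have /= [K0] := hM _ M1.
rewrite sub0r normrN => hK; exists (M + 1) => //.
rewrite Ex_indic; last by rewrite -[X in measurable X]setTI -preimage_itvoy; exact: mF'.
apply: le_trans hK; rewrite -preimage_itvoy.
exact: ler_norm.
Qed.

End complex_expectation.

(** * Sub-sigma-algebras, independence and equality in law *)

Section sub_sigma_algebra.
Context d (T : measurableType d) (R : realType).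
Implicit Types (G H : set_system T).

Lemma sigma_sub_measurable G : G `<=` measurable -> <<s G >> `<=` measurable.
Proof. by move=> GM; apply: smallest_sub => //; exact: sigma_algebra_measurable. Qed.

Lemma bmeas_sub G (X : T -> R) : G `<=` measurable ->
  @bmeas _ (g_sigma_algebraType G) R X -> @bmeas _ T R X.
Proof.
move=> GM [mX bX]; split=> // _ Y mY.
by apply: (sigma_sub_measurable GM); exact: mX.
Qed.

Lemma cbmeas_sub G (X : T -> R[i]) : G `<=` measurable ->
  @cbmeas _ (g_sigma_algebraType G) R X -> @cbmeas _ T R X.
Proof. by move=> GM [X1 X2]; split; exact: (bmeas_sub GM). Qed.

Variable P : probability T R.
Local Notation Ex := (Ex P).
Local Notation Ec := (cexpectation P).

Lemma ExM_indep_sigma G H (X Y : T -> R) : G `<=` measurable -> H `<=` measurable ->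
  independent_sigma P <<s G >> <<s H >> ->
  @bmeas _ (g_sigma_algebraType G) R X -> @bmeas _ (g_sigma_algebraType H) R Y ->
  Ex (fun w => X w * Y w) = Ex X * Ex Y.
Proof.
move=> GM HM GH bX bY; apply: (ExM_indep GH).
- exact: (bmeas_sub GM).
- exact: (bmeas_sub HM).
- by move=> x; exact: (level_measurable x bX).
- by move=> x; exact: (level_measurable x bY).
Qed.

Lemma EcM_indep G H (X Y : T -> R[i]) : G `<=` measurable -> H `<=` measurable ->
  independent_sigma P <<s G >> <<s H >> ->
  @cbmeas _ (g_sigma_algebraType G) R X -> @cbmeas _ (g_sigma_algebraType H) R Y ->
  Ec (fun w => X w * Y w) = Ec X * Ec Y.
Proof.
move=> GM HM GH [X1 X2] [Y1 Y2].
have bX1 := bmeas_sub GM X1; have bX2 := bmeas_sub GM X2.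
have bY1 := bmeas_sub HM Y1; have bY2 := bmeas_sub HM Y2.
have ind := ExM_indep_sigma GM HM GH.
rewrite !EcE; apply/eqP; rewrite eq_complex; apply/andP; split; apply/eqP.
  rewrite cReM/= -(ind _ _ X1 Y1) -(ind _ _ X2 Y2) -ExB; try exact: bmeasM.
  by apply: eq_Ex => w; rewrite cReM.
rewrite cImM/= -(ind _ _ X1 Y2) -(ind _ _ X2 Y1) -ExD; try exact: bmeasM.
by apply: eq_Ex => w; rewrite cImM.
Qed.

Lemma Ex_same_law (X Y : {RV P >-> R}) (f : R -> R) :
  (forall A : set R, measurable A -> distribution P X A = distribution P Y A) ->
  bmeas f -> Ex (f \o X) = Ex (f \o Y).
Proof.
move=> XY bf.
have bc (Z : {RV P >-> R}) : bmeas (f \o Z).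
  have [mf [C hC]] := bf; split; first exact: measurableT_comp.
  by exists C => w; exact: hC.
have mf : measurable_fun setT (EFin \o f) by apply/measurable_EFinP; case: bf.
rewrite /Ex /Rintegral; congr fine.
rewrite -[LHS](@integral_distribution _ _ _ _ _ P X (EFin \o f))//; last first.
  exact: (bmeas_integrable P (bc X)).
rewrite -[RHS](@integral_distribution _ _ _ _ _ P Y (EFin \o f))//; last first.
  exact: (bmeas_integrable P (bc Y)).
by apply: eq_measure_integral => A mA _; exact: XY.
Qed.

Lemma Ec_same_law (X Y : {RV P >-> R}) (f : R -> R[i]) :
  (forall A : set R, measurable A -> distribution P X A = distribution P Y A) ->
  cbmeas f -> Ec (f \o X) = Ec (f \o Y).
Proof.
move=> XY [f1 f2]; rewrite !EcE.
by congr (_ +i* _); [exact: (Ex_same_law XY f1)|exact: (Ex_same_law XY f2)].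
Qed.

End sub_sigma_algebra.

(** * The transform of the mark *)

Section laplace.
Context d (T : measurableType d) (R : realType) (P : probability T R).
Variable B : {RV P >-> R}.
Hypothesis B_gt0 : P [set w | 0 < B w] = 1%E.
Local Notation Ex := (Ex P).
Local Notation Ec := (cexpectation P).

Lemma ae_gt0 : {ae P, forall w, 0 < B w}.
Proof.
have mB : measurable [set w | 0 < B w].
  by rewrite -[X in measurable X]setTI -preimage_itvoy; exact: measurable_funP.
exists (~` [set w | 0 < B w]); split=> //; first exact: measurableC.
by rewrite probability_setC// B_gt0 subee.
Qed.

Definition cpart (x : R) : R := Num.max 0 x.

Lemma cpart_ge0 x : 0 <= cpart x.
Proof. by rewrite /cpart le_max lexx. Qed.

Lemma measurable_cpart : measurable_fun setT cpart.
Proof. by apply: measurable_maxr; [exact: measurable_cst|exact: measurable_id]. Qed.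

Lemma cpart_gt0 x : 0 < x -> cpart x = x.
Proof. by move=> x0; rewrite /cpart max_r// ltW. Qed.

Lemma measurable_cpartB : measurable_fun setT (fun w => cpart (B w)).
Proof. by apply: measurableT_comp => //; exact: measurable_cpart. Qed.

Lemma cbmeas_cexpB s : 0 <= complex.Re s ->
  cbmeas (fun w => cexp (- s * (cpart (B w))%:C)).
Proof.
move=> s0; apply: cbmeas_cexpNM => //; first exact: measurable_cpartB.
by move=> w; exact: cpart_ge0.
Qed.

Lemma betaE s : 0 <= complex.Re s ->
  beta B s = Ec (fun w => cexp (- s * (cpart (B w))%:C)).
Proof.
move=> s0; apply: Ec_ae; last by apply: filterS ae_gt0 => w /cpart_gt0 ->.
  by apply/cmeas_cexp/cmeas_scale; exact: measurable_funP.
exact: cbmeas_cexpB.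
Qed.

Lemma normc_beta s : 0 <= complex.Re s -> normc (beta B s) <= 1.
Proof.
move=> s0; rewrite betaE//; rewrite -[leRHS](Ex_cst P); apply: normc_Ec.
- exact: cbmeas_cexpB.
- exact: bmeas_cst.
- move=> w; apply: normc_cexp_le1.
  by rewrite ReMr cReN mulNr oppr_le0 mulr_ge0// cpart_ge0.
Qed.

(** Where [B <= K] the exponential is Lipschitz in its parameter with constant [3 K]; the remaining
    event has small probability and there the difference is at most 2. As [K] depends on the tail of
    [B] only, the modulus is uniform over the half-plane. *)
Lemma beta_ucont (e : R) : 0 < e -> exists2 del : R, 0 < del &
  forall x y, 0 <= complex.Re x -> 0 <= complex.Re y ->
  normc (x - y) <= del -> normc (beta B x - beta B y) <= e.
Proof.
move=> e0; have e4 : 0 < e / 4 by rewrite divr_gt0.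
have [K K0 hK] := tail_small P measurable_cpartB e4.
(* Then [3 * K * del = e / 2], and the tail contributes [2 * (e / 4)]. *)
exists (e / (6 * K)); first by rewrite divr_gt0// mulr_gt0.
move=> x y x0 y0 xy; rewrite !betaE// -EcB; try exact: cbmeas_cexpB.
have mK : measurable [set w | K < cpart (B w)].
  by rewrite -[X in measurable X]setTI -preimage_itvoy; exact: measurable_cpartB.
have bK := bmeas_indic R mK.
have bY : bmeas (fun w => e / 2 + 2 * \1_[set w | K < cpart (B w)] w).
  by apply: bmeasD; [exact: bmeas_cst|apply: bmeasM => //; exact: bmeas_cst].
have -> : e = Ex (fun=> e / 2) + 2 * (e / 4) by rewrite Ex_cst; field.
apply: (@le_trans _ _ (Ex (fun w => e / 2 + 2 * \1_[set w | K < cpart (B w)] w))).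
  apply: normc_Ec => //; first by apply: cbmeasB; exact: cbmeas_cexpB.
  move=> w; rewrite indic_setE; have b0 := cpart_ge0 (B w).
  have hr s : 0 <= complex.Re s -> complex.Re (- s * (cpart (B w))%:C) <= 0.
    by move=> s0; rewrite ReMr cReN mulNr oppr_le0 mulr_ge0.
  case: ltP => Kw; rewrite ?mulr1 ?mulr0 ?addr0.
    rewrite (le_trans (le_normcB _ _))// (@le_trans _ _ (1 + 1))//.
      by rewrite lerD// normc_cexp_le1// hr.
    by rewrite -[leLHS]add0r lerD// divr_ge0// ltW.
  rewrite (le_trans (cexp_lip _ _)) ?hr//.
  rewrite -mulrBl opprK addrC ComplexField.Normc.normcM normcBC normc_real.
  rewrite (ger0_norm b0).
  rewrite (@le_trans _ _ (3 * (e / (6 * K) * K)))//.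
    by rewrite ler_pM2l// ler_pM// ?normc_ge0.
  by rewrite le_eqVlt; apply/orP; left; apply/eqP; field; rewrite gt_eqF.
rewrite ExD//; last 2 first.
- exact: bmeas_cst.
- by apply: bmeasM => //; exact: bmeas_cst.
by rewrite lerD2l ExZl// ler_pM2l.
Qed.

End laplace.

(** * Derivatives relative to an interval *)

Section within_derivative.
Variable R : realType.

(** Cleared of the division, the expansion also makes sense at [v = u], and it can be passed to
    limits and combined with norms. *)
Lemma within_derivP (D : set R) (f : R -> R) (u l : R) :
  ((v - u)^-1 * (f v - f u) @[v --> within D u^'] --> l) <->
  (forall e : R, 0 < e -> exists2 del : R, 0 < del &
     forall v, D v -> `|v - u| <= del ->
     `|f v - f u - (v - u) * l| <= e * `|v - u|).
Proof.
have key (v e : R) : v != u ->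
    (`|l - (v - u)^-1 * (f v - f u)| <= e) = (`|f v - f u - (v - u) * l| <= e * `|v - u|).
  rewrite -subr_eq0 => vu.
  rewrite -ler_pdivrMr ?normr_gt0// -normrV ?unitfE// -normrM distrC.
  congr (`|_| <= _); field.
  exact: vu.
split.
- move=> /cvgrPdist_le h e e0.
  have /nbhs_ballP[del /= del0 hdel] := h e e0.
  (* Half the radius fits the closed ball of the statement into the open ball of the
     neighbourhood. *)
  exists (del / 2); first by rewrite divr_gt0.
  move=> v Dv vu; have [->|neq] := eqVneq v u.
    by rewrite !subrr mul0r subr0 normr0 mulr0.
  rewrite -key//; apply: hdel => //.
  rewrite /ball/= distrC (le_lt_trans vu)// ltr_pdivrMr// ltr_pMr//.
  by rewrite ltr1n.
- move=> h; apply/cvgrPdist_le => e e0.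
  have [del del0 hdel] := h e e0.
  apply/nbhs_ballP; exists del => //= v uv neq Dv.
  by rewrite key// hdel// distrC ltW.
Qed.

Lemma cderiv_withinP (D : set R) (f : R -> R[i]) (u : R) (l : R[i]) :
  (forall e : R, 0 < e -> exists2 del : R, 0 < del &
     forall v, D v -> `|v - u| <= del ->
     normc (f v - f u - (v - u)%:C * l) <= e * `|v - u|) <->
  cderiv_within D f u l.
Proof.
split.
  move=> h; split; apply/within_derivP => e e0; have [del del0 hdel] := h e e0;
    exists del => // v Dv vu; apply: le_trans (hdel v Dv vu).
    by apply: le_trans (normc_ge_Re _); rewrite !ReB cReM/= mul0r subr0.
  by apply: le_trans (normc_ge_Im _); rewrite !ImB cImM/= mul0r addr0.
move=> [/within_derivP h1 /within_derivP h2] e e0.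
have e20 : 0 < e / 2 by rewrite divr_gt0.
have [d1 d10 hd1] := h1 _ e20; have [d2 d20 hd2] := h2 _ e20.
exists (Num.min d1 d2); first by rewrite lt_min d10.
move=> v Dv; rewrite le_min => /andP[vd1 vd2].
rewrite (le_trans (normc_le_ReIm _))// (splitr e) mulrDl lerD//.
  by rewrite !ReB cReM/= mul0r subr0; exact: hd1.
by rewrite !ImB cImM/= mul0r addr0; exact: hd2.
Qed.

End within_derivative.

(** * Limits along an ultrafilter *)

Section ultralimit.
Variable R : realType.

(** Compactness of the segment. One ultrafilter serves all bounded sequences at once, which replaces
    the extraction of a diagonal subsequence in the usual proof of Peano's theorem. *)
Lemma ultra_bounded_cvg (U : set_system nat) (a : nat -> R) (C : R) :
  UltraFilter U -> (forall n, `|a n| <= C) ->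
  exists l : R, forall e : R, 0 < e -> U [set n | `|a n - l| <= e].
Proof.
move=> UU aC.
have ultra : UltraFilter (a @ U).
  split; first exact: fmap_proper_filter.
  move=> G PG UG; apply/seteqP; split => // A GA; have [//|UA] := in_ultra_setVsetC (a @^-1` A) UU.
  have : G (~` A) by apply: UG.
  move=> /(filterI GA); rewrite setICr => G0.
  by have := @filter_not_empty _ _ PG.
have := @segment_compact R (- C) C; rewrite compact_ultra => /(_ (a @ U) ultra).
case.
  rewrite /nbhs/=; apply: filterS filterT => n _ /=.
  by rewrite in_itv/= -ler_norml aC.
move=> l [_ al]; exists l => e e0.
suff /al : nbhs l [set x | `|x - l| <= e] by [].
apply/nbhs_ballP; exists e => //= x; rewrite /ball/= distrC.
exact: ltW.
Qed.

Lemma ultra_le (U : set_system nat) (a : nat -> R) (l c K : R) :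
  UltraFilter U -> (forall e, 0 < e -> U [set n | `|a n - l| <= e]) ->
  (forall e, 0 < e -> U [set n | `|a n - c| <= K + e]) -> `|l - c| <= K.
Proof.
move=> UU al ac; apply/ler_addgt0Pr => e e0.
have e20 : 0 < e / 2 by rewrite divr_gt0.
have PU : ProperFilter U by exact: ultra_proper.
have UI : U ([set n | `|a n - l| <= e / 2] `&` [set n | `|a n - c| <= K + e / 2]).
  by apply: filterI; [exact: al|exact: ac].
have [n [/= h1 h2]] := filter_ex UI.
rewrite (_ : l - c = (a n - c) - (a n - l)); last by ring.
by rewrite (le_trans (ler_normB _ _))// (splitr e) addrA lerD.
Qed.

End ultralimit.

(** * Existence of solutions of the ODE *)

Section euler.
Variable R : realType.

Fixpoint euler (phi : R -> R[i] -> R[i]) (s : R[i]) (h : R) (k : nat) : R[i] :=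
  if k is k'.+1 then
    let x := euler phi s h k' in x + h%:C * phi (k'%:R * h) x
  else s.

Lemma increment_bound (x : nat -> R[i]) (y : R[i]) (h e : R) (a b : nat) :
  (a <= b)%N ->
  (forall k, (a <= k < b)%N -> normc (x k.+1 - x k - h%:C * y) <= h * e) ->
  normc (x b - x a - ((b - a)%:R * h)%:C * y) <= (b - a)%:R * h * e.
Proof.
move=> ab; rewrite -(subnKC ab) addKn; move: (b - a)%N => n {ab b}.
elim: n => [|n IH] hx.
  by rewrite addn0 subrr !mul0r subr0 ComplexField.Normc.normc0.
have -> : x (a + n.+1)%N - x a - (n.+1%:R * h)%:C * y =
    (x (a + n).+1 - x (a + n)%N - h%:C * y) + (x (a + n)%N - x a - (n%:R * h)%:C * y).
  by rewrite addnS -natr1 mulrDl mul1r rmorphD/=; ring.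
rewrite (le_trans (le_normcD _ _))// -natr1 !mulrDl !mul1r addrC lerD//.
  by apply: IH => k /andP[ak kn]; apply: hx; rewrite ak addnS ltnS ltnW.
by apply: hx; rewrite leq_addr addnS ltnS/=.
Qed.

Variables (phi : R -> R[i] -> R[i]) (s : R[i]) (t L h0 : R).
Hypotheses (t_ge0 : 0 <= t) (L_gt0 : 0 < L) (h0_gt0 : 0 < h0).
Hypothesis euler_ok : forall h k, 0 < h <= h0 -> k%:R * h <= t ->
  0 <= complex.Re (euler phi s h k) /\
  normc (phi (k%:R * h) (euler phi s h k)) <= L.
Hypothesis phi_cont : forall u0 x0, 0 <= u0 <= t -> 0 <= complex.Re x0 ->
  forall e : R, 0 < e -> exists2 del : R, 0 < del &
  forall u x, 0 <= u <= t -> 0 <= complex.Re x -> `|u - u0| <= del ->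
    normc (x - x0) <= del -> normc (phi u x - phi u0 x0) <= e.

Let index (h u : R) : nat := Num.truncn (u / h).
(** A step function rather than the interpolated polygon: all its values are taken at grid points,
    where the half-plane condition is known. The price is an extra [h] in the increment bounds. *)
Let approx (h u : R) : R[i] := euler phi s h (index h u).

Lemma index_itv h u : 0 < h -> 0 <= u ->
  (index h u)%:R * h <= u /\ u < (index h u)%:R * h + h.
Proof.
move=> h_gt0 u0.
have /truncn_itv/andP[h1 h2] : 0 <= u / h by rewrite divr_ge0// ltW.
by rewrite -ler_pdivlMr// h1 -[X in _ + X]mul1r -mulrDl natr1 -ltr_pdivrMr.
Qed.

Lemma index_le h u v : 0 < h -> 0 <= u <= v -> (index h u <= index h v)%N.
Proof.
move=> h_gt0 /andP[_ uv]; apply: le_truncn.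
by rewrite ler_pM2r// invr_gt0.
Qed.

(** The Euler steps between [u] and [v] cover a time that differs from [v - u] by at most [h]: this
    yields the [+ h] in the first term and the whole second term. *)
Lemma approx_diff h u v y e : 0 < h <= h0 -> 0 <= u <= v -> v <= t -> 0 <= e ->
  (forall k, (index h u <= k < index h v)%N ->
     normc (phi (k%:R * h) (euler phi s h k) - y) <= e) ->
  normc (approx h v - approx h u - (v - u)%:C * y) <=
    e * (v - u + h) + h * normc y.
Proof.
move=> /andP[h_gt0 hh] uv vt e0 he.
have /andP[u0 uv'] := uv.
have ab := index_le h_gt0 uv.
have [iu1 iu2] := index_itv h_gt0 u0.
have [iv1 iv2] := index_itv h_gt0 (le_trans u0 uv').
have := @increment_bound (euler phi s h) y h e _ _ ab.
set m := (_ - _)%:R.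
have mE : m = (index h v)%:R - (index h u)%:R by rewrite /m natrB.
move=> H.
have {}H : normc (approx h v - approx h u - (m * h)%:C * y) <= m * h * e.
  apply: H => k /he hk /=.
  rewrite [X in normc X](_ : _ = h%:C * (phi (k%:R * h) (euler phi s h k) - y)); last first.
    by rewrite mulrBr; ring.
  by rewrite ComplexField.Normc.normcM normc_real gtr0_norm// ler_pM2l.
rewrite [X in normc X](_ : _ = (approx h v - approx h u - (m * h)%:C * y) +
    (m * h - (v - u))%:C * y); last by rewrite !rmorphB/=; ring.
rewrite (le_trans (le_normcD _ _))// lerD//.
  by rewrite (le_trans H)// mulrC ler_wpM2l// mE; lra.
rewrite ComplexField.Normc.normcM normc_real ler_wpM2r ?normc_ge0//.
by rewrite mE ler_norml; apply/andP; split; lra.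
Qed.

Lemma approx_Lip h u v : 0 < h <= h0 -> 0 <= u <= v -> v <= t ->
  normc (approx h v - approx h u) <= L * (v - u + h).
Proof.
move=> hh uv vt.
have := @approx_diff h u v 0 L hh uv vt (ltW L_gt0).
rewrite !mulr0 subr0 ComplexField.Normc.normc0 mulr0 addr0; apply.
move=> k /andP[_ kv]; rewrite subr0.
have [] // := @euler_ok h k hh.
have /andP[h_gt0 _] := hh; have /andP[u0 uv'] := uv.
have [iv1 _] := index_itv h_gt0 (le_trans u0 uv').
by rewrite (le_trans _ vt)// (le_trans _ iv1)// ler_pM2r// ler_nat ltnW.
Qed.

Lemma approx_Re h u : 0 < h <= h0 -> 0 <= u <= t -> 0 <= complex.Re (approx h u).
Proof.
move=> hh /andP[u0 ut]; have /andP[h_gt0 _] := hh.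
have [iu1 _] := index_itv h_gt0 u0.
by have [] := @euler_ok h (index h u) hh (le_trans iu1 ut).
Qed.

Lemma approx0 h : 0 < h -> approx h 0 = s.
Proof. by move=> _; rewrite /approx /index mul0r truncn0. Qed.

Lemma index_mid h u v k : 0 < h <= h0 -> 0 <= u <= v ->
  (index h u <= k < index h v)%N -> u - h <= k%:R * h <= v.
Proof.
move=> /andP[h_gt0 _] /andP[u0 uv] /andP[k1 k2].
have [iu1 iu2] := index_itv h_gt0 u0.
have [iv1 _] := index_itv h_gt0 (le_trans u0 uv).
apply/andP; split.
  by rewrite lerBlDr (le_trans (ltW iu2))// lerD2r ler_pM2r// ler_nat.
by rewrite (le_trans _ iv1)// ler_pM2r// ler_nat ltnW.
Qed.

Lemma euler_mid h u v k : 0 < h <= h0 -> 0 <= u <= v -> v <= t ->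
  (index h u <= k < index h v)%N ->
  normc (euler phi s h k - approx h u) <= L * (v - u + h) /\
  normc (euler phi s h k - approx h v) <= L * (v - u + h).
Proof.
move=> hh uv vt kk; have /andP[k1 k2] := kk.
have /andP[h_gt0 _] := hh; have /andP[u0 uv'] := uv.
have [iu1 iu2] := index_itv h_gt0 u0.
have [iv1 iv2] := index_itv h_gt0 (le_trans u0 uv').
have step j : (j < index h v)%N ->
    normc (euler phi s h j.+1 - euler phi s h j - 0) <= h * L.
  move=> jv; rewrite subr0 /= addrAC subrr add0r.
  rewrite ComplexField.Normc.normcM normc_real gtr0_norm// ler_pM2l//.
  have [] // := @euler_ok h j hh.
  by rewrite (le_trans _ vt)// (le_trans _ iv1)// ler_pM2r// ler_nat ltnW.
have k2R : k%:R <= (index h v)%:R :> R by rewrite ler_nat ltnW.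
have k1R : (index h u)%:R <= k%:R :> R by rewrite ler_nat.
have k2h : k%:R * h <= (index h v)%:R * h by rewrite ler_pM2r.
have k1h : (index h u)%:R * h <= k%:R * h by rewrite ler_pM2r.
split.
  have := @increment_bound (euler phi s h) 0 h L _ _ k1.
  rewrite !mulr0 subr0 => H; apply: (le_trans (H _)).
    by move=> j /andP[_ jk]; apply: step; exact: ltn_trans k2.
  by rewrite mulrC ler_pM2l// natrB// mulrBl; lra.
have := @increment_bound (euler phi s h) 0 h L _ _ (ltnW k2).
rewrite !mulr0 subr0 normcBC => H; apply: (le_trans (H _)).
  by move=> j /andP[_ jk]; exact: step.
by rewrite mulrC ler_pM2l// natrB ?(ltnW k2)// mulrBl; lra.
Qed.

Lemma approx_bound h u : 0 < h <= h0 -> 0 <= u <= t ->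
  normc (approx h u) <= normc s + L * (t + h0).
Proof.
move=> hh /andP[u0 ut]; have /andP[h_gt0 hh0] := hh.
rewrite (_ : approx h u = s + (approx h u - approx h 0)); last first.
  by rewrite approx0//; ring.
rewrite (le_trans (le_normcD _ _))// lerD2l.
have u00 : 0 <= (0 : R) <= u by rewrite lexx.
by rewrite (le_trans (approx_Lip hh u00 ut))// subr0 ler_pM2l// lerD.
Qed.

Let step (n : nat) : R := h0 / n.+1%:R.

Let step_ok n : 0 < step n <= h0.
Proof.
by rewrite divr_gt0//= ler_pdivrMr// ler_pMr// ler1n.
Qed.

Let step_small (U : set_system nat) (e : R) : Filter U -> \oo `<=` U -> 0 < e ->
  U [set n | step n <= e].
Proof.
move=> FU ooU e0; apply: ooU.
exists (Num.truncn (h0 / e)) => // n /= hn.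
rewrite /step ler_pdivrMr// mulrC -ler_pdivrMr//.
rewrite (le_trans (ltW (truncnS_gt (h0 / e))))// ler_nat ltnS.
exact: hn.
Qed.

Lemma dist_endpoint (u v m h c a e : R) : 0 < e -> u - h <= m <= v ->
  v - u <= a -> h <= a / 2 -> a <= e / 4 -> u = c \/ v = c -> `|m - c| <= e.
Proof.
move=> e0 /andP[um mv] vu ha ae; rewrite ler_norml.
by case=> <-; apply/andP; split; lra.
Qed.

(** Close to [u0] the grid values stay near [f u0], so each Euler slope is within [e / 2] of [y] and
    the increment of the approximation is nearly linear with slope [y]. This holds along the
    ultrafilter with an error that vanishes with the mesh, so it passes to the limit and is the
    required derivative. *)
Lemma peano : exists sol : R -> R[i], sol 0 = s /\
  forall u, 0 <= u <= t -> 0 <= complex.Re (sol u) /\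
    cderiv_within `[0, t] sol u (phi u (sol u)).
Proof.
have [U [UU ooU]] := @ultraFilterLemma nat \oo _.
have PU : ProperFilter U by exact: ultra_proper.
have FU : Filter U by exact: filter_filter.
pose C := normc s + L * (t + h0).
(* The default 0 outside the interval keeps [F] bounded, so that a limit can be chosen at every real
   [u]. *)
pose F n u := if 0 <= u <= t then approx (step n) u else 0.
have FC n u : normc (F n u) <= C.
  rewrite /F; case: ifP => ut; first exact: approx_bound.
  by rewrite ComplexField.Normc.normc0 addr_ge0 ?normc_ge0// mulr_ge0 ?addr_ge0// ltW.
have /choice[f1 hf1] u : exists l : R, forall e : R, 0 < e ->
    U [set n | `|complex.Re (F n u) - l| <= e].
  by apply: (@ultra_bounded_cvg _ _ _ C) => n; apply: le_trans (FC n u); exact: normc_ge_Re.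
have /choice[f2 hf2] u : exists l : R, forall e : R, 0 < e ->
    U [set n | `|complex.Im (F n u) - l| <= e].
  by apply: (@ultra_bounded_cvg _ _ _ C) => n; apply: le_trans (FC n u); exact: normc_ge_Im.
pose f u := f1 u +i* f2 u.
have fE u e : 0 < e -> U [set n | normc (F n u - f u) <= e].
  move=> e0; have e20 : 0 < e / 2 by rewrite divr_gt0.
  have UI : U ([set n | `|complex.Re (F n u) - f1 u| <= e / 2] `&`
    [set n | `|complex.Im (F n u) - f2 u| <= e / 2]).
    by apply: filterI; [exact: hf1|exact: hf2].
  apply: filterS UI => n [/= r1 r2].
  by rewrite (le_trans (normc_le_ReIm _))// (splitr e) lerD// ?ReB ?ImB.
have f_Re u : 0 <= u <= t -> 0 <= complex.Re (f u).
  move=> ut; apply/ler_addgt0Pr => e e0.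
  have [n /= hn] := filter_ex (hf1 u _ e0).
  have := approx_Re (step_ok n) ut; move: hn; rewrite /F ut.
  by rewrite ler_norml => /andP[_]; rewrite lerBlDr; lra.
have f0 : f 0 = s.
  have h1 := @ultra_le _ U (fun n => complex.Re (F n 0)) (f1 0) (complex.Re s) 0 UU (hf1 0).
  have h2 := @ultra_le _ U (fun n => complex.Im (F n 0)) (f2 0) (complex.Im s) 0 UU (hf2 0).
  have F0 n : F n 0 = s.
    by rewrite /F lexx t_ge0 approx0//; case/andP: (step_ok n).
  have /eqP : `|f1 0 - complex.Re s| == 0.
    rewrite -normr_le0 normr_id; apply: h1 => e e0; apply: filterS filterT => n _ /=.
    by rewrite F0 subrr normr0 add0r ltW.
  have /eqP : `|f2 0 - complex.Im s| == 0.
    rewrite -normr_le0 normr_id; apply: h2 => e e0; apply: filterS filterT => n _ /=.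
    by rewrite F0 subrr normr0 add0r ltW.
  move=> /normr0_eq0/subr0_eq e2 /normr0_eq0/subr0_eq e1.
  by rewrite /f e1 e2; case: (s).
exists f; split => // u0 u0t; split; first exact: f_Re.
set y := phi u0 (f u0).
apply/cderiv_withinP => e e0.
have e20 : 0 < e / 2 by rewrite divr_gt0.
have [del del0 hdel] := phi_cont u0t (f_Re _ u0t) e20.
(* With a mesh of at most [del' / 2], grid values move by at most
   [L * (del' + del' / 2) <= 3 * del / 8]; adding [del / 4] for the distance of the approximation
   from its limit stays below [del]. *)
pose del' := Num.min (del / 4) (del / (4 * L)).
have del'0 : 0 < del' by rewrite lt_min !divr_gt0// mulr_gt0.
exists del' => // v; rewrite /= in_itv/= => vt uv.
have main (e1 : R) : 0 < e1 ->
    U [set n | normc (F n v - F n u0 - (v - u0)%:C * y) <= e / 2 * `|v - u0| + e1].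
  move=> e10.
  (* The second bound makes the mesh errors [h * (e / 2)] and [h * normc y] of [approx_diff] add up
     to at most [e1]. *)
  pose e2 := Num.min (del' / 2) (e1 / (e / 2 + normc y + 1)).
  have cy : 0 < e / 2 + normc y + 1 by rewrite ltr_wpDl// addr_ge0 ?normc_ge0// ltW.
  have e20' : 0 < e2 by rewrite lt_min !divr_gt0.
  have UI : U ([set n | step n <= e2] `&` [set n | normc (F n u0 - f u0) <= del / 4]).
    by apply: filterI; [exact: step_small|apply: fE; rewrite divr_gt0].
  apply: filterS UI => n [/= n1 n2].
  have hstep := step_ok n; have /andP[h_gt0 hh0] := hstep.
  set h := step n in n1 hstep h_gt0 hh0 *.
  have hd : h <= del' / 2 by rewrite (le_trans n1)// ge_min lexx.
  have he : h * (e / 2 + normc y + 1) <= e1.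
    by rewrite -ler_pdivlMr// (le_trans n1)// ge_min lexx orbT.
  have hy : h * (e / 2) + h * normc y <= e1.
    by rewrite (le_trans _ he)// -mulrDr ler_pM2l// lerDl.
  rewrite /F vt u0t -/h; rewrite /F u0t -/h in n2.
  have Ld : L * del' <= del / 4.
    have : del' <= del / (4 * L) by rewrite ge_min lexx orbT.
    rewrite -(ler_pM2l L_gt0) => /le_trans; apply.
    by rewrite le_eqVlt; apply/orP; left; apply/eqP; field; rewrite gt_eqF.
  have d4 : del' <= del / 4 by rewrite ge_min lexx.
  (* The base point [u0] may be either end of the interval, which serves both one-sided
     increments. *)
  have near k u v' : 0 <= u <= v' -> v' <= t -> (v' - u <= del') ->
      (u = u0 \/ v' = u0) ->
      (index h u <= k < index h v')%N ->
      normc (phi (k%:R * h) (euler phi s h k) - y) <= e / 2.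
    move=> uv' v't vud uu kk.
    have /andP[m1 m2] := index_mid hstep uv' kk.
    have [E1 E2] := euler_mid hstep uv' v't kk.
    have /andP[u_ge0 uv''] := uv'.
    have kh0 : 0 <= k%:R * h by rewrite mulr_ge0// ltW.
    have kt : k%:R * h <= t by rewrite (le_trans m2).
    have [xR _] := euler_ok hstep kt.
    apply: hdel => //; first by rewrite kh0.
      by apply: (@dist_endpoint u v' _ h _ del') => //; rewrite m1 m2.
    rewrite (_ : _ - f u0 = (euler phi s h k - approx h u0) + (approx h u0 - f u0)); last by ring.
    rewrite (le_trans (le_normcD _ _))//.
    have Lb : L * (v' - u + h) <= L * (del' + del' / 2).
      by rewrite ler_pM2l// lerD.
    have : normc (euler phi s h k - approx h u0) <= L * (v' - u + h) by case: uu => <-.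
    by lra.
  have /andP[v0 vt'] := vt; have /andP[u00 ut'] := u0t.
  have [uv0|/ltW vu0] := leP u0 v.
    have vu : 0 <= v - u0 by rewrite subr_ge0.
    rewrite (ger0_norm vu) in uv *.
    have uv' : 0 <= u0 <= v by rewrite u00.
    have := @approx_diff h u0 v y (e / 2) hstep uv' vt' (ltW e20).
    move=> /(_ (fun k kk => near k u0 v uv' vt' uv (or_introl erefl) kk)).
    by move=> /le_trans; apply; lra.
  have vu : 0 <= u0 - v by rewrite subr_ge0.
  rewrite distrC (ger0_norm vu) in uv *.
  have uv' : 0 <= v <= u0 by rewrite v0.
  have := @approx_diff h v u0 y (e / 2) hstep uv' ut' (ltW e20).
  move=> /(_ (fun k kk => near k v u0 uv' ut' uv (or_intror erefl) kk)).
  rewrite [X in _ -> normc X <= _](_ : _ = - (approx h u0 - approx h v - (u0 - v)%:C * y)).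
    by rewrite normcN => /le_trans; apply; lra.
  by rewrite !rmorphB/=; ring.
apply/ler_addgt0Pr => e1 e10.
have e13 : 0 < e1 / 3 by rewrite divr_gt0.
have UI : U ([set n | normc (F n v - F n u0 - (v - u0)%:C * y) <= e / 2 * `|v - u0| + e1 / 3]
   `&` ([set n | normc (F n v - f v) <= e1 / 3] `&` [set n | normc (F n u0 - f u0) <= e1 / 3])).
  by apply: filterI; [exact: main|apply: filterI; exact: fE].
have [n [/= n1 [n2 n3]]] := filter_ex UI.
rewrite (_ : f v - f u0 - (v - u0)%:C * y = (F n v - F n u0 - (v - u0)%:C * y) -
  (F n v - f v) + (F n u0 - f u0)); last by ring.
rewrite (le_trans (le_normcD _ _))//.
have := le_normcB (F n v - F n u0 - (v - u0)%:C * y) (F n v - f v).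
have : e / 2 * `|v - u0| <= e * `|v - u0|.
  by rewrite ler_wpM2r// ler_pdivrMr// ler_pMr// ler1n.
by lra.
Qed.

End euler.

(** * The vector field of the ODE *)

Section thinning_ode.
Context d (T : measurableType d) (R : realType) (P : probability T R).
Variables (B : {RV P >-> R}) (r mu t : R) (z : R[i]).
Hypothesis B_gt0 : P [set w | 0 < B w] = 1%E.
Hypotheses (r_gt0 : 0 < r) (mu_gt0 : 0 < mu) (t_ge0 : 0 <= t).
Hypothesis z_le1 : normc z <= 1.

(** The generating function of the indicator that a customer is still present at age [u]; as a
    convex combination of 1 and [z] it has modulus at most 1. *)
Definition gfun (u : R) : R[i] := 1 + (z - 1) * (expR (- mu * u))%:C.

Definition vfield (u : R) (x : R[i]) : R[i] := 1 - r%:C * x - gfun u * beta B x.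

Lemma normc_gfun (u : R) : 0 <= u -> normc (gfun u) <= 1.
Proof.
move=> u0; set e := expR (- mu * u).
have e0 : 0 <= e by exact: expR_ge0.
have e1 : e <= 1 by rewrite expR_le1 mulNr oppr_le0 mulr_ge0// ltW.
have -> : gfun u = (1 - e)%:C + z * e%:C by rewrite /gfun -/e rmorphB/= rmorph1; ring.
rewrite (le_trans (le_normcD _ _))// ComplexField.Normc.normcM !normc_real.
rewrite !ger0_norm ?subr_ge0//.
have : normc z * e <= e by rewrite ler_piMl.
by lra.
Qed.

Lemma gfun_lip (u v : R) : 0 <= u -> 0 <= v -> normc (gfun u - gfun v) <= 2 * mu * `|u - v|.
Proof.
move=> u0 v0.
have -> : gfun u - gfun v = (z - 1) * (expR (- mu * u) - expR (- mu * v))%:C.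
  by rewrite /gfun rmorphB/=; ring.
rewrite ComplexField.Normc.normcM normc_real -mulrA ler_pM ?normc_ge0//.
  rewrite (le_trans (le_normcB _ _))// (natrD _ 1 1) lerD//.
  by rewrite ComplexField.Normc.normc1.
have nn x : 0 <= x -> - mu * x <= 0 by move=> x0; rewrite mulNr oppr_le0 mulr_ge0// ltW.
rewrite (le_trans (expR_lip (nn _ u0) (nn _ v0)))// -mulrBr normrM normrN.
by rewrite (gtr0_norm mu_gt0).
Qed.

Lemma normc_gbeta (u : R) x : 0 <= u -> 0 <= complex.Re x -> normc (gfun u * beta B x) <= 1.
Proof.
move=> u0 x0; rewrite ComplexField.Normc.normcM -[leRHS]mul1r.
by rewrite ler_pM ?normc_ge0// ?normc_gfun// normc_beta.
Qed.

Lemma normc_vfield (u : R) x : 0 <= u -> 0 <= complex.Re x ->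
  normc (vfield u x) <= 2 + r * normc x.
Proof.
move=> u0 x0; rewrite (le_trans (le_normcB _ _))//.
have := le_normcB 1 (r%:C * x).
rewrite ComplexField.Normc.normc1 ComplexField.Normc.normcM normc_real gtr0_norm//.
by have := normc_gbeta u0 x0; lra.
Qed.

Lemma vfield_ucont (e : R) : 0 < e -> exists2 del : R, 0 < del &
  forall (u v : R) x y, 0 <= u -> 0 <= v -> 0 <= complex.Re x -> 0 <= complex.Re y ->
  `|u - v| <= del -> normc (x - y) <= del -> normc (vfield u x - vfield v y) <= e.
Proof.
move=> e0; have e3 : 0 < e / 3 by rewrite divr_gt0.
have [d1 d10 hd1] := beta_ucont B_gt0 e3.
exists (Num.min d1 (Num.min (e / 3 / r) (e / 3 / (2 * mu)))).
  by rewrite !lt_min d10 !divr_gt0//= mulr_gt0.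
move=> u v x y u0 v0 x0 y0; rewrite !le_min.
move=> /andP[_ /andP[_ uv]] /andP[xy1 /andP[xy2 _]].
have -> : vfield u x - vfield v y = - (r%:C * (x - y)) - (gfun u - gfun v) * beta B x
   - gfun v * (beta B x - beta B y) by rewrite /vfield; ring.
rewrite (le_trans (le_normcB _ _))//.
have H1 := le_normcB (- (r%:C * (x - y))) ((gfun u - gfun v) * beta B x).
have H2 : normc (- (r%:C * (x - y))) <= e / 3.
  rewrite normcN ComplexField.Normc.normcM normc_real gtr0_norm//.
  by rewrite mulrC -ler_pdivlMr.
have H3 : normc ((gfun u - gfun v) * beta B x) <= e / 3.
  rewrite ComplexField.Normc.normcM -[leRHS]mulr1 ler_pM ?normc_ge0//; last exact: normc_beta.
  rewrite (le_trans (gfun_lip _ _))// mulrC -ler_pdivlMr// mulr_gt0//.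
have H4 : normc (gfun v * (beta B x - beta B y)) <= e / 3.
  rewrite ComplexField.Normc.normcM -[leRHS]mul1r ler_pM ?normc_ge0//; first exact: normc_gfun.
  exact: hd1.
by lra.
Qed.

Lemma vfield_euler s (h : R) k : 0 <= complex.Re s -> 0 < h <= r^-1 ->
  0 <= complex.Re (euler vfield s h k) /\
  normc (euler vfield s h k) <= normc s + 2 * (k%:R * h).
Proof.
move=> s0 /andP[h0 hr].
have rh : r * h <= 1 by rewrite mulrC -ler_pdivlMr// mul1r.
elim: k => [|k [IH1 IH2]]; first by rewrite /= mul0r mulr0 addr0.
rewrite [euler _ _ _ _]/=.
set x := euler vfield s h k in IH1 IH2 *.
have kh0 : 0 <= k%:R * h by rewrite mulr_ge0// ltW.
have hg := normc_gbeta kh0 IH1.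
(* For [r * h <= 1] the Euler step is a sum of nonnegative multiples of two points of the right
   half-plane; this is where the bound [r^-1] on the mesh comes from. *)
have -> : x + h%:C * vfield (k%:R * h) x =
    (1 - r * h)%:C * x + h%:C * (1 - gfun (k%:R * h) * beta B x).
  by rewrite /vfield rmorphB/= rmorph1 rmorphM/=; ring.
split.
  have := le_trans (ler_norm _) (le_trans (normc_ge_Re _) hg).
  set q := gfun _ * _ => hg1.
  rewrite ReD [_%:C * x]mulrC [_%:C * _]mulrC !ReMr ReB.
  by apply: addr_ge0; apply: mulr_ge0; rewrite ?subr_ge0 ?(ltW h0).
rewrite (le_trans (le_normcD _ _))// !ComplexField.Normc.normcM !normc_real.
rewrite ger0_norm ?subr_ge0// (gtr0_norm h0).
have : normc (1 - gfun (k%:R * h) * beta B x) <= 2.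
  rewrite (le_trans (le_normcB _ _))// ComplexField.Normc.normc1.
  by lra.
rewrite -(ler_pM2l h0) => H.
have : (1 - r * h) * normc x <= normc x.
  by rewrite ler_piMl ?normc_ge0// gerBl mulr_ge0// ltW.
rewrite -natr1; nra.
Qed.

Lemma ode_solution_exists s : 0 <= complex.Re s ->
  exists sol : R -> R[i], solves_ode r mu B z s t sol.
Proof.
move=> s0.
(* By [vfield_euler] the polygon grows at speed at most 2, so [normc s + 2 * t] bounds it up to time
   [t], and [L] bounds the field along it. *)
pose L := 2 + r * (normc s + 2 * t).
have L0 : 0 < L.
  by rewrite ltr_wpDr// mulr_ge0// ?(ltW r_gt0)// addr_ge0 ?normc_ge0// mulr_ge0.
have rV : 0 < r^-1 by rewrite invr_gt0.
have [||sol [sol0 hsol]] := @peano R vfield s t L r^-1 t_ge0 L0 rV.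
- move=> h k hh kt; have [E1 E2] := vfield_euler k s0 hh; split => //.
  have /andP[h0 _] := hh.
  have kh0 : 0 <= k%:R * h by rewrite mulr_ge0// ltW.
  rewrite (le_trans (normc_vfield kh0 E1))// lerD2l ler_pM2l//.
  by rewrite (le_trans E2)// lerD2l ler_pM2l.
- move=> u0 x0 /andP[u00 _] x00 e e0; have [del del0 hdel] := vfield_ucont e0.
  by exists del => // u x /andP[u1 _] x1 uu xx; apply: hdel.
exists sol; split => // [u ut|u ut]; first by have [] := hsol u ut.
have [_ h] := hsol u ut.
by exists (vfield u (sol u)) => //; rewrite /vfield /gfun; ring.
Qed.

End thinning_ode.

(** * Mean values and integrals on a closed interval *)

Section real_calculus.
Variable R : realType.
Implicit Types (f l : R -> R) (a b t : R).

Lemma within_deriv_continuous f l t :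
  (forall u, 0 <= u <= t ->
    (v - u)^-1 * (f v - f u) @[v --> within `[0, t] u^'] --> l u) ->
  {within `[0, t], continuous f}.
Proof.
move=> fl; apply/subspace_continuousP => u /=; rewrite in_itv/= => ut.
have /within_derivP h := fl u ut.
have [del del0 hdel] := h 1 ltr01.
apply/cvgrPdist_le => e e0.
apply/nbhs_ballP; exists (Num.min del (e / (1 + `|l u|))) => /=.
  by rewrite lt_min del0 divr_gt0// ltr_pwDl.
move=> v; rewrite /ball/= lt_min => /andP[uv1 uv2] vt.
have vu : `|v - u| <= del by rewrite distrC ltW.
have H := hdel v vt vu; rewrite mul1r in H.
rewrite distrC (_ : f v - f u = (f v - f u - (v - u) * l u) + (v - u) * l u); last by ring.
rewrite (le_trans (ler_normD _ _))// normrM.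
have : `|v - u| * (1 + `|l u|) <= e.
  by rewrite -ler_pdivlMr ?ltr_pwDl// distrC ltW.
by lra.
Qed.

Lemma within_deriv_mvt f l t a b :
  (forall u, 0 <= u <= t ->
    (v - u)^-1 * (f v - f u) @[v --> within `[0, t] u^'] --> l u) ->
  0 <= a -> a <= b -> b <= t ->
  exists2 c, a <= c <= b & f b - f a = l c * (b - a).
Proof.
move=> fl a0 ab bt.
have [||c cab E] := @MVT_segment R f l a b ab.
- move=> x; rewrite in_itv/= => /andP[ax xb].
  have xt : 0 <= x <= t by rewrite (le_trans a0 (ltW ax)) (le_trans (ltW xb)).
  have /within_derivP h := fl x xt.
  have cv : (fun h => h^-1 *: ((f \o shift x) (h *: 1) - f x)) @ 0^' --> l x.
    apply/cvgrPdist_le => e e0.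
    have [del del0 hdel] := h e e0.
    (* Within this radius both sides of [x] lie in [a, b], so the derivative relative to the
       interval is the ordinary one. *)
    apply/nbhs_ballP; exists (Num.min del (Num.min (x - a) (b - x))) => /=.
      by rewrite !lt_min del0 !subr_gt0 ax.
    move=> y; rewrite /ball/= sub0r normrN !lt_min => /andP[y1 /andP[y2 y3]] y0.
    rewrite /= /shift /= [y%:A]mulr1.
    have yt : 0 <= y + x <= t.
      by move: y2 y3; rewrite !ltr_norml => /andP[? ?] /andP[? ?]; apply/andP; split; lra.
    have := hdel (y + x); rewrite /= in_itv/= addrK => /(_ yt (ltW y1)).
    rewrite -ler_pdivrMr ?normr_gt0// -normrV ?unitfE// -normrM distrC.
        suff -> : y^-1 *: (f (y + x) - f x) - l x = (f (y + x) - f x - y * l x) / y by [].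
    by rewrite /GRing.scale/=; field.
  by split; [apply/cvg_ex; exists (l x)|exact: cvg_lim cv].
- apply: continuous_subspaceW (within_deriv_continuous fl) => x /=.
  by rewrite !in_itv/= => /andP[ax xb]; rewrite (le_trans a0 ax) (le_trans xb).
by exists c.
Qed.

Lemma continuous_bounded f t : 0 <= t -> {within `[0, t], continuous f} ->
  exists C : R, forall u, 0 <= u <= t -> `|f u| <= C.
Proof.
move=> t0 cf.
have [c1 _ h1] := EVT_max t0 cf; have [c2 _ h2] := EVT_min t0 cf.
exists (`|f c1| + `|f c2|) => u ut.
have := h1 u; rewrite in_itv/= => /(_ ut) H1.
have := h2 u; rewrite in_itv/= => /(_ ut) H2.
have := ler_norm (f c1); have := ler_norm (- f c2); rewrite normrN.
have := normr_ge0 (f c1); have := normr_ge0 (f c2).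
by rewrite ler_norml => *; apply/andP; split; lra.
Qed.

Local Notation mu := (@lebesgue_measure R).

Lemma Rintegral_increment f t a b (e : R) : {within `[0, t], continuous f} ->
  0 <= a -> a <= b -> b <= t ->
  (forall u, a <= u <= b -> `|f u - f b| <= e) ->
  `|\int[mu]_(u in `[0, b]) f u - \int[mu]_(u in `[0, a]) f u - (b - a) * f b|
    <= e * (b - a).
Proof.
move=> cf a0 ab bt fe.
have intf c : c <= t -> mu.-integrable `[0, c] (EFin \o f).
  move=> ct; apply: continuous_compact_integrable; first exact: segment_compact.
  apply: continuous_subspaceW cf => x /=.
  by rewrite !in_itv/= => /andP[-> xc]; rewrite (le_trans xc).
have -> : \int[mu]_(u in `[0, b]) f u - \int[mu]_(u in `[0, a]) f u =
    \int[mu]_(u in `]a, b]) f u.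
  by rewrite (@Rintegral_itvB _ f _ _ a) ?bnd_simp//; exact: intf.
have muab : fine (mu `]a, b]) = b - a.
  rewrite lebesgue_measure_itv/= lte_fin; case: ltP => [//|ba].
  by apply/eqP; rewrite eq_sym subr_eq0 eq_le ba.
have mufin : (mu `]a, b] < +oo)%E.
  by rewrite lebesgue_measure_itv/= lte_fin; case: ifP => _; rewrite ?ltry.
have intab : mu.-integrable `]a, b] (EFin \o f).
  apply: (integrableS _ _ _ (intf b bt)) => // x /=.
  by rewrite !in_itv/= => /andP[ax ->]; rewrite (le_trans a0 (ltW ax)).
have intc (c : R) : mu.-integrable `]a, b] (EFin \o (fun=> c)).
  apply: measurable_bounded_integrable => //.
  by exists `|c|; split; [rewrite num_real|move=> x cx w _ /=; exact: ltW].
have -> : (b - a) * f b = \int[mu]_(u in `]a, b]) (fun=> f b) u.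
  by rewrite Rintegral_cst// muab mulrC.
rewrite -RintegralB//.
have intd : mu.-integrable `]a, b] (EFin \o (fun u => f u - f b)).
  rewrite (_ : EFin \o _ = ((EFin \o f) \- (EFin \o (fun=> f b)))%E)//.
  by apply: integrableB => //; exact: intc.
rewrite (le_trans (le_normr_Rintegral _ _))//.
rewrite -muab -Rintegral_cst// le_Rintegral//.
  exact: integrable_norm.
move=> x /=; rewrite in_itv/= => /andP[ax xb]; apply: fe.
by rewrite (ltW ax).
Qed.

End real_calculus.

(** * Regularity of a given solution *)

Section ode_solution.
Context d (T : measurableType d) (R : realType) (P : probability T R).
Variables (B : {RV P >-> R}) (r mu t : R) (z s : R[i]) (sol : R -> R[i]).
Hypothesis B_gt0 : P [set w | 0 < B w] = 1%E.
Hypotheses (r_gt0 : 0 < r) (mu_gt0 : 0 < mu) (t_ge0 : 0 <= t).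
Hypothesis z_le1 : normc z <= 1.
Hypothesis sol_ode : solves_ode r mu B z s t sol.
Local Notation vf := (vfield B r mu z).

Lemma sol_Re u : 0 <= u <= t -> 0 <= complex.Re (sol u).
Proof. by have [_ h _] := sol_ode; exact: h. Qed.

Lemma sol_cderiv u : 0 <= u <= t -> cderiv_within `[0, t] sol u (vf u (sol u)).
Proof.
have [_ _ h] := sol_ode => /h[l hl E].
suff -> : vf u (sol u) = l by [].
apply/esym/eqP; rewrite -subr_eq0 -[eqbRHS]E; apply/eqP.
by rewrite /vfield /gfun; ring.
Qed.

Let Re_deriv u : 0 <= u <= t -> (v - u)^-1 *
  (complex.Re (sol v) - complex.Re (sol u)) @[v --> within `[0, t] u^']
    --> complex.Re (vf u (sol u)).
Proof. by move=> /sol_cderiv[]. Qed.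

Let Im_deriv u : 0 <= u <= t -> (v - u)^-1 *
  (complex.Im (sol v) - complex.Im (sol u)) @[v --> within `[0, t] u^']
    --> complex.Im (vf u (sol u)).
Proof. by move=> /sol_cderiv[]. Qed.

Let Re_cont := within_deriv_continuous Re_deriv.
Let Im_cont := within_deriv_continuous Im_deriv.

Lemma sol_bounded : exists2 C : R, 0 < C & forall u, 0 <= u <= t -> normc (sol u) <= C.
Proof.
have [C1 h1] := continuous_bounded t_ge0 Re_cont.
have [C2 h2] := continuous_bounded t_ge0 Im_cont.
exists (`|C1| + `|C2| + 1) => [|u ut].
  by rewrite ltr_wpDl// addr_ge0.
rewrite (le_trans (normc_le_ReIm _))//.
have := h1 u ut; have := h2 u ut; have := ler_norm C1; have := ler_norm C2.
by lra.
Qed.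

(** There is no mean value theorem for complex values; it is applied to the real and the imaginary
    part separately, hence the factor 2. *)
Lemma sol_Lip : exists2 L : R, 0 < L & forall a b, 0 <= a -> a <= b -> b <= t ->
  normc (sol b - sol a) <= L * (b - a).
Proof.
have [C C0 hC] := sol_bounded.
have L0 : 0 < 2 + r * C by rewrite addr_gt0// mulr_gt0.
exists (2 * (2 + r * C)); first by rewrite mulr_gt0.
move=> a b a0 ab bt.
have ba : 0 <= b - a by rewrite subr_ge0.
have bound c : a <= c <= b -> normc (vf c (sol c)) <= 2 + r * C.
  move=> /andP[ac cb]; have c0 := le_trans a0 ac.
  have ct : 0 <= c <= t by rewrite c0 (le_trans cb).
  rewrite (le_trans (normc_vfield B_gt0 r_gt0 mu_gt0 z_le1 c0 (sol_Re ct)))//.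
  by rewrite lerD2l ler_pM2l// hC.
have [c1 /bound hc1 E1] := within_deriv_mvt Re_deriv a0 ab bt.
have [c2 /bound hc2 E2] := within_deriv_mvt Im_deriv a0 ab bt.
rewrite (le_trans (normc_le_ReIm _))// ReB ImB E1 E2 !normrM (ger0_norm ba).
rewrite -mulrDl ler_wpM2r// mulr_natl mulr2n lerD//.
  exact: le_trans (normc_ge_Re _) hc1.
exact: le_trans (normc_ge_Im _) hc2.
Qed.

(** The derivative is taken at the right end [b] because the martingale runs the solution backwards:
    [b = t - v] belongs to the current time [v], and [a] to the next one. Uniformity in [a] and [b]
    comes from the uniform continuity of the field. *)
Lemma sol_increment (e : R) : 0 < e -> exists2 del : R, 0 < del &
  forall a b, 0 <= a -> a <= b -> b <= t -> b - a <= del ->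
  normc (sol b - sol a - (b - a)%:C * vf b (sol b)) <= e * (b - a).
Proof.
move=> e0; have e20 : 0 < e / 2 by rewrite divr_gt0.
have [L L0 hL] := sol_Lip.
have [d1 d10 hd1] := vfield_ucont B_gt0 r_gt0 mu_gt0 z_le1 e20.
exists (Num.min d1 (d1 / L)); first by rewrite lt_min d10 divr_gt0.
move=> a b a0 ab bt; rewrite le_min => /andP[bad1 badL].
have ba : 0 <= b - a by rewrite subr_ge0.
have bound c : a <= c <= b -> normc (vf c (sol c) - vf b (sol b)) <= e / 2.
  move=> /andP[ac cb]; have c0 := le_trans a0 ac.
  have ct : 0 <= c <= t by rewrite c0 (le_trans cb).
  have b0t : 0 <= b <= t by rewrite (le_trans a0).
  apply: hd1 => //; [exact: le_trans c0 cb|exact: sol_Re|exact: sol_Re| |].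
    by rewrite distrC ger0_norm ?subr_ge0//; lra.
  rewrite normcBC (le_trans (hL _ _ c0 cb bt))// mulrC -ler_pdivlMr//.
  by rewrite (le_trans _ badL)// lerD2l lerN2.
have [c1 /bound hc1 E1] := within_deriv_mvt Re_deriv a0 ab bt.
have [c2 /bound hc2 E2] := within_deriv_mvt Im_deriv a0 ab bt.
have bC x : (b - a)%:C * x = x * (b - a)%:C by rewrite mulrC.
rewrite (le_trans (normc_le_ReIm _))// !ReB !ImB bC ReMr ImMr E1 E2.
rewrite -!mulrBl !normrM (ger0_norm ba) (splitr e) [leRHS]mulrDl lerD// ler_wpM2r//.
  by rewrite -ReB (le_trans (normc_ge_Re _)).
by rewrite -ImB (le_trans (normc_ge_Im _)).
Qed.

Lemma sol_integral_increment (e : R) : 0 < e -> exists2 del : R, 0 < del &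
  forall a b, 0 <= a -> a <= b -> b <= t -> b - a <= del ->
  normc (cintegral b sol - cintegral a sol - (b - a)%:C * sol b) <= e * (b - a).
Proof.
move=> e0; have [L L0 hL] := sol_Lip.
exists (e / 2 / L); first by rewrite !divr_gt0.
move=> a b a0 ab bt hab.
have bound u : a <= u <= b -> normc (sol u - sol b) <= e / 2.
  move=> /andP[au ub]; rewrite normcBC (le_trans (hL _ _ (le_trans a0 au) ub bt))//.
  rewrite mulrC -ler_pdivlMr// (le_trans _ hab)// lerD2l lerN2//.
have bC x : (b - a)%:C * x = x * (b - a)%:C by rewrite mulrC.
rewrite (le_trans (normc_le_ReIm _))// !ReB !ImB bC ReMr ImMr ![_ * (b - a)]mulrC.
rewrite (splitr e) [leRHS]mulrDr lerD// [leRHS]mulrC.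
  apply: (Rintegral_increment Re_cont) => // u /bound.
  by apply: le_trans; rewrite -ReB normc_ge_Re.
apply: (Rintegral_increment Im_cont) => // u /bound.
by apply: le_trans; rewrite -ImB normc_ge_Im.
Qed.

Lemma cintegral_Re_ge0 b : b <= t -> 0 <= complex.Re (cintegral b sol).
Proof.
move=> bt; apply: Rintegral_ge0 => u /=; rewrite in_itv/= => /andP[u0 ub].
by apply: sol_Re; rewrite u0 (le_trans ub).
Qed.

End ode_solution.

(** Sums and products over the arrivals have a random number of terms; they are the limits,
    eventually constant at each point, of expressions with a fixed number of terms. *)
Lemma measurable_fun_eventually d (T : measurableType d) (R : realType)
    (h : nat -> T -> R) (f : T -> R) (n : T -> nat) :
  (forall m, measurable_fun setT (h m)) ->
  (forall m w, (n w <= m)%N -> h m w = f w) -> measurable_fun setT f.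
Proof.
move=> mh hf; apply: (measurable_fun_cvg mh) => w _.
apply: cvg_near_cst; exists (n w) => // m /= nm; exact: hf.
Qed.

(** * Arrivals and their history *)

Section arrivals_theory.
Context d (T : measurableType d) (R : realType) (P : probability T R).
Variables (arr mark : nat -> {RV P >-> R}).
Hypothesis cp : counting_process arr.
Local Notation cnt := (arrivals arr).

Lemma arr_gt0 i w : 0 < arr i w.
Proof.
have [a0 ai _] := cp w.
by elim: i => // i /lt_trans; apply.
Qed.

Lemma arr_lt i j w : (i < j)%N -> arr i w < arr j w.
Proof.
have [_ ai _] := cp w; elim: j => // j IH; rewrite ltnS leq_eqVlt.
by move=> /orP[/eqP->//|/IH /lt_trans]; apply.
Qed.

Lemma arr_le i j w : (i <= j)%N -> arr i w <= arr j w.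
Proof. by rewrite leq_eqVlt => /orP[/eqP->//|/arr_lt/ltW]. Qed.

(** The epochs increase and only finitely many are at most [v], so the first index beyond [v] exists
    and is the count. *)
Lemma arr_set v w : [set i | arr i w <= v] = `I_(cnt v w).
Proof.
have [_ _ fin] := cp w.
have ex : exists n, v < arr n w.
  apply: contrapT => h; have : infinite_set [set i | arr i w <= v].
    rewrite (_ : [set i | arr i w <= v] = setT); first exact: infinite_nat.
    apply/seteqP; split => // i _ /=; rewrite leNgt; apply/negP => vi.
    by apply: h; exists i.
  by apply; exact: fin.
case: (ex_minnP ex) => m vm min.
have E : [set i | arr i w <= v] = `I_m.
  apply/seteqP; split => i /=.
    by move=> iv; rewrite ltnNge; apply/negP => /(@arr_le _ _ w)/le_trans/(_ iv); rewrite leNgt vm.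
  by move=> im; rewrite leNgt; apply/negP => /min; rewrite leqNgt im.
suff -> : cnt v w = m by [].
by rewrite /arrivals E; apply: card_fset_set; exact: card_eqxx.
Qed.

Lemma lt_cnt i v w : (i < cnt v w)%N = (arr i w <= v).
Proof.
have := arr_set v w => /seteqP[h1 h2].
by apply/idP/idP => [/h2|/h1].
Qed.

Lemma cnt_ge v i w : (cnt v w <= i)%N = (v < arr i w).
Proof. by rewrite leqNgt lt_cnt -ltNge. Qed.

Lemma cnt_le u v w : u <= v -> (cnt u w <= cnt v w)%N.
Proof.
move=> uv; rewrite leqNgt; apply/negP => h; have := h.
rewrite lt_cnt => /le_trans/(_ uv); rewrite -lt_cnt ltnn.
by [].
Qed.

Lemma cnt0 w : cnt 0 w = 0%N.
Proof. by apply/eqP; rewrite -leqn0 cnt_ge arr_gt0. Qed.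

Lemma sum_cnt (V : nmodType) (F : nat -> V) v w N : (cnt v w <= N)%N ->
  \sum_(i < cnt v w) F i = \sum_(i < N) (if arr i w <= v then F i else 0).
Proof.
move=> h; rewrite (big_ord_widen _ F h) big_mkcond /=.
by apply: eq_bigr => i _; rewrite lt_cnt.
Qed.

Lemma prod_cnt (V : comPzSemiRingType) (F : nat -> V) v w N : (cnt v w <= N)%N ->
  \prod_(i < cnt v w) F i = \prod_(i < N) (if arr i w <= v then F i else 1).
Proof.
move=> h; rewrite (big_ord_widen _ F h) big_mkcond /=.
by apply: eq_bigr => i _; rewrite lt_cnt.
Qed.

Definition hist_gen (t : R) : set_system T :=
  [set A | exists i (u : R) (Y : set R), [/\ u <= t, measurable Y &
         A = [set w | arr i w <= u /\ Y (mark i w)]]].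

Lemma measurable_arr_le i (u : R) : measurable [set w | arr i w <= u].
Proof.
by rewrite -[X in measurable X]setTI -preimage_itvNyc; exact: measurable_funP.
Qed.

Lemma hist_gen_measurable t : hist_gen t `<=` measurable.
Proof.
move=> A [i [u [Y [ut mY ->]]]].
rewrite (_ : mkset _ = [set w | arr i w <= u] `&` (mark i @^-1` Y))//.
apply: measurableI; first exact: measurable_arr_le.
by rewrite -[X in measurable X]setTI; exact: measurable_funP.
Qed.

Lemma hist_gen_sub u v : u <= v -> hist_gen u `<=` hist_gen v.
Proof. by move=> uv A [i [x [Y [xu mY ->]]]]; exists i, x, Y; split => //; exact: le_trans uv. Qed.

Lemma history_sub u v : u <= v -> <<s hist_gen u >> `<=` <<s hist_gen v >>.
Proof. by move=> uv; apply: sub_sigma_algebra2; exact: hist_gen_sub. Qed.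

Local Notation HT v := (g_sigma_algebraType (hist_gen v)).

Lemma history_arr i u v : u <= v -> @measurable _ (HT v) [set w | arr i w <= u].
Proof.
move=> uv; apply: sub_sigma_algebra; exists i, u, setT; split => //.
by apply/seteqP; split => w //= -[].
Qed.

(** An epoch after [v] is not seen by the history, so only the capped epoch is measurable; levels at
    or above [v] have empty preimage. *)
Lemma history_minarr i v :
  @measurable_fun _ _ (HT v) R setT (fun w => Num.min (arr i w) v).
Proof.
apply: (measurability _ (RGenOInfty.measurableE R)) => // _ [_ [x ->] <-].
rewrite setTI; have [xv|vx] := ltP x v; last first.
  rewrite (_ : _ @^-1` _ = set0); first exact: measurable0.
  apply/seteqP; split => w //=; rewrite in_itv/= andbT lt_min => /andP[_].
  by rewrite ltNge vx.
rewrite (_ : _ @^-1` _ = ~` [set w | arr i w <= x]).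
  by apply: measurableC; apply: history_arr; exact: ltW.
apply/seteqP; split => w /=; rewrite in_itv/= andbT lt_min xv andbT.
  by rewrite ltNge => /negP.
by move/negP; rewrite -ltNge.
Qed.

Lemma history_mark i v :
  @measurable_fun _ _ (HT v) R setT (fun w => if arr i w <= v then mark i w else 0).
Proof.
move=> _ Y mY; rewrite setTI.
have m1 : @measurable _ (HT v) [set w | arr i w <= v /\ Y (mark i w)].
  by apply: sub_sigma_algebra; exists i, v, Y.
have m2 : @measurable _ (HT v) (~` [set w | arr i w <= v]).
  by apply: measurableC; exact: history_arr.
(* The value 0 stands for a mark not yet seen, so the event that arrival [i] is later than [v]
   belongs to the preimage exactly when [Y] contains 0. *)
have [Y0|nY0] := pselect (Y 0).
  rewrite (_ : _ @^-1` _ = [set w | arr i w <= v /\ Y (mark i w)] `|` ~` [set w | arr i w <= v]).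
    exact: measurableU.
  apply/seteqP; split => w /=; case: ifPn => av.
  - by left.
  - by right; exact/negP.
  - by case=> [[]|].
  - by [].
rewrite (_ : _ @^-1` _ = [set w | arr i w <= v /\ Y (mark i w)])//.
by apply/seteqP; split => w /=; case: ifPn => av // [].
Qed.

Lemma history_indic i v : @bmeas _ (HT v) R (fun w => (arr i w <= v)%R%:R).
Proof.
rewrite (_ : (fun _ => _) = \1_[set w | arr i w <= v] :> (T -> R)).
  by apply: bmeas_indic; exact: history_arr.
by apply/funext => w; rewrite indic_setE.
Qed.

Lemma history_discount i v c :
  @measurable_fun _ _ (HT v) R setT (fun w => expR (- c * (v - Num.min (arr i w) v))).
Proof.
apply: measurableT_comp => //; apply: measurable_funM; first exact: measurable_cst.
by apply: measurable_funB; [exact: measurable_cst|exact: history_minarr].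
Qed.

End arrivals_theory.

(** * Intensity and service weights as functionals of the history *)

Section state.
Context d (T : measurableType d) (R : realType) (P : probability T R).
Variables (arr mark : nat -> {RV P >-> R}).
Hypothesis cp : counting_process arr.
Variables (lam r mu t : R) (z : R[i]).
Hypotheses (lam_gt0 : 0 < lam) (r_gt0 : 0 < r) (mu_gt0 : 0 < mu).
Hypothesis z_le1 : normc z <= 1.
Local Notation cnt := (arrivals arr).
Local Notation HT v := (g_sigma_algebraType (hist_gen arr mark v)).

(** The right-continuous intensity with truncated marks. Counting an arrival at [v] itself is what
    makes the one-step recursions [lint_none] and [lint_one] exact. *)
Definition lint (v : R) w : R :=
  lam + \sum_(i < cnt v w) cpart (mark i w) * expR (- r * (v - arr i w)).

(** The ages are taken at the final time [t], so a factor never changes after the arrival of its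
    customer. *)
Definition wprod (v : R) w : R[i] := \prod_(i < cnt v w) gfun mu z (t - arr i w).

Lemma discount_le1 (c u : R) : 0 < c -> 0 <= u -> expR (- c * u) <= 1.
Proof. by move=> c0 u0; rewrite expR_le1 mulNr oppr_le0 mulr_ge0// ltW. Qed.

Lemma lint_ge v w : lam <= lint v w.
Proof.
rewrite lerDl sumr_ge0// => i _.
by rewrite mulr_ge0 ?cpart_ge0 ?expR_ge0.
Qed.

Lemma lint_ge0 v w : 0 <= lint v w.
Proof. exact: le_trans (ltW lam_gt0) (lint_ge v w). Qed.

(** The marks undiscounted: one finite random variable above the intensity at all times up to [t],
    so the event of ever exceeding [K] is controlled by its tail. *)
Definition lsup w : R := lam + \sum_(i < cnt t w) cpart (mark i w).

Lemma lint_le_lsup v w : v <= t -> lint v w <= lsup w.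
Proof.
move=> vt; rewrite lerD2l.
rewrite (@sum_cnt _ _ _ _ _ cp _ (fun i => cpart (mark i w) * expR (- r * (v - arr i w)))
  _ _ (cnt t w)); last exact: cnt_le.
apply: ler_sum => i _; case: ifPn => av; last exact: cpart_ge0.
by rewrite ler_piMr ?cpart_ge0// discount_le1// subr_ge0.
Qed.

Lemma lint0 w : lint 0 w = lam.
Proof. by rewrite /lint cnt0// big_ord0 addr0. Qed.

Lemma wprod0 w : wprod 0 w = 1.
Proof. by rewrite /wprod cnt0// big_ord0. Qed.

Lemma lint_none v h w : cnt (v + h) w = cnt v w ->
  lint (v + h) w = lam + (lint v w - lam) * expR (- r * h).
Proof.
move=> E; rewrite /lint E addrAC subrr add0r big_distrl/=; congr (_ + _).
apply: eq_bigr => i _; rewrite -mulrA -expRD; congr (_ * expR _); ring.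
Qed.

Lemma lint_one v h w : cnt (v + h) w = (cnt v w).+1 ->
  lint (v + h) w = lam + (lint v w - lam) * expR (- r * h) +
    cpart (mark (cnt v w) w) * expR (- r * (v + h - arr (cnt v w) w)).
Proof.
move=> E; rewrite /lint E big_ord_recr/= addrA [lam + _ - lam]addrAC subrr add0r big_distrl/=.
congr (_ + _ + _).
apply: eq_bigr => i _; rewrite -mulrA -expRD; congr (_ * expR _); ring.
Qed.

Lemma wprod_none v h w : cnt (v + h) w = cnt v w -> wprod (v + h) w = wprod v w.
Proof. by rewrite /wprod => ->. Qed.

Lemma wprod_one v h w : cnt (v + h) w = (cnt v w).+1 ->
  wprod (v + h) w = wprod v w * gfun mu z (t - arr (cnt v w) w).
Proof. by rewrite /wprod => ->; rewrite big_ord_recr. Qed.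

Lemma normc_prod (n : nat) (F : nat -> R[i]) :
  (forall i, (i < n)%N -> normc (F i) <= 1) -> normc (\prod_(i < n) F i) <= 1.
Proof.
elim: n => [|n IH] hF; first by rewrite big_ord0 ComplexField.Normc.normc1.
rewrite big_ord_recr/= ComplexField.Normc.normcM -[leRHS]mulr1 ler_pM ?normc_ge0//.
  by apply: IH => i iN; apply: hF; rewrite ltnS ltnW.
exact: hF.
Qed.

Lemma normc_wprod v w : v <= t -> normc (wprod v w) <= 1.
Proof.
move=> vt; apply: (normc_prod (F := fun i => gfun mu z (t - arr i w))) => i.
by rewrite lt_cnt// => iv; apply: normc_gfun => //; rewrite subr_ge0 (le_trans iv).
Qed.

Lemma history_lint v : @measurable_fun _ _ (HT v) R setT (lint v).
Proof.
(* The default mark 0 removes arrivals after [v] and the cap on the epoch keeps every factor in the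
   history; for [N] beyond the count the sum is that of [lint]. *)
pose h N w : R := lam + \sum_(i < N) cpart (if arr i w <= v then mark i w else 0) *
  expR (- r * (v - Num.min (arr i w) v)).
apply: (@measurable_fun_eventually _ (HT v) _ h _ (cnt v)) => [N|N w NN].
  apply: measurable_funD; first exact: measurable_cst.
  apply: (@measurable_sum _ (HT v)) => i; apply: measurable_funM.
    by apply: measurableT_comp; [exact: measurable_cpart|exact: history_mark].
  exact: history_discount.
rewrite /h /lint; congr (_ + _).
rewrite (@sum_cnt _ _ _ _ _ cp _ (fun i => cpart (mark i w) * expR (- r * (v - arr i w)))
  _ _ N)//.
apply: eq_bigr => i _; case: ifPn => av; first by rewrite min_l.
by rewrite /cpart maxxx mul0r.
Qed.

Lemma history_wprod v : v <= t -> @cbmeas _ (HT v) R (wprod v).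
Proof.
move=> vt.
pose f i w : R := (arr i w <= v)%R%:R * expR (- mu * (t - Num.min (arr i w) v)).
have bf i : @bmeas _ (HT v) R (f i).
  apply: bmeasM; first exact: history_indic.
  split; last first.
    exists 1 => w; rewrite ger0_norm ?expR_ge0// discount_le1// subr_ge0.
    by rewrite ge_min vt orbT.
  apply: measurableT_comp => //; apply: measurable_funM; first exact: measurable_cst.
  by apply: measurable_funB; [exact: measurable_cst|exact: history_minarr].
pose h N w : R[i] := \prod_(i < N) (1 + (z - 1) * (f i w)%:C).
have bh N : @cbmeas _ (HT v) R (h N).
  apply: cbmeas_prod => i; apply: cbmeasD; first exact: cbmeas_cst.
  by apply: cbmeasM; [exact: cbmeas_cst|exact: cbmeas_real].
have hE N w : (cnt v w <= N)%N -> h N w = wprod v w.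
  move=> NN; rewrite /h /wprod (@prod_cnt _ _ _ _ _ cp _ (fun i => gfun mu z (t - arr i w)) _ _ N)//.
  apply: eq_bigr => i _; rewrite /f; case: ifPn => av; first by rewrite min_l// mul1r.
  by rewrite mul0r mulr0 addr0.
apply: (@cbmeasP _ _ _ _ 1); last by move=> w; exact: normc_wprod.
split.
  apply: (@measurable_fun_eventually _ (HT v) _ (fun N w => complex.Re (h N w)) _ (cnt v)) => [N|N w NN].
    by have [[]] := bh N.
  by rewrite hE.
apply: (@measurable_fun_eventually _ (HT v) _ (fun N w => complex.Im (h N w)) _ (cnt v)) => [N|N w NN].
  by have [_ []] := bh N.
by rewrite hE.
Qed.

Lemma measurable_lsup : measurable_fun setT lsup.
Proof.
pose h N w : R := lam + \sum_(i < N) cpart (mark i w) * \1_[set w | arr i w <= t] w.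
apply: (@measurable_fun_eventually _ _ _ h _ (cnt t)) => [N|N w NN].
  apply: measurable_funD; first exact: measurable_cst.
  apply: measurable_sum => i; apply: measurable_funM.
    by apply: measurableT_comp => //; exact: measurable_cpart.
  by apply: measurable_indic; exact: measurable_arr_le.
rewrite /h /lsup (@sum_cnt _ _ _ _ _ cp _ (fun i => cpart (mark i w)) _ _ N)//.
congr (_ + _); apply: eq_bigr => i _; rewrite indic_setE; case: ifPn => _.
  by rewrite mulr1.
by rewrite mulr0.
Qed.

Lemma measurable_cnt v : measurable_fun setT (fun w => (cnt v w)%:R : R).
Proof.
pose h N w : R := \sum_(i < N) \1_[set w | arr i w <= v] w.
apply: (@measurable_fun_eventually _ _ _ h _ (cnt v)) => [N|N w NN].
  by apply: measurable_sum => i; apply: measurable_indic; exact: measurable_arr_le.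
rewrite /h [RHS](_ : _ = \sum_(i < cnt v w) 1); last by rewrite sumr_const card_ord.
rewrite (@sum_cnt _ _ _ _ _ cp _ (fun=> 1) _ _ N)//.
by apply: eq_bigr => i _; rewrite indic_setE; case: ifPn.
Qed.

End state.

Section gen_sigma_gen.
Context d (T : measurableType d) (R : realType).

Definition gen_of (X : set (T -> R)) : set_system T :=
  \bigcup_(f in X) preimage_set_system setT f measurable.

Lemma gen_of_measurable (X : set (T -> R)) :
  (forall f, X f -> measurable_fun setT f) -> gen_of X `<=` measurable.
Proof.
move=> mX A [f Xf [Y mY <-]]; exact: mX.
Qed.

Lemma gen_of_fun (X : set (T -> R)) f : X f ->
  @measurable_fun _ _ (g_sigma_algebraType (gen_of X)) R setT f.
Proof.
move=> Xf _ Y mY; apply: sub_sigma_algebra; exists f => //; exists Y => //.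
Qed.

End gen_sigma_gen.

(** * The mark of the next arrival *)

Section new_mark.
Context d (T : measurableType d) (R : realType) (P : probability T R).
Variables (arr mark : nat -> {RV P >-> R}) (B : {RV P >-> R}).
Hypothesis cp : counting_process arr.
Hypothesis iid_mark : iid mark (distribution P B).
Hypothesis indep_mark : forall i,
  independent_sigma P (gen_sigma [set (mark i : T -> R)]) (before_mark arr mark i).
Local Notation cnt := (arrivals arr).
Local Notation HT v := (g_sigma_algebraType (hist_gen arr mark v)).
Local Notation Ec := (cexpectation P).
Local Notation Ex := (Ex P).

Let bset (n : nat) : set (T -> R) :=
  [set (arr j : T -> R) | j in [set j | (j <= n)%N]] `|`
  [set (mark j : T -> R) | j in [set j | (j < n)%N]].

Let BT n := g_sigma_algebraType (gen_of (bset n)).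

Lemma bset_measurable n : gen_of (bset n) `<=` measurable.
Proof.
by apply: gen_of_measurable => f [[j _ <-]|[j _ <-]]; exact: measurable_funP.
Qed.

Lemma before_arr n j u : (j <= n)%N -> @measurable _ (BT n) [set w | arr j w <= u].
Proof.
move=> jn; have mj : @measurable_fun _ _ (BT n) R setT (arr j).
  by apply: gen_of_fun; left; exists j.
by rewrite -[X in measurable X]setTI -preimage_itvNyc; exact: mj.
Qed.

(** The event says that epoch [n - 1] is at most [v] and epoch [n] is later, so the epochs with
    index up to [n] decide it. *)
Lemma before_cnt n v : @measurable _ (BT n) [set w | cnt v w = n].
Proof.
have m2 : @measurable _ (BT n) (~` [set w | arr n w <= v]).
  by apply: measurableC; exact: before_arr.
case: n m2 => [|n] m2.
  rewrite (_ : mkset _ = ~` [set w | arr 0%N w <= v])//.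
  apply/seteqP; split => w /= => [E|].
    by apply/negP; rewrite -ltNge -cnt_ge// E.
  by move/negP; rewrite -ltNge -cnt_ge// leqn0 => /eqP.
rewrite (_ : mkset _ = [set w | arr n w <= v] `&` ~` [set w | arr n.+1 w <= v]).
  by apply: measurableI => //; exact: before_arr.
apply/seteqP; split => w /= => [E|[h1 /negP]].
  by split; [rewrite -lt_cnt// E|apply/negP; rewrite -ltNge -cnt_ge// E].
by rewrite -ltNge -cnt_ge// => h2; apply/eqP; rewrite eqn_leq h2/= lt_cnt.
Qed.

(* An arrival after [v] cannot be seen in the history up to [v]. *)
Lemma history_before n v A : @measurable _ (HT v) A ->
  @measurable _ (BT n) (A `&` [set w | cnt v w = n]).
Proof.
set E := [set w | cnt v w = n].
have mE : @measurable _ (BT n) E by exact: before_cnt.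
suff : <<s hist_gen arr mark v >> `<=` [set A | @measurable _ (BT n) (A `&` E)] by apply.
apply: smallest_sub.
  split => /=.
  - by rewrite set0I; exact: measurable0.
  - move=> A' mA'; rewrite (_ : _ `&` E = E `\` (A' `&` E)); first exact: measurableD.
    apply/seteqP; split => w /=; first by move=> [[_ nA] Ew]; split => // -[].
    by move=> [Ew h]; split => //; split => // Aw; apply: h.
  - move=> F mF; rewrite setI_bigcupl; exact: bigcupT_measurable.
move=> _ [i [u [Y [uv mY ->]]]] /=.
have [iltn|nlei] := ltnP i n.
  apply: measurableI => //.
  rewrite (_ : mkset _ = [set w | arr i w <= u] `&` (mark i @^-1` Y))//.
  apply: measurableI; first by apply: before_arr; exact: ltnW.
  have /(_ measurableT Y mY) : @measurable_fun _ _ (BT n) R setT (mark i).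
    by apply: gen_of_fun; right; exists i.
  by rewrite setTI.
rewrite (_ : _ `&` E = set0); first exact: measurable0.
apply/seteqP; split => w //= [[au _] Ew].
have : (i < cnt v w)%N by rewrite lt_cnt// (le_trans au).
by rewrite Ew ltnNge nlei.
Qed.

Lemma bmeas_history_before n v (X : T -> R) : @bmeas _ (HT v) R X ->
  @bmeas _ (BT n) R (fun w => X w * \1_[set w | cnt v w = n] w).
Proof.
set E := [set w | cnt v w = n].
have mE : @measurable _ (BT n) E by exact: before_cnt.
move=> [mX [C hC]]; split; last first.
  exists C => w; rewrite normrM -[leRHS]mulr1 ler_pM//.
  by rewrite indicE ger0_norm ?ler0n// lern1 leq_b1.
move=> _ Y mY; rewrite setTI.
have mXE : @measurable _ (BT n) ((X @^-1` Y) `&` E).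
  by apply: history_before; have := mX measurableT Y mY; rewrite setTI.
have mCE : @measurable _ (BT n) (~` E) by exact: measurableC.
have [Y0|nY0] := pselect (Y 0).
  rewrite (_ : _ @^-1` _ = ((X @^-1` Y) `&` E) `|` ~` E); first exact: measurableU.
  apply/seteqP; split => w /=; rewrite indicE; have [Ew|nEw] := pselect (E w).
  - by rewrite mem_set// mulr1; left.
  - by right.
  - by rewrite mem_set// mulr1 => -[[]|].
  - by rewrite memNset// mulr0.
rewrite (_ : _ @^-1` _ = (X @^-1` Y) `&` E)//.
apply/seteqP; split => w /=; rewrite indicE; have [Ew|nEw] := pselect (E w).
- by rewrite mem_set// mulr1.
- by rewrite memNset// mulr0.
- by rewrite mem_set// mulr1 => -[].
- by move=> [].
Qed.

Lemma cbmeas_history_before n v (X : T -> R[i]) : @cbmeas _ (HT v) R X ->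
  @cbmeas _ (BT n) R (fun w => X w * (\1_[set w | cnt v w = n] w)%:C).
Proof.
move=> [X1 X2]; split.
  by under eq_fun do rewrite ReMr; exact: bmeas_history_before.
by under eq_fun do rewrite ImMr; exact: bmeas_history_before.
Qed.

Lemma measurable_cnt_eq v n : measurable [set w | cnt v w = n].
Proof.
by apply: (sigma_sub_measurable (@bset_measurable n)); exact: before_cnt.
Qed.

(** A total expectation formula over the values of the count. Finite sums suffice: counts of at
    least [N] have small probability, and there the difference is at most [C]. *)
Lemma Ec_cnt_split v (X Y : T -> R[i]) (C : R) : cbmeas X -> cbmeas Y ->
  (forall w, normc (X w - Y w) <= C) ->
  (forall n, Ec (fun w => X w * (\1_[set w | cnt v w = n] w)%:C) =
             Ec (fun w => Y w * (\1_[set w | cnt v w = n] w)%:C)) ->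
  Ec X = Ec Y.
Proof.
move=> bX bY hC h; have bZ := cbmeasB bX bY.
have C0 : 0 <= C by exact: le_trans (normc_ge0 _) (hC point).
apply/eqP; rewrite -subr_eq0 -EcB//; apply/eqP/ComplexField.Normc.eq0_normc.
apply/eqP; rewrite eq_le normc_ge0 andbT; apply/ler_addgt0Pr => e e0; rewrite add0r.
have C1 : 0 < C + 1 by rewrite ltr_wpDl.
have eC : 0 < e / (C + 1) by rewrite divr_gt0.
have mc := measurable_cnt cp v.
have [K K0 hK] := tail_small P mc eC.
pose N := (Num.truncn K).+1.
pose I n w : R[i] := (\1_[set w | cnt v w = n] w)%:C.
have bI n : cbmeas (I n) by apply: cbmeas_indic; exact: measurable_cnt_eq.
have E0 : Ec (fun w => \sum_(n < N) (X w - Y w) * I n w) = 0.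
  rewrite Ec_sum; last by move=> n; exact: cbmeasM.
  apply: big1 => n _.
  rewrite (@eq_Ec _ _ _ _ _ (fun w => X w * I n w - Y w * I n w)); last first.
    by move=> w; rewrite mulrBl.
  by rewrite EcB ?h ?subrr//; exact: cbmeasM.
have bS : cbmeas (fun w => \sum_(n < N) (X w - Y w) * I n w).
  by apply: cbmeas_sum => n; exact: cbmeasM.
rewrite -[Ec _]subr0 -E0 -EcB//.
have mK : measurable [set w | K < (cnt v w)%:R].
  by rewrite -[X in measurable X]setTI -preimage_itvoy; exact: mc.
have bK := bmeas_indic R mK.
have bCK : bmeas (fun w => (C + 1) * \1_[set w | K < (cnt v w)%:R] w).
  by apply: bmeasM => //; exact: bmeas_cst.
apply: (@le_trans _ _ (Ex (fun w => (C + 1) * \1_[set w | K < (cnt v w)%:R] w))); last first.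
  by rewrite ExZl// -ler_pdivlMl// mulrC.
apply: normc_Ec => //; first exact: cbmeasB.
move=> w; rewrite -big_distrr/= -[X in X - _]mulr1 -mulrBr ComplexField.Normc.normcM.
have IE n : I n w = (cnt v w == n)%:R.
  rewrite /I (_ : mkset _ = [set w | cnt v w == n]); last first.
    by apply/seteqP; split => w' /= /eqP.
  by rewrite indic_setE; case: eqP.
have -> : \sum_(n < N) I n w = (cnt v w < N)%N%:R.
  under eq_bigr do rewrite IE.
  have [cN|Nc] := ltnP (cnt v w) N.
    rewrite (bigD1 (Ordinal cN))//= eqxx big1 ?addr0// => i /negP ni.
    by case: eqP => // E; case: ni; apply/eqP/val_inj.
  by rewrite big1// => i _; case: eqP => // E; move: Nc; rewrite E leqNgt ltn_ord.
rewrite indic_setE; have [cN|Nc] := ltnP (cnt v w) N.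
  by rewrite subrr ComplexField.Normc.normc0 mulr0 mulr_ge0// ltW.
rewrite subr0 ComplexField.Normc.normc1 mulr1.
rewrite (lt_le_trans (truncnS_gt K)) ?ler_nat// mulr1.
by rewrite (le_trans (hC w))// lerDl.
Qed.

Lemma measurable_new_mark v : measurable_fun setT (fun w => mark (cnt v w) w).
Proof.
move=> _ Y mY; rewrite setTI.
rewrite (_ : _ @^-1` _ = \bigcup_n ([set w | cnt v w = n] `&` (mark n @^-1` Y))).
  apply: bigcupT_measurable => n; apply: measurableI; first exact: measurable_cnt_eq.
  by rewrite -[X in measurable X]setTI; exact: measurable_funP.
apply/seteqP; split => w /=; first by exists (cnt v w).
by move=> [n _ [/= <-]].
Qed.

Lemma measurable_jump v h : measurable [set w | (cnt v w < cnt (v + h) w)%N].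
Proof.
rewrite (_ : mkset _ = [set w | (cnt v w)%:R < (cnt (v + h) w)%:R :> R]); last first.
  by apply/seteqP; split => w /=; rewrite ltr_nat.
rewrite -[X in measurable X]setTI.
have := @measurable_fun_ltr _ T R setT _ _ (measurable_cnt cp v) (measurable_cnt cp (v + h)).
by move=> /(_ measurableT [set true]); apply.
Qed.

(** Once the count at [v] is fixed to [n], the new mark is mark [n], and both the history up to [v]
    and the occurrence of a jump are decided by what precedes that mark. *)
Lemma new_mark_indep v h (Z : T -> R[i]) (phi : R -> R[i]) (C D : R) :
  @cbmeas _ (HT v) R Z -> (forall w, normc (Z w) <= C) ->
  cbmeas phi -> (forall x, normc (phi x) <= D) ->
  Ec (fun w => Z w * (\1_[set w | (cnt v w < cnt (v + h) w)%N] w)%:C *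
               phi (mark (cnt v w) w)) =
  Ec (fun w => Z w * (\1_[set w | (cnt v w < cnt (v + h) w)%N] w)%:C) *
  Ec (phi \o B).
Proof.
move=> bZ hC bphi hD.
have bZT : cbmeas Z by apply: cbmeas_sub bZ; exact: hist_gen_measurable.
have C0 : 0 <= C by exact: le_trans (normc_ge0 _) (hC point).
have D0 : 0 <= D by exact: le_trans (normc_ge0 _) (hD 0).
pose J w : R[i] := (\1_[set w | (cnt v w < cnt (v + h) w)%N] w)%:C.
have bJ : cbmeas J by apply: cbmeas_indic; exact: measurable_jump.
have bphiX (X : T -> R) : measurable_fun setT X -> cbmeas (fun w => phi (X w)).
  move=> mX; apply: (@cbmeasP _ _ _ _ D) => //.
  by case: bphi => [[m1 _] [m2 _]]; split; [exact: measurableT_comp m1 mX|exact: measurableT_comp m2 mX].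
have bnew := bphiX _ (measurable_new_mark v).
have bB : cbmeas (phi \o B) by apply: bphiX; exact: measurable_funP.
have nE : normc (Ec (phi \o B)) <= D.
  rewrite -[leRHS](Ex_cst P); apply: normc_Ec => //; [exact: bmeas_cst|by move=> w; exact: hD].
have nJ w : normc (J w) <= 1.
  by rewrite normc_real indicE ger0_norm ?ler0n// lern1 leq_b1.
have nZJ w : normc (Z w * J w) <= C.
  by rewrite ComplexField.Normc.normcM -[leRHS]mulr1 ler_pM// normc_ge0.
rewrite -EcZr; last exact: cbmeasM.
apply: (@Ec_cnt_split v _ _ (2 * (C * D))).
- by apply: cbmeasM => //; exact: cbmeasM.
- by apply: cbmeasM; [exact: cbmeasM|exact: cbmeas_cst].
- move=> w; rewrite (le_trans (le_normcB _ _))// mulr_natl mulr2n.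
  rewrite !(ComplexField.Normc.normcM (Z w * J w)).
  by rewrite lerD// ler_pM// normc_ge0.
move=> n; pose I w : R[i] := (\1_[set w | cnt v w = n] w)%:C.
pose A w : R[i] := (\1_[set w | arr n w <= v + h] w)%:C.
have bZn : @cbmeas _ (BT n) R (fun w => Z w * I w * A w).
  apply: cbmeasM; first exact: cbmeas_history_before.
  by apply: cbmeas_indic; exact: before_arr.
(* With [n] arrivals up to [v], a jump before [v + h] means exactly that epoch [n] is at most
   [v + h]. *)
have JA w : I w * J w = I w * A w.
  rewrite /I /J /A !indicE; have [Ew|nEw] := pselect (cnt v w = n); last first.
    by rewrite [w \in mkset _]memNset//= rmorph0 !mul0r.
  congr (_ * (_%:R)%:C); congr (nat_of_bool _).
  by apply/idP/idP => /set_mem /= h1; apply/mem_set => /=; move: h1; rewrite -Ew lt_cnt.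
pose Hn := gen_of [set (mark n : T -> R)].
have bm : @cbmeas _ (g_sigma_algebraType Hn) R (fun w => phi (mark n w)).
  apply: (@cbmeasP _ (g_sigma_algebraType Hn) _ _ D) => //.
  have mm : @measurable_fun _ _ (g_sigma_algebraType Hn) R setT (mark n).
    exact: gen_of_fun.
  by case: bphi => [[m1 _] [m2 _]]; split; [exact: measurableT_comp m1 mm|exact: measurableT_comp m2 mm].
have HM : Hn `<=` measurable.
  by apply: gen_of_measurable => f ->; exact: measurable_funP.
have ind := EcM_indep HM (@bset_measurable n) (@indep_mark n) bm bZn.
transitivity (Ec (fun w => phi (mark n w) * (Z w * I w * A w))).
  apply: eq_Ec => w; rewrite -[_ * I w * A w]mulrA -JA -/(J w) -/(I w).
  have [Ew|nEw] := pselect (cnt v w = n); first by rewrite Ew; ring.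
  have -> : I w = 0 by rewrite /I indicE memNset//= rmorph0.
  by rewrite !(mul0r, mulr0).
rewrite ind mulrC.
have -> : Ec (fun w => phi (mark n w)) = Ec (phi \o B).
  apply: (Ec_same_law (X := mark n) (Y := B)) => // Y mY.
  by have [+ _] := iid_mark; apply.
rewrite -EcZr; last by apply: cbmeas_sub bZn; exact: bset_measurable.
by apply: eq_Ec => w; rewrite -[_ * I w * A w]mulrA -JA -/(J w) -/(I w); ring.
Qed.

End new_mark.

(** * Conditional expansions in intensity form *)

Section conditional.
Context d (T : measurableType d) (R : realType) (P : probability T R).
Local Notation Ex := (Ex P).

Lemma Rintegral_ae_bound (X : T -> R) (c : R) : measurable_fun setT X -> 0 <= c ->
  {ae P, forall w, `|X w| <= c} -> `|Ex X| <= c.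
Proof.
move=> mX c0 Xc.
(* Clamping changes [X] on a null set only and makes the bound hold everywhere. *)
pose Y w : R := Num.max (- c) (Num.min c (X w)).
have Yc w : `|Y w| <= c.
  by rewrite ler_norml /Y le_max lexx/= ge_max ge_min lexx/= andbT; lra.
have mY : measurable_fun setT Y.
  apply: measurable_maxr; first exact: measurable_cst.
  by apply: measurable_minr => //; exact: measurable_cst.
have -> : Ex X = Ex Y.
  rewrite /Ex /Rintegral; congr fine; apply: ae_eq_integral => //.
  - exact/measurable_EFinP.
  - exact/measurable_EFinP.
  - apply: filterS Xc => w; rewrite ler_norml => /andP[h1 h2] _.
    by rewrite /Y (min_r h2) (max_r h1).
rewrite -[leRHS](Ex_cst P); apply: Ex_norm => //; last exact: bmeas_cst.
by split => //; exists c.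
Qed.

(** The integral over [A] does not distinguish the indicator of [E] from [f], and [f] is close to
    [q] on [A]. The version [f] is integrable but possibly unbounded, so the exchange relies on
    integrability rather than on [bmeas]. *)
Lemma cond_prob_bound (G : set_system T) (A E : set T) (f q : T -> R) (c : R) :
  G A -> measurable A -> measurable E -> cond_prob P G E f ->
  bmeas (fun w => \1_A w * q w) -> 0 <= c ->
  {ae P, forall w, A w -> `|f w - q w| <= c} ->
  `|Ex (fun w => \1_A w * (\1_E w - q w))| <= c.
Proof.
move=> GA mA mE [_ intf fE] bq c0 fq.
have mf : measurable_fun setT f by apply/measurable_EFinP; exact: measurable_int intf.
have bA := bmeas_indic R mA; have bE := bmeas_indic R mE.
have -> : Ex (fun w => \1_A w * (\1_E w - q w)) = Ex (fun w => \1_A w * (f w - q w)).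
  have intA : P.-integrable setT (EFin \o (fun w => \1_A w * f w)).
    have := (integrable_mkcond (EFin \o f) mA).1 (integrableS measurableT mA (@subsetT _ _) intf).
    rewrite [X in _ -> _.-integrable _ X](_ : _ = (EFin \o f) \_ A)//.
    apply/funext => w; rewrite patchE /= indicE; case: ifPn => _; first by rewrite mul1r.
    by rewrite mul0r.
  rewrite (@eq_Ex _ _ _ _ _ (fun w => \1_A w * \1_E w - \1_A w * q w)); last first.
    by move=> w; rewrite mulrBr.
  rewrite (@eq_Ex _ _ _ _ (fun w => \1_A w * (f w - q w)) (fun w => \1_A w * f w - \1_A w * q w)); last first.
    by move=> w; rewrite mulrBr.
  rewrite ExB//; last exact: bmeasM.
  rewrite (@ExB_integrable _ _ _ _ (fun w => \1_A w * f w))//; last exact: bmeas_integrable.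
  congr (_ - _).
  rewrite (@eq_Ex _ _ _ _ _ \1_(A `&` E)); last by move=> w; rewrite indicI.
  rewrite Ex_indic; last exact: measurableI.
  rewrite -fE// /Rintegral integral_mkcond; congr fine; apply: eq_integral => w _.
  rewrite patchE /= indicE; case: ifPn => _; first by rewrite mul1r.
  by rewrite mul0r.
apply: Rintegral_ae_bound => //.
  have [[mq _] mA'] := (bq, bA); rewrite (_ : (fun _ => _) = (fun w => \1_A w * f w - \1_A w * q w)).
    by apply: measurable_funB => //; apply: measurable_funM => //; case: bA.
  by apply/funext => w; rewrite mulrBr.
apply: filterS fq => w h; rewrite indicE; have [Aw|nA] := pselect (A w).
  by rewrite mem_set// mul1r h.
by rewrite memNset// mul0r normr0.
Qed.

End conditional.

Section expansions.
Context d (T : measurableType d) (R : realType) (P : probability T R).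
Variables (arr mark : nat -> {RV P >-> R}) (lam r : R).
Hypothesis cp : counting_process arr.
Hypotheses (lam_gt0 : 0 < lam) (r_gt0 : 0 < r).
Hypothesis mark_gt0 : {ae P, forall w, forall i, 0 < mark i w}.
Local Notation cnt := (arrivals arr).
Local Notation HT v := (g_sigma_algebraType (hist_gen arr mark v)).
Local Notation Ex := (Ex P).
Local Notation int := (intensity lam r arr mark).
Local Notation L := (lint arr mark lam r).

Hypothesis none_exp : cond_prob_expansion lam r arr mark
  (fun t h => [set w | (arrivals arr (t + h) w - arrivals arr t w = 0)%N])
  (fun t h w => 1 - intensity lam r arr mark t w * h).
Hypothesis multi_exp : cond_prob_expansion lam r arr mark
  (fun t h => [set w | (1 < arrivals arr (t + h) w - arrivals arr t w)%N])
  (fun _ _ _ => 0).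

Lemma intensityE v w : int v w = lam + \sum_(i < cnt v w)
   (if arr i w < v then mark i w * expR (- r * (v - arr i w)) else 0).
Proof.
rewrite /intensity; congr (_ + _).
rewrite (fsbig_ord _ _ (fun i => if arr i w < v then mark i w * expR (- r * (v - arr i w)) else 0)).
rewrite -(@fsbig_widen _ _ _ _ [set i | arr i w < v] `I_(cnt v w)).
- by apply: eq_fsbigr => i; rewrite inE => /= ->.
- by move=> i /= av; rewrite lt_cnt// ltW.
- by move=> i [_ /= nav]; case: ifPn.
Qed.

(** The left-continuous intensity with truncated marks: almost surely equal to [intensity] and
    nonnegative everywhere, it links the model to [lint]. *)
Definition lintl v w : R := lam + \sum_(i < cnt v w)
   (if arr i w < v then cpart (mark i w) * expR (- r * (v - arr i w)) else 0).

Lemma lintl_le v w : lintl v w <= L v w.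
Proof.
rewrite lerD2l ler_sum// => i _; case: ifPn => // _.
by rewrite mulr_ge0 ?cpart_ge0 ?expR_ge0.
Qed.

Lemma lintl_ge0 v w : 0 <= lintl v w.
Proof.
rewrite addr_ge0 ?(ltW lam_gt0)// sumr_ge0// => i _; case: ifPn => // _.
by rewrite mulr_ge0 ?cpart_ge0 ?expR_ge0.
Qed.

Lemma ae_intensity v : {ae P, forall w, int v w = lintl v w}.
Proof.
apply: filterS mark_gt0 => w h; rewrite intensityE; congr (_ + _).
by apply: eq_bigr => i _; case: ifPn => // _; rewrite cpart_gt0.
Qed.

Lemma measurable_sum_left (m : nat -> T -> R) v : (forall i, measurable_fun setT (m i)) ->
  measurable_fun setT (fun w => lam + \sum_(i < cnt v w)
   (if arr i w < v then m i w * expR (- r * (v - arr i w)) else 0)).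
Proof.
move=> mm.
pose h N w : R := lam + \sum_(i < N) m i w * expR (- r * (v - arr i w)) * \1_[set w | arr i w < v] w.
apply: (@measurable_fun_eventually _ _ _ h _ (cnt v)) => [N|N w NN].
  apply: measurable_funD; first exact: measurable_cst.
  apply: measurable_sum => i; apply: measurable_funM.
    apply: measurable_funM => //; apply: measurableT_comp => //.
    apply: measurable_funM; first exact: measurable_cst.
    by apply: measurable_funB; [exact: measurable_cst|exact: measurable_funP].
  apply: measurable_indic; rewrite -[X in measurable X]setTI -preimage_itvNyo.
  exact: measurable_funP.
rewrite /h (@sum_cnt _ _ _ _ _ cp _ (fun i => if arr i w < v then m i w * expR (- r * (v - arr i w)) else 0) _ _ N)//.
congr (_ + _); apply: eq_bigr => i _; rewrite indic_setE.
case: ltP => av; first by rewrite (ltW av) mulr1.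
by rewrite mulr0; case: ifP.
Qed.

Lemma measurable_lintl v : measurable_fun setT (lintl v).
Proof.
apply: (@measurable_sum_left (fun i w => cpart (mark i w))) => i.
apply: measurableT_comp => //; exact: measurable_cpart.
Qed.

Lemma measurable_intensity v : measurable_fun setT (int v).
Proof.
rewrite (_ : int v = fun w => lam + \sum_(i < cnt v w)
   (if arr i w < v then mark i w * expR (- r * (v - arr i w)) else 0)).
  by apply: (@measurable_sum_left mark) => i; exact: measurable_funP.
by apply/funext => w; exact: intensityE.
Qed.

Lemma measurable_multi v h : measurable [set w | (1 < cnt (v + h) w - cnt v w)%N].
Proof.
rewrite (_ : mkset _ = [set w | (cnt v w)%:R + 1 < (cnt (v + h) w)%:R :> R]); last first.
  by apply/seteqP; split => w /=; rewrite natr1 ltr_nat ltn_subRL addn1.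
rewrite -[X in measurable X]setTI.
have m1 : measurable_fun setT (fun w => (cnt v w)%:R + 1 : R).
  by apply: measurable_funD; [exact: measurable_cnt|exact: measurable_cst].
have := @measurable_fun_ltr _ T R setT _ _ m1 (measurable_cnt cp (v + h)).
by move=> /(_ measurableT [set true]); apply.
Qed.

Lemma noneE v h : 0 <= h ->
  [set w | (cnt (v + h) w - cnt v w = 0)%N] = ~` [set w | (cnt v w < cnt (v + h) w)%N].
Proof.
move=> h0; apply/seteqP; split => w /=.
  by move=> /eqP; rewrite subn_eq0 leqNgt => /negP.
by move/negP; rewrite -leqNgt -subn_eq0 => /eqP.
Qed.

Lemma history_measurable v (A : set T) : @measurable _ (HT v) A -> @measurable _ T A.
Proof.
move=> mA; apply: (@sigma_sub_measurable _ T (hist_gen arr mark v)) => //.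
exact: hist_gen_measurable.
Qed.

(** On [A] the left version is at most [L v], hence at most [K], and it is almost surely the
    intensity; so the proviso of the expansion is met almost everywhere on [A] and the estimate can
    be integrated over it. *)
Lemma none_bound_left (t K e : R) : 0 < e -> \forall h \near 0^'+,
  forall v (A : set T), 0 <= v <= t -> @measurable _ (HT v) A ->
  (forall w, A w -> L v w <= K) ->
  `|Ex (fun w => \1_A w * (\1_[set w | (cnt (v + h) w - cnt v w = 0)%N] w -
      (1 - lintl v w * h)))| <= e * h.
Proof.
move=> e0; have := @none_exp t K e e0.
move=> near_h; near=> h.
have h0 : 0 < h by [].
have hh : forall v, 0 <= v <= t -> exists f, cond_prob P (history arr mark v)
   [set w | (arrivals arr (v + h) w - arrivals arr v w = 0)%N] f /\
  {ae P, forall w, int v w <= K -> `|f w - (1 - int v w * h)| <= e * h}.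
  by near: h.
move=> v A vt mA AK; have [f [cf fK]] := hh v vt.
apply: (@cond_prob_bound _ _ _ _ (history arr mark v) _ _ f) => //.
- exact: history_measurable mA.
- rewrite noneE ?(ltW h0)//; apply: measurableC; exact: measurable_jump.
- split.
    apply: measurable_funM; first by apply: measurable_indic; exact: history_measurable mA.
    apply: measurable_funB; first exact: measurable_cst.
    by apply: measurable_funM; [exact: measurable_lintl|exact: measurable_cst].
  exists (1 + `|K| * h) => w; rewrite indicE; have [Aw|nA] := pselect (A w); last first.
    by rewrite memNset// mul0r normr0 addr_ge0// mulr_ge0// ltW.
  rewrite mem_set// mul1r (le_trans (ler_normB _ _))// normr1 lerD2l normrM.
  rewrite ger0_norm ?lintl_ge0// (gtr0_norm h0) ler_pM2r//.
  by rewrite (le_trans (lintl_le _ _))// (le_trans (AK _ Aw))// ler_norm.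
- by rewrite mulr_ge0// ltW.
- apply: filterS2 (ae_intensity v) fK => w E H Aw; rewrite -E; apply: H.
  by rewrite E (le_trans (lintl_le _ _))// AK.
Unshelve. all: by end_near. Qed.

Lemma multi_bound (t K e : R) : 0 < e -> \forall h \near 0^'+,
  forall v (A : set T), 0 <= v <= t -> @measurable _ (HT v) A ->
  (forall w, A w -> L v w <= K) ->
  Ex (fun w => \1_A w * \1_[set w | (1 < cnt (v + h) w - cnt v w)%N] w) <= e * h.
Proof.
move=> e0; have := @multi_exp t K e e0.
move=> near_h; near=> h.
have h0 : 0 < h by [].
have hh : forall v, 0 <= v <= t -> exists f, cond_prob P (history arr mark v)
   [set w | (1 < arrivals arr (v + h) w - arrivals arr v w)%N] f /\
  {ae P, forall w, int v w <= K -> `|f w - 0| <= e * h}.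
  by near: h.
move=> v A vt mA AK; have [f [cf fK]] := hh v vt.
rewrite (@eq_Ex _ _ _ _ _ (fun w => \1_A w *
  (\1_[set w | (1 < cnt (v + h) w - cnt v w)%N] w - 0))); last by move=> w; rewrite subr0.
rewrite (le_trans (ler_norm _))//.
apply: (@cond_prob_bound _ _ _ _ (history arr mark v) _ _ f) => //.
- exact: history_measurable mA.
- exact: measurable_multi.
- by apply: bmeasM; [apply: bmeas_indic; exact: history_measurable mA|exact: bmeas_cst].
- by rewrite mulr_ge0// ltW.
- apply: filterS2 (ae_intensity v) fK => w E H Aw; apply: H.
  by rewrite E (le_trans (lintl_le _ _))// AK.
Unshelve. all: by end_near. Qed.

End expansions.

(** * Absence of arrivals at fixed times *)

Section fixed_times.
Context d (T : measurableType d) (R : realType) (P : probability T R).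
Variables (arr mark : nat -> {RV P >-> R}) (lam r : R).
Hypothesis cp : counting_process arr.
Hypotheses (lam_gt0 : 0 < lam) (r_gt0 : 0 < r).
Hypothesis mark_gt0 : {ae P, forall w, forall i, 0 < mark i w}.
Local Notation cnt := (arrivals arr).
Local Notation HT v := (g_sigma_algebraType (hist_gen arr mark v)).
Local Notation Ex := (Ex P).
Local Notation int := (intensity lam r arr mark).
Local Notation L := (lint arr mark lam r).
Local Notation Ll := (lintl arr mark lam r).

Hypothesis none_exp : cond_prob_expansion lam r arr mark
  (fun t h => [set w | (arrivals arr (t + h) w - arrivals arr t w = 0)%N])
  (fun t h w => 1 - intensity lam r arr mark t w * h).

Lemma history_level v (K : R) : @measurable _ (HT v) [set w | L v w <= K].
Proof.
have mL : @measurable_fun _ _ (HT v) R setT (L v) by exact: history_lint.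
by rewrite -[X in measurable X]setTI -preimage_itvNyc; exact: mL.
Qed.

Lemma measurable_lint v : measurable_fun setT (L v).
Proof.
have mL : @measurable_fun _ _ (HT v) R setT (L v) by exact: history_lint.
by move=> _ Y mY; apply: (@history_measurable _ _ _ _ arr mark v); exact: mL.
Qed.

Lemma bmeas_level_mul v (A : set T) (K : R) (X : T -> R) : measurable A ->
  (forall w, A w -> L v w <= K) -> measurable_fun setT X ->
  (forall w, 0 <= X w <= L v w) -> bmeas (fun w => \1_A w * X w).
Proof.
move=> mA AK mX XL; split.
  by apply: measurable_funM => //; exact: measurable_indic.
exists `|K| => w; rewrite indicE; have [Aw|nA] := pselect (A w); last first.
  by rewrite memNset// mul0r normr0.
have /andP[X0 X1] := XL w.
rewrite mem_set// mul1r ger0_norm// (le_trans X1)// (le_trans (AK _ Aw))//.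
exact: ler_norm.
Qed.

Lemma lintl_itv v w : 0 <= Ll v w <= L v w.
Proof. by rewrite lintl_ge0//= lintl_le. Qed.

Lemma lint_itv v w : 0 <= L v w <= L v w.
Proof. by rewrite lexx lint_ge0. Qed.

Lemma jump_bound_left (h v K e : R) (A : set T) : 0 <= h -> 0 <= K -> measurable A ->
  (forall w, A w -> L v w <= K) ->
  `|Ex (fun w => \1_A w * (\1_[set w | (cnt (v + h) w - cnt v w = 0)%N] w -
      (1 - Ll v w * h)))| <= e * h ->
  Ex (fun w => \1_A w * \1_[set w | (cnt v w < cnt (v + h) w)%N] w) <= (K + e) * h.
Proof.
move=> h0 K0 mA AK H.
set J := [set w | _] in H; set J' := [set w | _].
have mJ' : measurable J' by exact: measurable_jump.
have JE w : \1_J w = 1 - \1_J' w :> R.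
  rewrite /J noneE// !indicE in_setC -/J'.
  by case: (w \in J'); rewrite ?subrr// subr0.
have bA := bmeas_indic R mA; have bJ' := bmeas_indic R mJ'.
have bL := bmeas_level_mul mA AK (measurable_lintl mark lam r cp v) (lintl_itv v).
have bLh : bmeas (fun w => \1_A w * Ll v w * h) by apply: bmeasM => //; exact: bmeas_cst.
have E : Ex (fun w => \1_A w * (\1_J w - (1 - Ll v w * h))) =
   Ex (fun w => \1_A w * Ll v w * h) - Ex (fun w => \1_A w * \1_J' w).
  rewrite -ExB//; last exact: bmeasM.
  by apply: eq_Ex => w; rewrite JE; ring.
rewrite E in H.
have LK : Ex (fun w => \1_A w * Ll v w * h) <= K * h.
  rewrite -[leRHS](Ex_cst P); apply: le_Ex => //; first exact: bmeas_cst.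
  move=> w; rewrite ler_wpM2r// indicE; have [Aw|nA] := pselect (A w); last first.
    by rewrite memNset// mul0r.
  by rewrite mem_set// mul1r (le_trans (lintl_le _ _ _ _ _ _))// AK.
by move: H; rewrite mulrDl ler_norml => /andP[h1 h2]; lra.
Qed.

(** An arrival at [v > 0] is a jump over the step from [v - h] to [v] for every small [h], and such
    a jump has probability at most [(K + 1) * h] where the intensity at [v - h] is at most [K]. The
    base point moves with [h], which is where the uniformity in time of the expansion enters. *)
Lemma no_fixed_arrival v : 0 <= v -> {ae P, forall w, forall i, arr i w != v}.
Proof.
rewrite le_eqVlt => /predU1P[<-|v0].
  by apply: aeW => w i; rewrite gt_eqF// arr_gt0.
pose A := \bigcup_i [set w | arr i w = v].
have mA : measurable A.
  apply: bigcupT_measurable => i.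
  have -> : [set w | arr i w = v] = arr i @^-1` [set v] by [].
  by rewrite -[_ @^-1` _]setTI; exact: measurable_funP.
suff PA : P A = 0%E.
  exists A; split => // w /= /existsNP[i /negP]; rewrite negbK => /eqP E.
  by exists i.
suff PA : fine (P A) <= 0.
  have PA0 : fine (P A) = 0 by apply/eqP; rewrite eq_le PA fine_ge0.
  by rewrite -[LHS]fineK ?PA0//; exact: fin_num_measure.
apply/ler_addgt0Pr => e e0; rewrite add0r.
have e20 : 0 < e / 2 by rewrite divr_gt0.
have mQ := measurable_lsup mark cp lam v.
have [K K0 hK] := tail_small P mQ e20.
have K1 : 0 < K + 1 by rewrite addr_gt0.
(* A step shorter than this gives [(K + 1) * h <= e / 2]; the other half of [e] is the tail of
   [lsup]. *)
have eK : 0 < e / 2 / (K + 1) by rewrite divr_gt0.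
have none := @none_bound_left _ _ _ _ arr mark lam r cp lam_gt0 mark_gt0 none_exp v K 1 ltr01.
have : \forall h \near 0^'+, [/\ 0 < h, h < v, h < e / 2 / (K + 1) &
    forall v0 (A : set T), 0 <= v0 <= v -> @measurable _ (HT v0) A ->
  (forall w, A w -> L v0 w <= K) ->
  `|Ex (fun w => \1_A w * (\1_[set w | (cnt (v0 + h) w - cnt v0 w = 0)%N] w -
      (1 - Ll v0 w * h)))| <= 1 * h].
  near=> h; split => //.
  by near: h.
move=> /filter_ex[h [h0 hv he {none}/(_ (v - h))]] .
set D := [set w | L (v - h) w <= K] => /(_ D) none.
have vh : 0 <= v - h <= v by rewrite subr_ge0 (ltW hv) gerBl ltW.
have mD : @measurable _ (HT (v - h)) D by exact: history_level.
have mDT : @measurable _ T D by exact: history_measurable mD.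
have DK w : D w -> L (v - h) w <= K by [].
have := jump_bound_left (ltW h0) (ltW K0) mDT DK (none vh mD DK).
rewrite subrK; set J := [set w | _] => HJ.
have mJ : measurable J.
  by have := measurable_jump cp (v - h) h; rewrite subrK.
have mQK : measurable [set w | K < lsup arr mark lam v w].
  by rewrite -[X in measurable X]setTI -preimage_itvoy; exact: mQ.
have bDJ : bmeas (fun w => \1_D w * \1_J w : R).
  by apply: bmeasM; exact: bmeas_indic.
have bQ := bmeas_indic R mQK.
rewrite -(Ex_indic P mA).
apply: (@le_trans _ _ (Ex (fun w => \1_D w * \1_J w + \1_[set w | K < lsup arr mark lam v w] w))).
  apply: le_Ex; [exact: bmeas_indic|exact: bmeasD|] => w.
  rewrite indicE; have [[i _ /= Aw]|nA] := pselect (A w); last first.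
    by rewrite memNset// addr_ge0// ?mulr_ge0// indicE ler0n.
  rewrite mem_set; last by exists i.
  have Jw : J w.
    rewrite /J /= (@leq_ltn_trans i)// ?lt_cnt ?Aw// leqNgt lt_cnt// Aw -ltNge.
    by rewrite ltrBlDr ltrDl.
  rewrite [\1_J w]indicE mem_set// mulr1 indic_setE !indicE.
  have [Dw|nD] := pselect (D w); first by rewrite mem_set// lerDl ler0n.
  rewrite memNset// add0r.
  move/negP : nD; rewrite /D /= -ltNge => /lt_le_trans -> //.
  by apply: lint_le_lsup => //; case/andP: vh.
rewrite ExD// [leRHS](splitr e) lerD//.
rewrite (le_trans HJ)// mulrC -ler_pdivlMr//; exact: ltW.
Unshelve. all: by end_near. Qed.

Lemma ae_lintl v : 0 <= v -> {ae P, forall w, Ll v w = L v w}.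
Proof.
move=> v0; apply: filterS (no_fixed_arrival v0) => w h.
rewrite /lintl /lint; congr (_ + _); apply: eq_bigr => i _.
have : (i < cnt v w)%N by [].
by rewrite lt_cnt// le_eqVlt (negbTE (h i)) /= => ->.
Qed.

Lemma ae_intensity_lint v : 0 <= v -> {ae P, forall w, int v w = L v w}.
Proof.
move=> v0; apply: filterS2 (ae_lintl v0) (ae_intensity lam r cp mark_gt0 v) => w E1 E2.
by rewrite E2.
Qed.

(** The form required by the martingale: a compensated jump with the right-continuous intensity.
    Passing to the complementary event only changes the sign, and [ae_lintl] exchanges the two
    versions of the intensity. *)
Lemma none_bound (t K e : R) : 0 < e -> \forall h \near 0^'+,
  forall v (A : set T), 0 <= v <= t -> @measurable _ (HT v) A ->
  (forall w, A w -> L v w <= K) ->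
  `|Ex (fun w => \1_A w * (\1_[set w | (cnt v w < cnt (v + h) w)%N] w - L v w * h))| <= e * h.
Proof.
move=> e0.
have := @none_bound_left _ _ _ _ arr mark lam r cp lam_gt0 mark_gt0 none_exp t K e e0.
move=> none; near=> h.
have h0 : 0 < h by [].
have : forall v (A : set T), 0 <= v <= t -> @measurable _ (HT v) A ->
  (forall w, A w -> L v w <= K) ->
  `|Ex (fun w => \1_A w * (\1_[set w | (cnt (v + h) w - cnt v w = 0)%N] w -
      (1 - Ll v w * h)))| <= e * h by near: h.
move=> none' v A vt mA AK; have /andP[v0 _] := vt.
have mAT := history_measurable mA.
apply: le_trans (none' v A vt mA AK).
set J := [set w | _]; set J' := [set w | _].
have mJ : measurable J by exact: measurable_jump.
have JE w : \1_J' w = 1 - \1_J w :> R.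
  rewrite /J' noneE ?(ltW h0)// !indicE in_setC -/J.
  by case: (w \in J); rewrite ?subrr// subr0.
have bA := bmeas_indic R mAT; have bJ := bmeas_indic R mJ.
have bLl := bmeas_level_mul mAT AK (measurable_lintl mark lam r cp v) (lintl_itv v).
have bL := bmeas_level_mul mAT AK (measurable_lint v) (lint_itv v).
have bX : bmeas (fun w => \1_A w * (\1_J w - L v w * h)).
  rewrite (_ : (fun _ => _) = fun w => \1_A w * \1_J w - \1_A w * L v w * h).
    by apply: bmeasB; [exact: bmeasM|apply: bmeasM => //; exact: bmeas_cst].
  by apply/funext => w; ring.
rewrite -normrN -ExN// (@Ex_ae _ _ _ P _ (fun w => \1_A w * (\1_J' w - (1 - Ll v w * h))))//.
- exact: bmeasN.
- rewrite (_ : (fun _ => _) = fun w => \1_A w * Ll v w * h - \1_A w * \1_J w).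
    by apply: bmeasB; [apply: bmeasM => //; exact: bmeas_cst|exact: bmeasM].
  by apply/funext => w; rewrite JE; ring.
- by apply: filterS (ae_lintl v0) => w ->; rewrite JE; ring.
Unshelve. all: by end_near. Qed.

End fixed_times.

(** * The martingale *)

Section step_estimates.
Variable R : realType.
Implicit Types (lam r K C Lp e h L rho b th : R) (S I c g : R[i]).

(* The increment of the exponent of [mart] over a step without arrival, in which
   the intensity relaxes from [L] to [lam + (L - lam) * rho] while [sol] goes
   from [S] to [S'] and its integral from [I] to [I']. *)
Definition step_delta lam r L rho S S' I I' : R[i] :=
  - S' * (lam + (L - lam) * rho)%:C - (lam * r)%:C * I' + S * L%:C + (lam * r)%:C * I.

(** With [c0] the drift, the ODE reads [s' = - c0 - r s]. To first order the relaxation of the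
    intensity contributes [(L - lam) r h S], the integral [lam r h S] and the change of the solution
    [- L h c0 - L r h S]; all terms in [S] cancel and [- L h c0] remains. *)
Lemma step_delta_expansion lam r K C Lp e h L rho S S' I I' c0 :
  0 <= lam -> 0 <= r -> 0 <= h -> lam <= L -> L <= K -> normc S' <= C ->
  normc (S - S' - h%:C * (- c0 - r%:C * S)) <= e * h ->
  normc (I - I' - h%:C * S) <= e * h ->
  normc (S' - S) <= Lp * h ->
  `|1 - rho - r * h| <= 2 * (r * h) ^+ 2 ->
  normc (step_delta lam r L rho S S' I I' + (L * h)%:C * c0) <=
  h * ((K + lam * r) * e + h * (2 * C * K * r ^+ 2 + K * r * Lp)).
Proof.
move=> lam0 r0 h0 lamL LK S'C h1 h2 h3 h4.
have L0 := le_trans lam0 lamL.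
have K0 := le_trans L0 LK.
have -> : step_delta lam r L rho S S' I I' + (L * h)%:C * c0 =
   L%:C * (S - S' - h%:C * (- c0 - r%:C * S)) +
   S' * ((L - lam) * (1 - rho - r * h))%:C +
   (lam * r)%:C * (I - I' - h%:C * S) + ((L - lam) * r * h)%:C * (S' - S).
  rewrite /step_delta !(rmorphM, rmorphD, rmorphB, rmorphN, rmorph1)/= ; ring.
rewrite (le_trans (le_normcD _ _))//.
have t1 : normc (L%:C * (S - S' - h%:C * (- c0 - r%:C * S))) <= K * (e * h).
  by rewrite ComplexField.Normc.normcM normc_real ger0_norm// ler_pM// normc_ge0.
have t2 : normc (S' * ((L - lam) * (1 - rho - r * h))%:C) <= C * (K * (2 * (r * h) ^+ 2)).
  rewrite ComplexField.Normc.normcM normc_real normrM; apply: ler_pM; rewrite ?normc_ge0 ?mulr_ge0//.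
  by rewrite ler_pM// ger0_norm ?subr_ge0//; lra.
have t3 : normc ((lam * r)%:C * (I - I' - h%:C * S)) <= lam * r * (e * h).
  by rewrite ComplexField.Normc.normcM normc_real ger0_norm ?mulr_ge0// ler_wpM2l// mulr_ge0.
have t4 : normc (((L - lam) * r * h)%:C * (S' - S)) <= K * r * h * (Lp * h).
  rewrite ComplexField.Normc.normcM normc_real ger0_norm; last first.
    by rewrite !mulr_ge0// subr_ge0.
  rewrite ler_pM ?normc_ge0//; first by rewrite !mulr_ge0// subr_ge0.
  by rewrite !ler_wpM2r//; lra.
have s1 := le_normcD (L%:C * (S - S' - h%:C * (- c0 - r%:C * S)))
   (S' * ((L - lam) * (1 - rho - r * h))%:C).
have s2 := le_normcD (L%:C * (S - S' - h%:C * (- c0 - r%:C * S)) +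
   S' * ((L - lam) * (1 - rho - r * h))%:C) ((lam * r)%:C * (I - I' - h%:C * S)).
have -> : h * ((K + lam * r) * e + h * (2 * C * K * r ^+ 2 + K * r * Lp)) =
  K * (e * h) + C * (K * (2 * (r * h) ^+ 2)) + lam * r * (e * h) + K * r * h * (Lp * h) by ring.
by lra.
Qed.

Lemma step_none_bound lam r L rho S S' I I' c0 (D M : R) :
  normc (step_delta lam r L rho S S' I I' + c0) <= D ->
  normc c0 <= M -> D + M <= 2^-1 ->
  normc (cexp (step_delta lam r L rho S S' I I') - 1 + c0) <= D + 7 * (D + M) ^+ 2.
Proof.
set dl := step_delta _ _ _ _ _ _ _ _ => h1 h2 h3.
have nd : normc dl <= D + M.
  rewrite (_ : dl = (dl + c0) - c0); last by ring.
  by rewrite (le_trans (le_normcB _ _))// lerD.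
rewrite (_ : _ + c0 = (dl + c0) + (cexp dl - 1 - dl)); last by ring.
rewrite (le_trans (le_normcD _ _))// lerD//.
rewrite (le_trans (cexp_bound2 (le_trans nd h3)))// ler_pM2l// lerXn2r// ?nnegrE ?normc_ge0//.
exact: le_trans (normc_ge0 _) nd.
Qed.

(** An error of order [h] is enough, since an arrival itself has probability of order [h]. Here [b]
    is the mark and [th] its discount from the arrival to the end of the step. The factor 3 is that
    of [cexp_lip]; [M] comes from the relaxation, [K * (Lp + C * r)] from the mark and [G] from the
    service factor. *)
Lemma step_one_bound lam r L rho S S' I I' b th g g' (C Lp K h M G : R) :
  0 <= lam -> 0 <= r -> 0 <= h -> lam <= L -> 0 <= rho -> 0 <= th <= 1 ->
  0 <= b <= K -> 0 <= complex.Re S -> 0 <= complex.Re S' ->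
  0 <= complex.Re I -> 0 <= complex.Re I' ->
  normc S' <= C -> normc (S' - S) <= Lp * h -> 1 - th <= r * h ->
  normc (step_delta lam r L rho S S' I I') <= M * h ->
  normc g <= 1 -> normc g' <= 1 -> normc (g' - g) <= G * h ->
  normc (g' * cexp (- S' * (lam + (L - lam) * rho + b * th)%:C) * cexp (- (lam * r)%:C * I')
     - g * cexp (- S * (L + b)%:C) * cexp (- (lam * r)%:C * I))
  <= (3 * (M + K * (Lp + C * r)) + G) * h.
Proof.
move=> lam0 r0 h0 lamL rho0 /andP[th0 th1] /andP[b0 bK] S0 S'0 I0 I'0 S'C S'S th_h dM g1 g'1 gg.
have L0 := le_trans lam0 lamL.
set a' := - S' * (lam + (L - lam) * rho + b * th)%:C + - (lam * r)%:C * I'.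
set a := - S * (L + b)%:C + - (lam * r)%:C * I.
have -> : g' * cexp (- S' * (lam + (L - lam) * rho + b * th)%:C) * cexp (- (lam * r)%:C * I')
     - g * cexp (- S * (L + b)%:C) * cexp (- (lam * r)%:C * I) =
   g' * (cexp a' - cexp a) + (g' - g) * cexp a.
  by rewrite /a /a' !cexpD; ring.
have ReN x (y : R) : complex.Re (y%:C * x) = y * complex.Re x by rewrite mulrC ReMr mulrC.
have Ra : complex.Re a <= 0.
  rewrite /a ReD ReMr cReN [- (lam * r)%:C * _]mulNr cReN ReN.
  have : 0 <= complex.Re S * (L + b) by rewrite mulr_ge0// addr_ge0.
  have : 0 <= lam * r * complex.Re I by rewrite !mulr_ge0.
  lra.
have Ra' : complex.Re a' <= 0.
  rewrite /a' ReD ReMr cReN [- (lam * r)%:C * _]mulNr cReN ReN.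
  have : 0 <= complex.Re S' * (lam + (L - lam) * rho + b * th).
    by rewrite mulr_ge0// !addr_ge0// mulr_ge0// subr_ge0.
  have : 0 <= lam * r * complex.Re I' by rewrite !mulr_ge0.
  lra.
have aa : normc (a' - a) <= (M + K * (Lp + C * r)) * h.
  have -> : a' - a = step_delta lam r L rho S S' I I' +
     b%:C * (S' * (1 - th)%:C - (S' - S)).
    rewrite /a /a' /step_delta !(rmorphM, rmorphD, rmorphB, rmorphN, rmorph1)/=; ring.
  rewrite (le_trans (le_normcD _ _))// mulrDl lerD//.
  rewrite ComplexField.Normc.normcM normc_real ger0_norm// -mulrA ler_pM ?normc_ge0//.
  rewrite (le_trans (le_normcB _ _))// mulrDl addrC lerD//.
  rewrite ComplexField.Normc.normcM normc_real ger0_norm ?subr_ge0//.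
  by rewrite -mulrA ler_pM ?normc_ge0// subr_ge0.
rewrite (le_trans (le_normcD _ _))// [leRHS]mulrDl lerD//.
  rewrite ComplexField.Normc.normcM -[leRHS]mul1r ler_pM ?normc_ge0//.
  by rewrite (le_trans (cexp_lip Ra' Ra))// -mulrA ler_pM2l.
rewrite ComplexField.Normc.normcM -[leRHS]mulr1 ler_pM ?normc_ge0//.
exact: normc_cexp_le1.
Qed.

End step_estimates.

Lemma near_mul_le (R : realType) (a c : R) : 0 < c -> \forall h \near 0^'+, h * a <= c.
Proof.
move=> c0; have a1 : 0 < `|a| + 1 by rewrite ltr_wpDl.
have ca : 0 < c / (`|a| + 1) by rewrite divr_gt0.
near=> h; have h0 : 0 < h by [].
have hc : h <= c / (`|a| + 1) by near: h; exact: nbhs_right_le.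
rewrite (@le_trans _ _ (h * (`|a| + 1)))//; last by rewrite -ler_pdivlMr.
by rewrite ler_pM2l// (le_trans (ler_norm _))// lerDl.
Unshelve. all: by end_near. Qed.

Section martingale_step.
Context d (T : measurableType d) (R : realType) (P : probability T R).
Variables (arr mark : nat -> {RV P >-> R}) (B : {RV P >-> R}).
Variables (lam r mu t : R) (z s : R[i]) (sol : R -> R[i]).
Hypothesis cp : counting_process arr.
Hypothesis B_gt0 : P [set w | 0 < B w] = 1%E.
Hypotheses (lam_gt0 : 0 < lam) (r_gt0 : 0 < r) (mu_gt0 : 0 < mu) (t_ge0 : 0 <= t).
Hypothesis z_le1 : normc z <= 1.
Hypothesis sol_ode : solves_ode r mu B z s t sol.
Local Notation cnt := (arrivals arr).
Local Notation HT v := (g_sigma_algebraType (hist_gen arr mark v)).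
Local Notation L := (lint arr mark lam r).
Local Notation W := (wprod arr mu t z).
Local Notation g := (gfun mu z).

Definition mart (v : R) (w : T) : R[i] := W v w *
  cexp (- sol (t - v) * (L v w)%:C) * cexp (- (lam * r)%:C * cintegral (t - v) sol).

(** The mean relative jump of [mart] at an arrival. Between arrivals the exponent of [mart] moves at
    rate [- L v * drift v], which compensates the jumps. *)
Definition drift (v : R) : R[i] := g (t - v) * beta B (sol (t - v)) - 1.

Definition newmark_factor (v : R) (x : R) : R[i] :=
  cexp (- sol (t - v) * (cpart x)%:C).

Definition jump (v h : R) (w : T) : R := \1_[set w | (cnt v w < cnt (v + h) w)%N] w.

(** The first-order part of the increment: the compensator, and a jump with the solution and the
    service factor frozen at [v] instead of the epoch. Freezing leaves the new mark as the only
    randomness of the jump factor. *)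
Definition mart_main (v h : R) (w : T) : R[i] :=
  mart v w * (- (L v w * h)%:C * drift v) +
  mart v w * (jump v h w)%:C * (g (t - v) * newmark_factor v (mark (cnt v w) w) - 1).

Lemma time_itv v : 0 <= v <= t -> 0 <= t - v <= t.
Proof. by move=> /andP[v0 vt]; rewrite subr_ge0 vt gerBl. Qed.

Lemma normc_newmark v x : 0 <= v <= t -> normc (newmark_factor v x) <= 1.
Proof.
move=> vt; apply: normc_cexp_le1; rewrite ReMr cReN mulNr oppr_le0 mulr_ge0 ?cpart_ge0//.
exact/(sol_Re sol_ode)/time_itv.
Qed.

Lemma cReMl (y : R) (x : R[i]) : complex.Re (y%:C * x) = y * complex.Re x.
Proof. by rewrite mulrC ReMr mulrC. Qed.

Lemma normc_mart v w : 0 <= v <= t -> normc (mart v w) <= 1.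
Proof.
move=> vt; have /andP[v0 v1] := vt; have /andP[u0 u1] := time_itv vt.
rewrite /mart ComplexField.Normc.normcM (ComplexField.Normc.normcM (W v w)).
have n1 : normc (W v w) <= 1 by exact: normc_wprod.
have n2 : normc (cexp (- sol (t - v) * (L v w)%:C)) <= 1.
  apply: normc_cexp_le1; rewrite ReMr cReN mulNr oppr_le0 mulr_ge0 ?lint_ge0//.
  by apply: (sol_Re sol_ode); rewrite u0.
have n3 : normc (cexp (- (lam * r)%:C * cintegral (t - v) sol)) <= 1.
  apply: normc_cexp_le1; rewrite mulNr cReN cReMl oppr_le0; apply: mulr_ge0.
    by rewrite mulr_ge0// ltW.
  exact: (cintegral_Re_ge0 sol_ode).
have n0 := @normc_ge0 R.
by rewrite !mulr_ile1 ?mulr_ge0 ?n0.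
Qed.

Lemma normc_drift v : 0 <= v <= t -> normc (drift v) <= 2.
Proof.
move=> vt; have /andP[u0 u1] := time_itv vt.
rewrite (le_trans (le_normcB _ _))// ComplexField.Normc.normc1 (natrD _ 1 1) lerD2r.
apply: (normc_gbeta B_gt0 mu_gt0 z_le1 u0); apply: (sol_Re sol_ode).
by rewrite u0.
Qed.

Lemma normc_main_jump v h w : 0 <= v <= t ->
  normc (mart v w * (jump v h w)%:C * (g (t - v) * newmark_factor v (mark (cnt v w) w) - 1))
    <= 2.
Proof.
move=> vt; have /andP[u0 u1] := time_itv vt.
have n0 := @normc_ge0 R.
have n1 := normc_mart w vt.
have n2 : normc (jump v h w)%:C <= 1.
  by rewrite normc_real /jump indicE ger0_norm ?ler0n// lern1 leq_b1.
rewrite -[leRHS]mul1r ComplexField.Normc.normcM ler_pM ?n0//.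
  by rewrite ComplexField.Normc.normcM -[leRHS]mul1r ler_pM ?n0.
rewrite (le_trans (le_normcB _ _))// ComplexField.Normc.normc1 (natrD _ 1 1) lerD2r.
rewrite ComplexField.Normc.normcM -[leRHS]mul1r ler_pM ?normc_newmark//.
exact: normc_gfun.
Qed.

(** Without arrival the error is at most [e * h]. With one arrival and a mark up to [K'] it is of
    order [h], hence below [e]. Otherwise a crude bound 5 is used: 2 for the two values of [mart], 1
    for the compensator and 2 for the jump term. *)
Lemma mart_step_bound (e K K' : R) : 0 < e -> 0 < K -> 0 < K' ->
  \forall h \near 0^'+, forall v, 0 <= v -> v + h <= t -> forall w, L v w <= K ->
  normc (mart (v + h) w - mart v w - mart_main v h w) <=
    e * h + e * jump v h w +
    5 * (jump v h w * \1_[set w | K' < cpart (mark (cnt v w) w)] w +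
         \1_[set w | (1 < cnt (v + h) w - cnt v w)%N] w).
Proof.
move=> e0 K0 K'0.
have ar1 (x y : R) : y <= x / 4 -> x / 4 + y <= x / 2 by lra.
have ar2 (x y : R) : y <= x / 2 -> x / 2 + y <= x by lra.
have ar3 (a b c p q u k y : R) : a <= b + c -> b <= p + q -> c <= u + y ->
  p <= 1 -> q <= 1 -> u <= k -> k <= 1 -> y <= 2 -> a <= 5 by lra.
have ar4 (x y i : R) : 0 <= x -> 0 < y -> 0 <= i -> 5 <= x + y + 5 * (1 + i) by lra.
have ar5 (u x y : R) : u < y -> u + x - y <= x by lra.
have ar6 (x y u : R) : 1 + x <= y -> - x <= u -> 1 - y <= u by lra.
have ar7 (u x y q : R) : u < y -> y <= u + x -> - x <= q - y - (q - u) <= x.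
  by move=> *; apply/andP; split; lra.
have ar8 (x y u k a b i j : R) : x <= u -> y <= k -> u + k <= b -> 0 <= a ->
  0 <= i -> 0 <= j -> x + y <= a + b + 5 * (i + j) by lra.
have [C C0 hC] := sol_bounded t_ge0 sol_ode.
have [Lp Lp0 hLp] := sol_Lip B_gt0 r_gt0 mu_gt0 t_ge0 z_le1 sol_ode.
have cK : 0 < K + lam * r by rewrite addr_gt0// mulr_gt0.
(* The increments of the solution and of its integral enter [step_delta_expansion] with total weight
   [K + lam * r], so they cost [e / 4]. *)
pose e' := e / (4 * (K + lam * r)).
have e'0 : 0 < e' by rewrite divr_gt0// mulr_gt0.
have [d1 d10 hd1] := sol_increment B_gt0 r_gt0 mu_gt0 t_ge0 z_le1 sol_ode e'0.
have [d2 d20 hd2] := sol_integral_increment B_gt0 r_gt0 mu_gt0 t_ge0 z_le1 sol_ode e'0.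
(* [M * h] bounds the change of the exponent: [e / 2] from the expansion error and [2 * K] from the
   intensity times the drift, which is at most 2. *)
pose M := e / 2 + 2 * K.
have e2 : 0 < e / 2 by rewrite divr_gt0.
have e4 : 0 < e / 4 by rewrite divr_gt0.
have half : 0 < 2^-1 :> R by rewrite invr_gt0.
near=> h.
have h0 : 0 < h by [].
have hd1' : h <= d1 by near: h; exact: nbhs_right_le.
have hd2' : h <= d2 by near: h; exact: nbhs_right_le.
have hr : h * r <= 2^-1 by near: h; exact: near_mul_le.
have hc2 : h * (2 * C * K * r ^+ 2 + K * r * Lp) <= e / 4 by near: h; exact: near_mul_le.
have hM : h * M <= 2^-1 by near: h; exact: near_mul_le.
have hM2 : h * (7 * M ^+ 2) <= e / 2 by near: h; exact: near_mul_le.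
have h1 : h * (3 * (M + K' * (Lp + C * r)) + 2 * mu + 2 * K) <= e.
  by near: h; exact: near_mul_le.
have hK : h * (2 * K) <= 1 by near: h; exact: near_mul_le.
move=> v v0 vht w LK.
have vt : 0 <= v <= t by rewrite v0 (le_trans _ vht)// lerDl ltW.
have vht' : 0 <= v + h <= t by rewrite vht andbT addr_ge0// ltW.
have /andP[b0 bt] := time_itv vt; have /andP[a0 at'] := time_itv vht'.
set S := sol (t - v); set S' := sol (t - (v + h)).
set I := cintegral (t - v) sol; set I' := cintegral (t - (v + h)) sol.
set c0 := drift v.
have ab : t - (v + h) <= t - v by rewrite lerD2l lerN2 lerDl ltW.
have abh : t - v - (t - (v + h)) = h by ring.
have RS : 0 <= complex.Re S by apply: (sol_Re sol_ode); rewrite b0.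
have RS' : 0 <= complex.Re S' by apply: (sol_Re sol_ode); rewrite a0.
have RI : 0 <= complex.Re I by exact: (cintegral_Re_ge0 sol_ode).
have RI' : 0 <= complex.Re I' by exact: (cintegral_Re_ge0 sol_ode).
have S'C : normc S' <= C by apply: hC; rewrite a0.
have incS : normc (S - S' - h%:C * (- c0 - r%:C * S)) <= e' * h.
  have := hd1 _ _ a0 ab bt; rewrite abh => /(_ hd1').
  by rewrite /c0 /drift -/S -/S' (_ : vfield _ _ _ _ _ _ = - (g (t - v) * beta B S - 1) - r%:C * S)// /vfield; ring.
have incI : normc (I - I' - h%:C * S) <= e' * h.
  by have := hd2 _ _ a0 ab bt; rewrite abh => /(_ hd2').
have lipS : normc (S' - S) <= Lp * h.
  by have := hLp _ _ a0 ab bt; rewrite abh normcBC.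
set rho := expR (- r * h).
have rho0 : 0 <= rho by exact: expR_ge0.
have rhoE : `|1 - rho - r * h| <= 2 * (r * h) ^+ 2.
  have rh0 : 0 <= r * h by rewrite mulr_ge0// ltW.
  have := @expR_bound2 R (- r * h).
  rewrite mulNr normrN (ger0_norm rh0) => /(_ _) H.
  rewrite -normrN (_ : - (1 - rho - r * h) = expR (- (r * h)) - 1 - - (r * h)); last first.
    by rewrite /rho mulNr; ring.
  by apply: H; rewrite mulrC.
have lL := lint_ge arr mark lam r v w.
have L0 := lint_ge0 arr mark r lam_gt0 v w.
set Lv := L v w in LK lL L0 *.
have Dd := step_delta_expansion (ltW lam_gt0) (ltW r_gt0) (ltW h0) lL LK S'C incS incI lipS rhoE.
set delta := step_delta _ _ _ _ _ _ _ _ in Dd.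
have nLc : normc ((Lv * h)%:C * c0) <= h * (2 * K).
  rewrite ComplexField.Normc.normcM normc_real ger0_norm; last by rewrite mulr_ge0// ltW.
  rewrite (_ : h * (2 * K) = K * h * 2); last by ring.
  rewrite ler_pM ?normc_ge0// ?mulr_ge0 ?(ltW h0)//; last exact: normc_drift.
  by rewrite ler_pM2r.
have De : normc (delta + (Lv * h)%:C * c0) <= h * (e / 2).
  rewrite (le_trans Dd)// ler_pM2l//.
  have -> : (K + lam * r) * e' = e / 4 by rewrite /e'; field; rewrite gt_eqF.
  exact: ar1.
have nM : normc (mart v w) <= 1 by exact: normc_mart.
have nM' : normc (mart (v + h) w) <= 1 by exact: normc_mart.
have deltaM : normc delta <= M * h.
  rewrite (_ : delta = (delta + (Lv * h)%:C * c0) - (Lv * h)%:C * c0); last by ring.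
  rewrite (le_trans (le_normcB _ _))// /M [leRHS]mulrDl lerD//; first by rewrite [leRHS]mulrC.
  by rewrite [leRHS]mulrC.
have nX1 : normc (mart v w * (- (Lv * h)%:C * c0)) <= h * (2 * K).
  rewrite ComplexField.Normc.normcM mulNr normcN -[leRHS]mul1r.
  by rewrite ler_pM ?normc_ge0.
have eh0 : 0 <= e * h by rewrite mulr_ge0// ltW.
have ind0 (A : set T) : 0 <= \1_A w :> R by rewrite indicE ler0n.
have j0 : 0 <= jump v h w by exact: ind0.
have [E|NE] := eqVneq (cnt (v + h) w) (cnt v w).
  have J0 : jump v h w = 0 by rewrite /jump indic_setE E ltnn.
  rewrite /mart_main J0 rmorph0 mulr0 mul0r addr0 -/Lv -/c0.
  have -> : mart (v + h) w = mart v w * cexp delta.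
    have E' : cexp (- S' * (lam + (Lv - lam) * rho)%:C) * cexp (- (lam * r)%:C * I') =
        cexp (- S * Lv%:C) * cexp (- (lam * r)%:C * I) * cexp delta.
      by rewrite -!cexpD; congr cexp; rewrite /delta /step_delta; ring.
    rewrite /mart (wprod_none mu t z E) (lint_none mark lam r E) -/S -/S' -/I -/I' -/Lv -/rho.
    by rewrite -mulrA E'; ring.
  rewrite [X in normc X](_ : _ = mart v w * (cexp delta - 1 + (Lv * h)%:C * c0)); last by ring.
  have := step_none_bound De nLc; rewrite -mulrDr -/M => /(_ hM) H.
  rewrite mulr0 addr0 (@le_trans _ _ (e * h))//.
    rewrite ComplexField.Normc.normcM -[leRHS]mul1r ler_pM ?normc_ge0//.
    rewrite (le_trans H)// (_ : 7 * (h * M) ^+ 2 = h * (h * (7 * M ^+ 2))); last by ring.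
    by rewrite -mulrDr [leRHS]mulrC ler_pM2l//; exact: ar2.
  by rewrite lerDl mulr_ge0// addr_ge0// mulr_ge0.
have lt : (cnt v w < cnt (v + h) w)%N.
  by rewrite ltn_neqAle eq_sym NE cnt_le// lerDl ltW.
have J1 : jump v h w = 1 by rewrite /jump indic_setE lt.
have crude : normc (mart (v + h) w - mart v w - mart_main v h w) <= 5.
  have X2 := @normc_main_jump v h w vt.
  rewrite /mart_main -/Lv.
  set x1 := mart v w * (- _ * _); set x2 := mart v w * _ * _ in X2 *.
  apply: (ar3 _ _ _ _ _ _ _ _ (le_normcB (mart (v + h) w - mart v w) (x1 + x2))
    (le_normcB (mart (v + h) w) (mart v w)) (le_normcD x1 x2) nM' nM _ hK X2).
  exact: nX1.
have [E1|NE1] := eqVneq (cnt (v + h) w) (cnt v w).+1; last first.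
  have M1 : \1_[set w | (1 < cnt (v + h) w - cnt v w)%N] w = 1 :> R.
    rewrite indic_setE (_ : (1 < _)%N)// ltn_subRL addn1.
    by rewrite ltn_neqAle eq_sym NE1.
  rewrite M1 J1 mul1r mulr1 (le_trans crude)// [X in 5 * X]addrC.
  by apply: ar4.
set b := cpart (mark (cnt v w) w).
have [bK|bK] := ltP K' b.
  have K1 : \1_[set w0 | K' < cpart (mark (cnt v w0) w0)] w = 1 :> R.
    by rewrite indic_setE bK.
  rewrite K1 J1 mul1r mulr1 (le_trans crude)//.
  by apply: ar4.
set tau := arr (cnt v w) w.
have tau1 : v < tau by rewrite /tau -cnt_ge.
have tau2 : tau <= v + h by rewrite /tau -lt_cnt.
set th := expR (- r * (v + h - tau)).
have th01 : 0 <= th <= 1.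
  by rewrite expR_ge0/= discount_le1// subr_ge0.
have thh : 1 - th <= r * h.
  apply: (ar6 (- r * (v + h - tau))); first exact: expR_ge1Dx.
  by rewrite mulNr opprK ler_pM2l// ar5.
have g1 : normc (g (t - v)) <= 1 by exact: normc_gfun.
have t_tau : 0 <= t - tau by rewrite subr_ge0 (le_trans tau2).
have g2 : normc (g (t - tau)) <= 1 by exact: normc_gfun.
have gg : normc (g (t - tau) - g (t - v)) <= 2 * mu * h.
  rewrite (le_trans (gfun_lip mu_gt0 z_le1 t_tau b0))// ler_wpM2l ?mulr_ge0 ?(ltW mu_gt0)//.
  by rewrite ler_norml; apply: ar7.
have bb : 0 <= b <= K' by rewrite cpart_ge0.
have H := step_one_bound (ltW lam_gt0) (ltW r_gt0) (ltW h0) lL rho0 th01 bb RS RS' RI RI'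
  S'C lipS thh deltaM g1 g2 gg.
pose x1 := mart v w * (- (Lv * h)%:C * c0).
pose y := W v w * (g (t - tau) * cexp (- S' * (lam + (Lv - lam) * rho + b * th)%:C) * cexp (- (lam * r)%:C * I')
     - g (t - v) * cexp (- S * (Lv + b)%:C) * cexp (- (lam * r)%:C * I)).
have E2 : mart (v + h) w - mart v w - mart_main v h w = y - x1.
  have Em : mart v w * (g (t - v) * newmark_factor v (mark (cnt v w) w)) =
      W v w * (g (t - v) * cexp (- S * (Lv + b)%:C) * cexp (- (lam * r)%:C * I)).
    rewrite /mart /newmark_factor -/b -/S -/Lv -/I [(Lv + b)%:C]rmorphD mulrDr cexpD.
    by ring.
  have Em' : mart (v + h) w = W v w * (g (t - tau) *
      cexp (- S' * (lam + (Lv - lam) * rho + b * th)%:C) * cexp (- (lam * r)%:C * I')).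
    rewrite /mart (wprod_one mu t z E1) (lint_one mark lam r E1).
    by rewrite -/Lv -/rho -/tau -/th -/b -/S' -/I'; ring.
  rewrite /mart_main J1 rmorph1 mulr1 -/Lv -/c0 -/x1 mulrBr mulr1 Em Em' /y mulrBr.
  by ring.
rewrite E2.
rewrite (le_trans (le_normcB _ _))//.
have nx1 : normc x1 <= h * (2 * K) by [].
have ny : normc y <= (3 * (M + K' * (Lp + C * r)) + 2 * mu) * h.
  rewrite /y ComplexField.Normc.normcM -[leRHS]mul1r ler_pM ?normc_ge0//.
  by apply: normc_wprod => //; case/andP: vt.
have i1 : 0 <= \1_[set w0 | K' < cpart (mark (cnt v w0) w0)] w :> R by [].
have i2 : 0 <= \1_[set w | (1 < cnt (v + h) w - cnt v w)%N] w :> R by [].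
have : h * (3 * (M + K' * (Lp + C * r)) + 2 * mu + 2 * K) =
  (3 * (M + K' * (Lp + C * r)) + 2 * mu) * h + h * (2 * K) by ring.
rewrite J1 mulr1 mul1r => E3; rewrite E3 in h1.
exact: (ar8 _ _ _ _ _ _ _ _ ny nx1 h1 eh0 i1 i2).
Unshelve. all: by end_near. Qed.

End martingale_step.

(** * The mean increment over one step *)

Section martingale_mean.
Context d (T : measurableType d) (R : realType) (P : probability T R).
Variables (arr mark : nat -> {RV P >-> R}) (B : {RV P >-> R}).
Variables (lam r mu t : R) (z s : R[i]) (sol : R -> R[i]).
Hypothesis cp : counting_process arr.
Hypothesis B_gt0 : P [set w | 0 < B w] = 1%E.
Hypotheses (lam_gt0 : 0 < lam) (r_gt0 : 0 < r) (mu_gt0 : 0 < mu) (t_ge0 : 0 <= t).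
Hypothesis z_le1 : normc z <= 1.
Hypothesis sol_ode : solves_ode r mu B z s t sol.
Hypothesis iid_mark : iid mark (distribution P B).
Hypothesis indep_mark : forall i,
  independent_sigma P (gen_sigma [set (mark i : T -> R)]) (before_mark arr mark i).
Hypothesis mark_gt0 : {ae P, forall w, forall i, 0 < mark i w}.
Hypothesis none_exp : cond_prob_expansion lam r arr mark
  (fun t h => [set w | (arrivals arr (t + h) w - arrivals arr t w = 0)%N])
  (fun t h w => 1 - intensity lam r arr mark t w * h).
Hypothesis multi_exp : cond_prob_expansion lam r arr mark
  (fun t h => [set w | (1 < arrivals arr (t + h) w - arrivals arr t w)%N])
  (fun _ _ _ => 0).
Local Notation cnt := (arrivals arr).
Local Notation HT v := (g_sigma_algebraType (hist_gen arr mark v)).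
Local Notation L := (lint arr mark lam r).
Local Notation M := (mart arr mark lam r mu t z sol).
Local Notation Ex := (Ex P).
Local Notation Ec := (cexpectation P).
Local Notation J := (jump arr).

Lemma history_mart v : 0 <= v <= t -> @cbmeas _ (HT v) R (M v).
Proof.
move=> vt; have /andP[u0 u1] := time_itv vt.
apply: cbmeasM; last exact: cbmeas_cst.
apply: cbmeasM; first by apply: history_wprod => //; case/andP: vt.
apply: cbmeas_cexpNM.
- by apply: (sol_Re sol_ode); rewrite u0.
- exact: history_lint.
- by move=> w; exact: lint_ge0.
Qed.

Lemma cbmeas_mart v : 0 <= v <= t -> @cbmeas _ T R (M v).
Proof.
by move=> vt; apply: cbmeas_sub (history_mart vt); exact: hist_gen_measurable.
Qed.

Lemma bmeas_jump v h : bmeas (J v h).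
Proof. by apply: bmeas_indic; exact: measurable_jump. Qed.

Lemma new_mark_tail v h (A : set T) (K : R) : @measurable _ (HT v) A ->
  Ex (fun w => \1_A w * J v h w * \1_[set x | K < cpart x] (mark (cnt v w) w)) =
  Ex (fun w => \1_A w * J v h w) * Ex \1_[set w | K < cpart (B w)].
Proof.
move=> mA.
have mK : measurable [set x : R | K < cpart x].
  rewrite -[X in measurable X]setTI -preimage_itvoy; exact: measurable_cpart.
pose phi x : R[i] := (\1_[set x | K < cpart x] x : R)%:C.
have bphi : cbmeas phi by exact: cbmeas_indic.
have nind (A' : Type) (D : set A') x : normc ((\1_D x : R)%:C) <= 1.
  by rewrite normc_real indicE ger0_norm ?ler0n// lern1 leq_b1.
have := new_mark_indep cp iid_mark indep_mark h (cbmeas_indic R mA)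
  (nind _ _) bphi (nind _ _).
have -> : Ec (phi \o B) = (Ex \1_[set w | K < cpart (B w)])%:C.
  by rewrite -Ec_real; apply: eq_Ec => w; rewrite /phi /= !indic_setE.
rewrite -[X in X * _]/(Ec (fun w => (\1_A w)%:C * (J v h w)%:C)).
rewrite (@eq_Ec _ _ _ _ (fun w => (\1_A w)%:C * (J v h w)%:C) (fun w => (\1_A w * J v h w)%:C)); last first.
  by move=> w; rewrite rmorphM.
rewrite (@eq_Ec _ _ _ _ _
  (fun w => (\1_A w * J v h w * \1_[set x | K < cpart x] (mark (cnt v w) w))%:C)); last first.
  by move=> w; rewrite /phi !rmorphM.
by rewrite !Ec_real -rmorphM => /complexI.
Qed.

(** Independence replaces the factor of the new mark by its mean [beta]. The mean relative jump is
    then [drift], which is also the factor of the compensator, so the two terms merge into a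
    compensated jump. *)
Lemma Ec_main v h (A : set T) (K : R) : 0 <= v <= t -> @measurable _ (HT v) A ->
  (forall w, A w -> L v w <= K) ->
  Ec (fun w => mart_main arr mark B lam r mu t z sol v h w * (\1_A w)%:C) =
  drift B mu t z sol v * Ec (fun w => M v w * (\1_A w * (J v h w - L v w * h))%:C).
Proof.
move=> vt mA AK; have mAT := history_measurable mA.
have /andP[u0 u1] := time_itv vt.
have S0 : 0 <= complex.Re (sol (t - v)) by apply: (sol_Re sol_ode); rewrite u0.
have bM := cbmeas_mart vt.
have bA := cbmeas_indic R mAT.
have bU := bmeas_level_mul mAT AK (measurable_lint mark lam r cp v) (lint_itv arr mark r lam_gt0 v).
have bJ := bmeas_jump v h.
have bJA : bmeas (fun w => \1_A w * J v h w) by apply: bmeasM => //; exact: bmeas_indic.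
have bUh : bmeas (fun w => \1_A w * L v w * h) by apply: bmeasM => //; exact: bmeas_cst.
set c0 := drift _ _ _ _ _ _; set gt := gfun mu z (t - v).
have mphi : cbmeas (newmark_factor t sol v).
  apply: cbmeas_cexpNM => //; first exact: measurable_cpart.
  by move=> x; exact: cpart_ge0.
have bnew : cbmeas (fun w => newmark_factor t sol v (mark (cnt v w) w)).
  apply: cbmeas_cexpNM => //; last by move=> w; exact: cpart_ge0.
  apply: measurableT_comp; first exact: measurable_cpart.
  exact: measurable_new_mark.
have E1 : Ec (fun w => M v w * (\1_A w * J v h w)%:C * newmark_factor t sol v (mark (cnt v w) w)) =
    Ec (fun w => M v w * (\1_A w * J v h w)%:C) * beta B (sol (t - v)).
  have bZ : @cbmeas _ (HT v) R (fun w => M v w * (\1_A w)%:C).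
    by apply: cbmeasM; [exact: history_mart|exact: cbmeas_indic].
  have nZ w : normc (M v w * (\1_A w)%:C) <= 1.
    rewrite ComplexField.Normc.normcM mulr_ile1 ?normc_ge0//; first exact: (normc_mart mark cp lam_gt0 r_gt0 mu_gt0 z_le1 sol_ode).
    by rewrite normc_real indicE ger0_norm ?ler0n// lern1 leq_b1.
  have := new_mark_indep cp iid_mark indep_mark h bZ nZ mphi
    (fun x => normc_newmark sol_ode x vt).
  rewrite (betaE B_gt0 S0) => H.
  transitivity (Ec (fun w => M v w * (\1_A w)%:C * (J v h w)%:C *
     newmark_factor t sol v (mark (cnt v w) w))).
    by apply: eq_Ec => w; rewrite rmorphM; ring.
  rewrite H; congr (_ * _).
  by apply: eq_Ec => w; rewrite rmorphM; ring.
have bMJ : cbmeas (fun w => M v w * (\1_A w * J v h w)%:C).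
  by apply: cbmeasM => //; exact: cbmeas_real.
have bMU : cbmeas (fun w => M v w * (\1_A w * L v w * h)%:C).
  by apply: cbmeasM => //; exact: cbmeas_real.
have bMJn := cbmeasM bMJ bnew.
rewrite (@eq_Ec _ _ _ _ _ (fun w => (M v w * (\1_A w * L v w * h)%:C * (- c0) +
   M v w * (\1_A w * J v h w)%:C * newmark_factor t sol v (mark (cnt v w) w) * gt) +
   M v w * (\1_A w * J v h w)%:C * (- 1))); last first.
  by move=> w; rewrite /mart_main -/c0 -/gt !rmorphM; ring.
have bcst (X : T -> R[i]) c : cbmeas X -> cbmeas (fun w => X w * c).
  by move=> bX; apply: cbmeasM => //; exact: cbmeas_cst.
rewrite EcD; [|by apply: cbmeasD; exact: bcst|exact: bcst].
rewrite EcD; [|exact: bcst|exact: bcst].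
rewrite !EcZr// E1.
rewrite (@eq_Ec _ _ _ _ (fun w => M v w * (\1_A w * (J v h w - L v w * h))%:C)
  (fun w => M v w * (\1_A w * J v h w)%:C - M v w * (\1_A w * L v w * h)%:C)); last first.
  by move=> w; rewrite -mulrBr -rmorphB; congr (_ * _%:C); ring.
by rewrite EcB// /c0 /drift -/gt; ring.
Qed.

Lemma mart_step (e K : R) : 0 < e -> 0 < K ->
  \forall h \near 0^'+, forall v, 0 <= v -> v + h <= t ->
  forall A : set T, @measurable _ (HT v) A -> (forall w, A w -> L v w <= K) ->
  normc (Ec (fun w => (M (v + h) w - M v w) * (\1_A w)%:C)) <= e * h.
Proof.
move=> e0 K0.
have K1 : 0 < K + 1 by rewrite addr_gt0.
(* The uses of [e1] have weights 1, [K + 1] and 12, adding up to [e / 4]. Large marks and multiple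
   arrivals cost [e / 20] each, times the crude bound 5, hence [e / 2]; the total is [3 * e / 4]. *)
pose e1 := e / (4 * (14 + K)).
have e10 : 0 < e1 by rewrite divr_gt0// mulr_gt0// addr_gt0.
have p0 : 0 < e / (20 * (K + 1)) by rewrite divr_gt0// mulr_gt0.
have e20 : 0 < e / 20 by rewrite divr_gt0.
have [K' K'0 hK'] := tail_small P (measurable_cpartB B) p0.
have step := mart_step_bound mark cp B_gt0 lam_gt0
  r_gt0 mu_gt0 t_ge0 z_le1 sol_ode e10 K0 K'0.
have none := none_bound cp lam_gt0 r_gt0 mark_gt0 none_exp t K e10.
have none1 := none_bound cp lam_gt0 r_gt0 mark_gt0 none_exp t K ltr01.
have multi := multi_bound cp mark_gt0 multi_exp t K e20.
near=> h.
have h0 : 0 < h by [].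
have step' : forall v, 0 <= v -> v + h <= t -> forall w, L v w <= K ->
  normc (M (v + h) w - M v w - mart_main arr mark B lam r mu t z sol v h w) <=
    e1 * h + e1 * J v h w +
    5 * (J v h w * \1_[set w | K' < cpart (mark (cnt v w) w)] w +
         \1_[set w | (1 < cnt (v + h) w - cnt v w)%N] w) by near: h; exact: step.
have none' : forall v (A : set T), 0 <= v <= t -> @measurable _ (HT v) A ->
  (forall w, A w -> L v w <= K) ->
  `|Ex (fun w => \1_A w * (J v h w - L v w * h))| <= e1 * h by near: h; exact: none.
have none1' : forall v (A : set T), 0 <= v <= t -> @measurable _ (HT v) A ->
  (forall w, A w -> L v w <= K) ->
  `|Ex (fun w => \1_A w * (J v h w - L v w * h))| <= 1 * h by near: h; exact: none1.
have multi' : forall v (A : set T), 0 <= v <= t -> @measurable _ (HT v) A ->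
  (forall w, A w -> L v w <= K) ->
  Ex (fun w => \1_A w * \1_[set w | (1 < cnt (v + h) w - cnt v w)%N] w) <= e / 20 * h.
  by near: h; exact: multi.
move=> v v0 vht A mA AK; have mAT := history_measurable mA.
have vt : 0 <= v <= t by rewrite v0 (le_trans _ vht)// lerDl ltW.
have vht' : 0 <= v + h <= t by rewrite vht andbT addr_ge0// ltW.
set main := mart_main arr mark B lam r mu t z sol v h.
have bM := cbmeas_mart vt; have bM' := cbmeas_mart vht'.
have bI := bmeas_indic R mAT; have bA := cbmeas_indic R mAT.
have bU := bmeas_level_mul mAT AK (measurable_lint mark lam r cp v) (lint_itv arr mark r lam_gt0 v).
have bJ := bmeas_jump v h.
have bUh : bmeas (fun w => \1_A w * L v w * h) by apply: bmeasM => //; exact: bmeas_cst.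
have bIJ := bmeasM bI bJ.
pose Y w := \1_A w * (J v h w - L v w * h).
have bY : bmeas Y.
  rewrite (_ : Y = fun w => \1_A w * J v h w - \1_A w * L v w * h); first exact: bmeasB.
  by apply/funext => w; rewrite /Y; ring.
have nM w : normc (M v w) <= 1 by exact: (normc_mart mark cp lam_gt0 r_gt0 mu_gt0 z_le1 sol_ode).
have e1h : 0 <= e1 * h by rewrite mulr_ge0// ltW.
(* A level set of [Z] intersected with [A] is again a history set on which the intensity is at most
   [K], so the expansion may be tested against it. *)
have layer (Z : T -> R) : @bmeas _ (HT v) R Z -> (forall w, `|Z w| <= 1) ->
    `|Ex (fun w => Z w * Y w)| <= 3 * (e1 * h).
  move=> bZ nZ; rewrite -[X in X * _]mulr1.
  have bZT : @bmeas _ T R Z by apply: bmeas_sub bZ; exact: hist_gen_measurable.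
  apply: (layer_bound bZT bY nZ ltr01) => x.
  have mZ : @measurable _ (HT v) [set w | x <= Z w] by exact: level_measurable.
  have := none' v ([set w | x <= Z w] `&` A) vt (measurableI _ _ mZ mA).
  move=> /(_ (fun w h => AK w h.2)).
  rewrite (@eq_Ex _ _ _ _ _ (fun w => \1_[set w0 | x <= Z w0] w * Y w))//.
  by move=> w; rewrite indicI /= /Y mulrA.
have [bMr bMi] := history_mart vt.
(* The factor 12 is 2 for the drift times 3 for the level sets of each of the real and imaginary
   parts of [M]. *)
have main_bound : normc (Ec (fun w => main w * (\1_A w)%:C)) <= 12 * (e1 * h).
  rewrite (Ec_main _ vt mA AK) ComplexField.Normc.normcM.
  rewrite (_ : 12 * (e1 * h) = 2 * (3 * (e1 * h) + 3 * (e1 * h))); last by ring.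
  rewrite ler_pM ?normc_ge0//; first exact: (normc_drift B_gt0 mu_gt0 z_le1 sol_ode).
  rewrite EcE (le_trans (normc_le_ReIm _))//= lerD//.
    rewrite (@eq_Ex _ _ _ _ _ (fun w => complex.Re (M v w) * Y w)).
      by apply: layer => // w; exact: le_trans (normc_ge_Re _) (nM w).
    by move=> w; rewrite ReMr.
  rewrite (@eq_Ex _ _ _ _ _ (fun w => complex.Im (M v w) * Y w)).
    by apply: layer => // w; exact: le_trans (normc_ge_Im _) (nM w).
  by move=> w; rewrite ImMr.
have bphi : cbmeas (fun w => newmark_factor t sol v (mark (cnt v w) w)).
  have /andP[u0 u1] := time_itv vt.
  apply: cbmeas_cexpNM; first by apply: (sol_Re sol_ode); rewrite u0.
    apply: measurableT_comp; first exact: measurable_cpart.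
    exact: measurable_new_mark.
  by move=> w; exact: cpart_ge0.
have bmain : cbmeas (fun w => main w * (\1_A w)%:C).
  rewrite (_ : (fun _ => _) = fun w => M v w * (\1_A w * L v w * h)%:C * (- drift B mu t z sol v) +
     M v w * (J v h w)%:C * (gfun mu z (t - v) * newmark_factor t sol v (mark (cnt v w) w) - 1) * (\1_A w)%:C); last first.
    by apply/funext => w; rewrite /main /mart_main !rmorphM; ring.
  apply: cbmeasD.
    by apply: cbmeasM; [apply: cbmeasM => //; exact: cbmeas_real|exact: cbmeas_cst].
  apply: cbmeasM => //; apply: cbmeasM; first by apply: cbmeasM => //; exact: cbmeas_real.
  apply: cbmeasB; last exact: cbmeas_cst.
  by apply: cbmeasM => //; exact: cbmeas_cst.
set Q := [set w | K' < cpart (mark (cnt v w) w)] in step'.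
set N := [set w | (1 < cnt (v + h) w - cnt v w)%N] in step' multi'.
have mQ : measurable Q.
  rewrite /Q -[X in measurable X]setTI -preimage_itvoy.
  have m : measurable_fun setT (fun w => cpart (mark (cnt v w) w)).
    apply: measurableT_comp; first exact: measurable_cpart.
    exact: measurable_new_mark.
  exact: m.
have mN : measurable N by exact: measurable_multi.
have bQ := bmeas_indic R mQ; have bN := bmeas_indic R mN.
have IJ : Ex (fun w => \1_A w * J v h w) <= (K + 1) * h.
  have E : Ex (fun w => \1_A w * J v h w) = Ex Y + Ex (fun w => \1_A w * L v w * h).
    by rewrite -ExD//; apply: eq_Ex => w; rewrite /Y; ring.
  rewrite E addrC mulrDl lerD//; last exact: le_trans (ler_norm _) (none1' v A vt mA AK).
  rewrite -[leRHS](Ex_cst P); apply: le_Ex => //; first exact: bmeas_cst.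
  move=> w; rewrite ler_pM2r// indicE; have [Aw|nA] := pselect (A w).
    by rewrite mem_set// mul1r AK.
  by rewrite memNset// mul0r ltW.
pose bd w := \1_A w * (e1 * h) + \1_A w * J v h w * e1 + (\1_A w * J v h w * \1_Q w + \1_A w * \1_N w) * 5.
have bIJQ := bmeasM bIJ bQ; have bIN := bmeasM bI bN.
have bc (X : T -> R) c : bmeas X -> bmeas (fun w => X w * c).
  by move=> bX; apply: bmeasM => //; exact: bmeas_cst.
have bbd : bmeas bd.
  by apply: bmeasD; [apply: bmeasD; exact: bc|apply: bc; exact: bmeasD].
have Ebd : Ex bd <= e1 * h + (K + 1) * h * e1 + ((K + 1) * h * (e / (20 * (K + 1))) + e / 20 * h) * 5.
  rewrite /bd ExD; [|by apply: bmeasD; exact: bc|by apply: bc; exact: bmeasD].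
  rewrite ExD; [|exact: bc|exact: bc].
  rewrite !ExZr//; last exact: bmeasD.
  rewrite ExD// lerD//.
    rewrite lerD//; last by rewrite ler_wpM2r// ltW.
    rewrite -[leRHS]mul1r ler_wpM2r// -(Ex_cst P 1); apply: le_Ex => //.
    exact: bmeas_cst.
  rewrite ler_wpM2r// lerD//; last exact: multi'.
  rewrite (@eq_Ex _ _ _ _ _ (fun w => \1_A w * J v h w * \1_[set x | K' < cpart x] (mark (cnt v w) w))).
    rewrite new_mark_tail// ler_pM//; apply: Rintegral_ge0 => w _.
      by rewrite mulr_ge0// /jump indicE ler0n.
    by rewrite indicE ler0n.
  by move=> w; rewrite !indic_setE.
rewrite (@eq_Ec _ _ _ _ _ (fun w => (M (v + h) w - M v w - main w) * (\1_A w)%:C + main w * (\1_A w)%:C)); last first.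
  by move=> w; ring.
have brest : cbmeas (fun w => (M (v + h) w - M v w - main w) * (\1_A w)%:C).
  rewrite (_ : (fun _ => _) = fun w => (M (v + h) w - M v w) * (\1_A w)%:C - main w * (\1_A w)%:C).
    by apply: cbmeasB => //; apply: cbmeasM => //; exact: cbmeasB.
  by apply/funext => w; rewrite mulrBl.
rewrite EcD// (le_trans (le_normcD _ _))//.
have rest : normc (Ec (fun w => (M (v + h) w - M v w - main w) * (\1_A w)%:C)) <= Ex bd.
  apply: normc_Ec => // w.
  rewrite ComplexField.Normc.normcM normc_real; have [Aw|nA] := pselect (A w).
    have A1 : \1_A w = 1 :> R by rewrite indicE mem_set.
    rewrite A1 normr1 mulr1 (le_trans (step' v v0 vht w (AK w Aw)))//.
    by rewrite /bd A1 !mul1r le_eqVlt; apply/orP; left; apply/eqP; ring.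
  have A0 : \1_A w = 0 :> R by rewrite indicE memNset.
  by rewrite A0 normr0 mulr0 /bd A0 !mul0r !addr0 mul0r.
rewrite (le_trans (lerD rest main_bound))// (le_trans (lerD Ebd (lexx _)))//.
rewrite [leLHS](_ : _ = e * h * (3 / 4)); last first.
  by rewrite /e1; field; rewrite !gt_eqF// addr_gt0.
by rewrite ler_piMr ?mulr_ge0 ?(ltW e0) ?(ltW h0)// ler_pdivrMr// mul1r ler_nat.
Unshelve. all: by end_near. Qed.

End martingale_mean.

(** * Summation over a grid up to the first exit *)

Section telescoping.
Context d (T : measurableType d) (R : realType) (P : probability T R).
Variables (arr mark : nat -> {RV P >-> R}) (B : {RV P >-> R}).
Variables (lam r mu t : R) (z s : R[i]) (sol : R -> R[i]).
Hypothesis cp : counting_process arr.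
Hypothesis B_gt0 : P [set w | 0 < B w] = 1%E.
Hypotheses (lam_gt0 : 0 < lam) (r_gt0 : 0 < r) (mu_gt0 : 0 < mu) (t_ge0 : 0 <= t).
Hypothesis z_le1 : normc z <= 1.
Hypothesis sol_ode : solves_ode r mu B z s t sol.
Hypothesis iid_mark : iid mark (distribution P B).
Hypothesis indep_mark : forall i,
  independent_sigma P (gen_sigma [set (mark i : T -> R)]) (before_mark arr mark i).
Hypothesis mark_gt0 : {ae P, forall w, forall i, 0 < mark i w}.
Hypothesis none_exp : cond_prob_expansion lam r arr mark
  (fun t h => [set w | (arrivals arr (t + h) w - arrivals arr t w = 0)%N])
  (fun t h w => 1 - intensity lam r arr mark t w * h).
Hypothesis multi_exp : cond_prob_expansion lam r arr mark
  (fun t h => [set w | (1 < arrivals arr (t + h) w - arrivals arr t w)%N])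
  (fun _ _ _ => 0).
Local Notation cnt := (arrivals arr).
Local Notation HT v := (g_sigma_algebraType (hist_gen arr mark v)).
Local Notation L := (lint arr mark lam r).
Local Notation M := (mart arr mark lam r mu t z sol).
Local Notation Ex := (Ex P).
Local Notation Ec := (cexpectation P).
Local Notation J := (jump arr).


Let Mm := history_mart mark cp lam_gt0 mu_gt0 z_le1 sol_ode.

(** The event [D k] that no exit has occurred yet belongs to the history at the left end of step
    [k], so the one-step estimate applies on it. The stopped sum differs from the full increment
    after an exit only, by two values of modulus at most 1. *)
Lemma mart_const_aux (h K e : R) (n : nat) : 0 < h -> n%:R * h = t -> 0 <= e ->
  (forall v, 0 <= v -> v + h <= t ->
    forall A : set T, @measurable _ (HT v) A -> (forall w, A w -> L v w <= K) ->
    normc (Ec (fun w => (M (v + h) w - M v w) * (\1_A w)%:C)) <= e * h) ->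
  normc (Ec (M t) - Ec (M 0)) <= e * t + 2 * Ex \1_[set w | K < lsup arr mark lam t w].
Proof.
move=> h0 nh e0 step.
pose v k := k%:R * h.
have vt k : (k <= n)%N -> 0 <= v k <= t.
  by move=> kn; rewrite mulr_ge0 ?(ltW h0)//= -nh ler_pM2r// ler_nat.
have vS k : v k.+1 = v k + h by rewrite /v -natr1 mulrDl mul1r.
pose D k := [set w | forall j, (j <= k)%N -> L (v j) w <= K].
have mD k : @measurable _ (HT (v k)) (D k).
  elim: k => [|k IH].
    rewrite (_ : D 0%N = [set w | L (v 0%N) w <= K]); first exact: history_level.
    by apply/seteqP; split => w; [apply|move=> h1 j; rewrite leqn0 => /eqP ->].
  rewrite (_ : D k.+1 = D k `&` [set w | L (v k.+1) w <= K]).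
    apply: measurableI; last exact: history_level.
    apply: (history_sub (u := v k)); last exact: IH.
    by rewrite vS lerDl ltW.
  apply/seteqP; split => w /=.
    by move=> h1; split; [move=> j jk; apply: h1; exact: leqW|exact: h1].
  by move=> [h1 h2] j; rewrite leq_eqVlt => /predU1P[->//|]; rewrite ltnS; exact: h1.
have mDT k : @measurable _ T (D k) by exact: history_measurable (mD k).
pose X k w := (M (v k.+1) w - M (v k) w) * (\1_(D k) w)%:C.
have bM k : (k <= n)%N -> @cbmeas _ T R (M (v k)).
  move=> kn; apply: cbmeas_sub (Mm (vt k kn)); exact: hist_gen_measurable.
(* For [k >= n] the step leaves [0, t], where no bound on [M] is available; the default 0 makes the
   family bounded for every index. *)
pose X' k w := if (k < n)%N then X k w else 0.
have bX' k : cbmeas (X' k).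
  rewrite /X'; case: ltnP => kn; last exact: cbmeas_cst.
  apply: cbmeasM; last exact: cbmeas_indic.
  by apply: cbmeasB; [exact: (bM k.+1 kn)|exact: (bM k (ltnW kn))].
have XX' w : \sum_(k < n) X k w = \sum_(k < n) X' k w.
  by apply: eq_bigr => k _; rewrite /X' ltn_ord.
have v0 : v 0%N = 0 by rewrite /v mul0r.
have vn : v n = t by [].
have M0 : @cbmeas _ T R (M 0) by have := bM 0%N (leq0n n); rewrite v0.
have Mt : @cbmeas _ T R (M t) by have := bM n (leqnn n); rewrite vn.
(* The sum of the increments kept by [D] is the increment up to the first exit. *)
have stop w m : (m <= n)%N -> exists k, [/\ (k <= m)%N,
    \sum_(j < m) X j w = M (v k) w - M (v 0%N) w & D m w -> k = m].
  elim: m => [|m IH] mn; first by exists 0%N; split => //; rewrite big_ord0 subrr.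
  have [k [km E Dk]] := IH (ltnW mn).
  rewrite big_ord_recr/= E /X.
  have [Dm|nDm] := pselect (D m w).
    by exists m.+1; split => //; rewrite (Dk Dm) indicE mem_set// rmorph1 mulr1 addrC addrA subrK.
  exists k; split => [||Dm1]; first exact: leqW.
    by rewrite indicE memNset// rmorph0 mulr0 addr0.
  by exfalso; apply: nDm => j jm; apply: Dm1; exact: leqW.
have bS : cbmeas (fun w => \sum_(k < n) X' k w) by exact: cbmeas_sum.
rewrite -EcB//.
rewrite (@eq_Ec _ _ _ _ _ (fun w => \sum_(k < n) X' k w +
  (M t w - M 0 w - \sum_(k < n) X' k w))); last by move=> w; ring.
have bR : cbmeas (fun w => M t w - M 0 w - \sum_(k < n) X' k w).
  by apply: cbmeasB => //; exact: cbmeasB.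
rewrite EcD// (le_trans (le_normcD _ _))// lerD//.
  rewrite Ec_sum//.
  have -> : e * t = \sum_(k < n) e * h.
    by rewrite sumr_const card_ord -nh -mulr_natl; ring.
  elim/big_ind2 : _ => [|x1 x2 y1 y2 H1 H2|k _].
  - by rewrite ComplexField.Normc.normc0.
  - by rewrite (le_trans (le_normcD _ _))// lerD.
  - rewrite /X' ltn_ord /X vS; apply: step => //.
    + by have /andP[] := vt k (ltnW (ltn_ord k)).
    + by rewrite -vS; have /andP[] := vt k.+1 (ltn_ord k).
    + by move=> w; apply.
have mQ := measurable_lsup mark cp lam t.
have mQK : measurable [set w | K < lsup arr mark lam t w].
  by rewrite -[X in measurable X]setTI -preimage_itvoy; exact: mQ.
have bQ := bmeas_indic R mQK.
rewrite -ExZl//; apply: normc_Ec => //.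
  by apply: bmeasM => //; exact: bmeas_cst.
move=> w; rewrite -XX'; have [k [kn -> Dk]] := stop w n (leqnn n).
rewrite v0 (_ : M t w - M 0 w - _ = M t w - M (v k) w); last by rewrite opprB addrA subrK.
rewrite indic_setE; case: ltP => wK.
  rewrite mulr1 (le_trans (le_normcB _ _))// (natrD _ 1 1) lerD//.
    apply: (normc_mart mark cp lam_gt0 r_gt0 mu_gt0 z_le1 sol_ode).
    by have := vt n (leqnn n); rewrite vn.
  by apply: (normc_mart mark cp lam_gt0 r_gt0 mu_gt0 z_le1 sol_ode); exact: vt.
(* If [lsup <= K], no exit occurs, so the stopping index is [n] and nothing is left over. *)
rewrite Dk ?vn ?subrr ?ComplexField.Normc.normc0 ?mulr0// => j jn.
by apply: le_trans wK; apply: lint_le_lsup => //; case/andP: (vt j jn).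
Qed.

Lemma mart_const : Ec (M t) = Ec (M 0).
Proof.
have [->//|t0] := eqVneq t 0.
have {}t0 : 0 < t by rewrite lt_neqAle eq_sym t0.
apply/eqP; rewrite -subr_eq0; apply/eqP/ComplexField.Normc.eq0_normc.
apply/eqP; rewrite eq_le normc_ge0 andbT; apply/ler_addgt0Pr => e e0; rewrite add0r.
have e4 : 0 < e / 4 by rewrite divr_gt0.
(* All steps together cost [e / (2 * t) * t = e / 2], and the exit event at most [2 * (e / 4)]. *)
have et : 0 < e / (2 * t) by rewrite divr_gt0// mulr_gt0.
have [K K0 hK] := tail_small P (measurable_lsup mark cp lam t) e4.
have [del /= del0 hdel] := mart_step cp B_gt0 lam_gt0 r_gt0 mu_gt0 t_ge0 z_le1 sol_ode
  iid_mark indep_mark mark_gt0 none_exp multi_exp et K0.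
pose n := (Num.truncn (t / del)).+1.
have n0 : 0 < n%:R :> R by rewrite ltr0n.
have h0 : 0 < t / n%:R by rewrite divr_gt0.
have hd : t / n%:R < del.
  by rewrite ltr_pdivrMr// mulrC -ltr_pdivrMr//; exact: truncnS_gt.
have nh : n%:R * (t / n%:R) = t by rewrite mulrC divfK// gt_eqF.
have step := hdel (t / n%:R) _ h0.
apply: le_trans (mart_const_aux h0 nh (ltW et) (step _)) _.
  by rewrite /ball/= sub0r normrN gtr0_norm.
have -> : e / (2 * t) * t = e / 2 by field; rewrite gt_eqF.
by lra.
Qed.

End telescoping.

(** * Thinning by the services *)

Section exponential_tail.
Variables (R : realType) (mu : R).
Hypothesis mu_gt0 : 0 < mu.

Lemma exponential_prob_le (x : R) : 0 <= x ->
  exponential_prob mu `]-oo, x] = (1 - expR (- mu * x))%:E.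
Proof.
move=> x0.
have meas (A : set R) : measurable A -> measurable_fun A (EFin \o exponential_pdf mu).
  move=> mA; apply/measurable_EFinP; apply: measurable_funTS.
  exact: measurable_exponential_pdf.
have -> : `]-oo, x]%classic = `]-oo, 0[%classic `|` `[0, x]%classic :> set R.
  by rewrite -itv_bndbnd_setU ?bnd_simp.
rewrite /exponential_prob ge0_integral_setU//=; first last.
- by apply/disj_setPS => y [/=]; rewrite !in_itv/= => y0 /andP[]; rewrite leNgt y0.
- by move=> y _; rewrite lee_fin exponential_pdf_ge0// ltW.
- by apply: meas; exact: measurableU.
rewrite [X in (X + _)%E]integral0_eq; last first.
  by move=> y /=; rewrite in_itv/= => y0; rewrite lt0_exponential_pdf.
rewrite add0e.
move: x0; rewrite le_eqVlt => /predU1P[<-|x0].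
  by rewrite set_itv1 integral_set1 mulr0 expR0 subrr.
by rewrite -/(exponential_prob mu `[0, x]) exponential_prob_itv0c// EFinB.
Qed.

End exponential_tail.

Section services.
Context d (T : measurableType d) (R : realType) (P : probability T R).
Variables (arr mark serv : nat -> {RV P >-> R}) (mu : R).
Hypothesis mu_gt0 : 0 < mu.
Hypothesis iid_serv : iid serv (exponential_prob mu).
Hypothesis indep_serv :
  independent_sigma P (gen_sigma (range (fun i => serv i : T -> R)))
    (gen_sigma (range (fun i => arr i : T -> R) `|` range (fun i => mark i : T -> R))).
Local Notation Ec := (cexpectation P).
Local Notation Ex := (Ex P).

Definition epoch_gen : set_system T :=
  gen_of (range (fun i => arr i : T -> R) `|` range (fun i => mark i : T -> R)).
Definition serv_gen : set_system T := gen_of (range (fun i => serv i : T -> R)).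
Local Notation AT := (g_sigma_algebraType epoch_gen).

Lemma epoch_gen_measurable : epoch_gen `<=` measurable.
Proof. by apply: gen_of_measurable => f [[i _ <-]|[i _ <-]]; exact: measurable_funP. Qed.

Lemma serv_gen_measurable : serv_gen `<=` measurable.
Proof. by apply: gen_of_measurable => f [i _ <-]; exact: measurable_funP. Qed.

Lemma serv_tail j (x : R) : 0 <= x ->
  P (serv j @^-1` `]x, +oo[) = (expR (- mu * x))%:E.
Proof.
move=> x0; have [law _] := iid_serv.
have m1 : measurable (serv j @^-1` `]-oo, x]).
  by rewrite -[X in measurable X]setTI; exact: measurable_funP.
have -> : serv j @^-1` `]x, +oo[ = ~` (serv j @^-1` `]-oo, x]).
  by rewrite preimage_setC setCitvl.
rewrite probability_setC//.
have := law j `]-oo, x]%classic (measurable_itv _).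
rewrite exponential_prob_le// /distribution /pushforward => ->.
by rewrite -EFinB; congr (_%:E); ring.
Qed.

Definition tail_event (J : {fset nat}) (x : nat -> R) : set T :=
  \bigcap_(j in [set` J]) (serv j @^-1` `]x j, +oo[).

Lemma tail_event_gen J x :
  @measurable _ (g_sigma_algebraType serv_gen) (tail_event J x).
Proof.
apply: bigcap_measurableType => j Jj.
rewrite -[X in measurable X]setTI.
have m : @measurable_fun _ _ (g_sigma_algebraType serv_gen) R setT (serv j).
  by apply: gen_of_fun; exists j.
exact: m.
Qed.

Lemma prob_tail_event (J : {fset nat}) x : (forall j, j \in J -> 0 <= x j) ->
  P (tail_event J x) = (\prod_(j <- J) expR (- mu * x j))%:E.
Proof.
move=> x0; have [_ ind] := iid_serv.
rewrite /tail_event ind; last by move=> j; exact: measurable_itv.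
rewrite (big_morph EFin EFinM erefl).
by apply: eq_big_seq => j jJ; rewrite serv_tail// x0.
Qed.

Lemma Ec_tail_event (Phi : T -> R[i]) (J : {fset nat}) x : @cbmeas _ AT R Phi ->
  (forall j, j \in J -> 0 <= x j) ->
  Ec (fun w => Phi w * (\1_(tail_event J x) w)%:C) =
  Ec Phi * (\prod_(j <- J) expR (- mu * x j))%:C.
Proof.
move=> bPhi x0.
have b1 : @cbmeas _ (g_sigma_algebraType serv_gen) R (fun w => (\1_(tail_event J x) w)%:C).
  by apply: cbmeas_indic; exact: tail_event_gen.
have := EcM_indep serv_gen_measurable epoch_gen_measurable indep_serv b1 bPhi.
rewrite Ec_real Ex_indic; last first.
  by apply: (sigma_sub_measurable serv_gen_measurable); exact: tail_event_gen.
rewrite prob_tail_event//= => H.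
by rewrite [RHS]mulrC -H; apply: eq_Ec => w; rewrite mulrC.
Qed.

End services.

Section thinning.
Context d (T : measurableType d) (R : realType) (P : probability T R).
Variables (arr mark serv : nat -> {RV P >-> R}) (mu : R).
Hypothesis mu_gt0 : 0 < mu.
Hypothesis iid_serv : iid serv (exponential_prob mu).
Hypothesis indep_serv :
  independent_sigma P (gen_sigma (range (fun i => serv i : T -> R)))
    (gen_sigma (range (fun i => arr i : T -> R) `|` range (fun i => mark i : T -> R))).
Local Notation Ec := (cexpectation P).
Local Notation Ex := (Ex P).


Variables (t : R) (z : R[i]).
Hypotheses (t_gt0 : 0 < t) (z_le1 : normc z <= 1).
Hypothesis arr_ge0 : forall i w, 0 <= arr i w.
Local Notation AT := (g_sigma_algebraType (epoch_gen arr mark)).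

Definition alive i w : bool := arr i w <= t < arr i w + serv i w.

(** The conditional probability of [alive i] given the epochs and marks. *)
Definition alive_mean i w : R := if arr i w <= t then expR (- mu * (t - arr i w)) else 0.

Definition alive_prod n w : R[i] := \prod_(i < n) (1 + (z - 1) * (alive i w)%:R).

Definition mean_prod n w : R[i] := \prod_(i < n) (1 + (z - 1) * (alive_mean i w)%:C).

Lemma epoch_arr i : @measurable_fun _ _ AT R setT (arr i).
Proof. by apply: gen_of_fun; left; exists i. Qed.

Lemma measurable_alive i : measurable [set w | alive i w].
Proof.
rewrite (_ : mkset _ = [set w | arr i w <= t] `&` [set w | t < arr i w + serv i w]).
  apply: measurableI; first exact: measurable_arr_le.
  rewrite -[X in measurable X]setTI -preimage_itvoy.
  have m : measurable_fun setT (fun w => arr i w + serv i w).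
    by apply: measurable_funD; exact: measurable_funP.
  exact: m.
by apply/seteqP; split => w /=; rewrite /alive => /andP.
Qed.

Lemma cbmeas_alive i : cbmeas (fun w => (alive i w)%:R : R[i]).
Proof.
rewrite (_ : (fun _ => _) = fun w => (\1_[set w | alive i w] w)%:C).
  by apply: cbmeas_indic; exact: measurable_alive.
by apply/funext => w; rewrite indic_setE rmorph_nat.
Qed.

Lemma cbmeas_alive_prod n : cbmeas (alive_prod n).
Proof.
apply: cbmeas_prod => i; apply: cbmeasD; first exact: cbmeas_cst.
by apply: cbmeasM; [exact: cbmeas_cst|exact: cbmeas_alive].
Qed.

Lemma alive_mean_itv i w : 0 <= alive_mean i w <= 1.
Proof.
rewrite /alive_mean; case: ifPn => at'; last by rewrite lexx ler01.
by rewrite expR_ge0/= discount_le1// subr_ge0.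
Qed.

Lemma bmeas_alive_mean i : @bmeas _ AT R (alive_mean i).
Proof.
split; last first.
  exists 1 => w; have /andP[a0 a1] := alive_mean_itv i w.
  by rewrite ger0_norm.
have mA : @measurable _ AT [set w | arr i w <= t].
  rewrite -[X in measurable X]setTI -preimage_itvNyc; exact: epoch_arr.
rewrite (_ : alive_mean i = fun w => expR (- mu * (t - arr i w)) * \1_[set w | arr i w <= t] w).
  apply: measurable_funM; last exact: measurable_indic.
  apply: measurableT_comp => //; apply: measurable_funM; first exact: measurable_cst.
  by apply: measurable_funB; [exact: measurable_cst|exact: epoch_arr].
by apply/funext => w; rewrite /alive_mean indic_setE; case: ifP; rewrite ?mulr1 ?mulr0.
Qed.

Lemma cbmeas_mean_prod n : @cbmeas _ AT R (mean_prod n).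
Proof.
apply: cbmeas_prod => i; apply: cbmeasD; first exact: cbmeas_cst.
by apply: cbmeasM; [exact: cbmeas_cst|apply: cbmeas_real; exact: bmeas_alive_mean].
Qed.

Lemma normc_convex (a : R) : 0 <= a <= 1 -> normc (1 + (z - 1) * a%:C) <= 1.
Proof.
move=> /andP[a0 a1].
have -> : 1 + (z - 1) * a%:C = (1 - a)%:C + z * a%:C by rewrite rmorphB/= rmorph1; ring.
rewrite (le_trans (le_normcD _ _))// ComplexField.Normc.normcM !normc_real.
rewrite !ger0_norm ?subr_ge0//.
have : normc z * a <= a by rewrite ler_piMl.
by lra.
Qed.

Lemma normc_alive_prod n w : normc (alive_prod n w) <= 1.
Proof.
apply: (normc_prod (F := fun i => 1 + (z - 1) * (alive i w)%:R)) => i _.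
rewrite -(rmorph_nat (real_complex R)); apply: normc_convex.
by rewrite ler0n lern1 leq_b1.
Qed.

Lemma normc_mean_prod n w : normc (mean_prod n w) <= 1.
Proof.
apply: (normc_prod (F := fun i => 1 + (z - 1) * (alive_mean i w)%:C)) => i _.
exact/normc_convex/alive_mean_itv.
Qed.

(* The statement carries lower bounds on the services [j >= n] so that the
   service [n] can be conditioned on in an induction on [n]. *)
Definition thinned n := forall (Phi : T -> R[i]) (J : {fset nat}) (x : nat -> R),
  @cbmeas _ AT R Phi -> (forall w, normc (Phi w) <= 1) ->
  (forall j, j \in J -> (n <= j)%N) -> (forall j, j \in J -> 0 <= x j) ->
  Ec (fun w => Phi w * alive_prod n w * (\1_(tail_event serv J x) w)%:C) =
  Ec (fun w => Phi w * mean_prod n w) * (\prod_(j <- J) expR (- mu * x j))%:C.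

Lemma normc_indic (A : set T) w : normc ((\1_A w : R)%:C) <= 1.
Proof. by rewrite normc_real indicE ger0_norm ?ler0n// lern1 leq_b1. Qed.

Lemma tail_eventU1 n (J : {fset nat}) x y : n \notin J ->
  tail_event serv (n |` J)%fset (fun j => if j == n then y else x j) =
  (serv n @^-1` `]y, +oo[) `&` tail_event serv J x.
Proof.
move=> nJ; apply/seteqP; split => w /=.
  move=> h; split; first by have := h n; rewrite /= fset1U1 eqxx; apply.
  move=> j /= jJ; have := h j; rewrite /= fset1Ur// => /(_ isT).
  by case: eqP => // E; move: nJ; rewrite -E jJ.
move=> [h1 h2] j /=; rewrite in_fset1U => /orP[/eqP ->|jJ]; first by rewrite eqxx.
case: eqP => [E|_]; first by move: nJ; rewrite -E jJ.
exact: h2.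
Qed.

Lemma prod_tailU1 n (J : {fset nat}) (x : nat -> R) y : n \notin J ->
  \prod_(j <- (n |` J)%fset) expR (- mu * (if j == n then y else x j)) =
  expR (- mu * y) * \prod_(j <- J) expR (- mu * x j).
Proof.
move=> nJ; rewrite big_fsetU1//= eqxx; congr (_ * _).
by apply: eq_big_seq => j jJ; case: eqP => // E; move: nJ; rewrite -E jJ.
Qed.

Section grid.
Variables (n N : nat).
Hypothesis N_gt0 : (0 < N)%N.
Let del : R := t / N%:R.

Definition cell k w : bool := [&& arr n w <= t, k%:R * del <= arr n w & arr n w < k.+1%:R * del].

Lemma del_gt0 : 0 < del.
Proof. by rewrite divr_gt0// ltr0n. Qed.

Lemma cell_measurable k : @measurable _ AT [set w | cell k w].
Proof.
have m := epoch_arr n.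
rewrite (_ : mkset _ = [set w | arr n w <= t] `&` ([set w | k%:R * del <= arr n w] `&`
  [set w | arr n w < k.+1%:R * del])).
  apply: measurableI; first by rewrite -[X in measurable X]setTI -preimage_itvNyc; exact: m.
  apply: measurableI; first by rewrite -[X in measurable X]setTI -preimage_itvcy; exact: m.
  by rewrite -[X in measurable X]setTI -preimage_itvNyo; exact: m.
apply/seteqP; split => w /=; rewrite /cell; first by move=> /and3P[].
by move=> [-> [-> ->]].
Qed.

(** An epoch up to [t] lies in exactly one cell. There are [N + 1] cells because an epoch equal to
    [t] falls into the cell of index [N]. *)
Lemma cell_sum (V : pzRingType) (F : nat -> V) w :
  exists2 k, arr n w <= t -> cell k w & \sum_(j < N.+1) (cell j w)%:R * F j =
    if arr n w <= t then F k else 0.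
Proof.
have d0 := del_gt0.
set k := Num.truncn (arr n w / del).
have /andP[k1 k2] : k%:R <= arr n w / del < k.+1%:R.
  by apply: truncn_itv; rewrite divr_ge0// ltW.
have ck j : cell j w = (arr n w <= t) && (j == k).
  rewrite /cell; congr andb.
  rewrite -ler_pdivlMr// -ltr_pdivrMr//; apply/idP/idP => [/andP[j1 j2]|/eqP ->]; last first.
    by rewrite k1.
  rewrite eqn_leq -[(j <= k)%N]ltnS -[(k <= j)%N]ltnS -!(ltr_nat R).
  by rewrite (le_lt_trans j1)// (le_lt_trans k1).
exists k; first by rewrite ck eqxx andbT.
case: ifPn => at'.
  have kN : (k < N.+1)%N.
    rewrite ltnS -(ler_nat R) (le_trans k1)// ler_pdivrMr// /del mulrC divfK//.
    by rewrite pnatr_eq0 -lt0n.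
  rewrite (bigD1 (Ordinal kN))//= ck at' eqxx mul1r big1 ?addr0// => j /negP jk.
  rewrite ck at'/=; case: eqP => [E|_]; last by rewrite mul0r.
  by case: jk; apply/eqP/val_inj.
by rewrite big1// => j _; rewrite ck (negbTE at')/= mul0r.
Qed.

End grid.

Lemma thinned0 : thinned 0.
Proof.
move=> Phi J x bPhi _ _ x0.
rewrite (@eq_Ec _ _ _ _ _ (fun w => Phi w * (\1_(tail_event serv J x) w)%:C)); last first.
  by move=> w; rewrite /alive_prod big_ord0 mulr1.
rewrite (Ec_tail_event mu_gt0 iid_serv indep_serv bPhi x0); congr (_ * _).
by apply: eq_Ec => w; rewrite /mean_prod big_ord0 mulr1.
Qed.

Lemma tail_event_measurable J x : measurable (tail_event serv J x).
Proof.
by apply: (sigma_sub_measurable (@serv_gen_measurable _ _ _ _ serv)); exact: tail_event_gen.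
Qed.

Lemma Ex_serv_tail (A : set T) j (x : R) : @measurable _ AT A -> 0 <= x ->
  Ex (fun w => \1_A w * \1_(serv j @^-1` `]x, +oo[) w) = Ex \1_A * expR (- mu * x).
Proof.
move=> mA x0.
have := Ec_tail_event mu_gt0 iid_serv indep_serv (cbmeas_indic R mA) (J := [fset j]%fset)
  (x := fun=> x) (fun _ _ => x0).
rewrite big_seq_fset1 Ec_real -rmorphM => H; apply: complexI; rewrite -H -Ec_real.
apply: eq_Ec => w; rewrite rmorphM; congr (_ * (\1__ _)%:C).
apply/seteqP; split => w' /=; first by move=> h i /=; rewrite inE => /eqP ->.
by move=> h; apply: (h j); rewrite /= inE.
Qed.

(** The presence of customer [n] relates its service to its own random epoch. On a cell of the grid
    the epoch is nearly constant, so presence is nearly the event that the service exceeds a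
    constant; this is one more lower bound in the tail event, to which the induction hypothesis
    applies, while the indicator of the cell joins [Phi]. *)
Lemma thinned_alive n : thinned n -> forall (Phi : T -> R[i]) (J : {fset nat}) (x : nat -> R),
  @cbmeas _ AT R Phi -> (forall w, normc (Phi w) <= 1) ->
  (forall j, j \in J -> (n < j)%N) -> (forall j, j \in J -> 0 <= x j) ->
  Ec (fun w => Phi w * alive_prod n w * (alive n w)%:R * (\1_(tail_event serv J x) w)%:C) =
  Ec (fun w => Phi w * mean_prod n w * (alive_mean n w)%:C) *
    (\prod_(j <- J) expR (- mu * x j))%:C.
Proof.
move=> IH Phi J x bPhi nPhi Jn x0.
set q := (\prod_(j <- J) _)%:C.
have nJ : n \notin J by apply/negP => /Jn; rewrite ltnn.
apply/eqP; rewrite -subr_eq0; apply/eqP/ComplexField.Normc.eq0_normc.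
apply/eqP; rewrite eq_le normc_ge0 andbT; apply/ler_addgt0Pr => e e0; rewrite add0r.
(* Two errors of size [mu * del] arise: presence replaced by its grid version [X1], and [G] replaced
   by [alive_mean]. *)
pose N := (Num.truncn (2 * mu * t / e)).+1.
have N0 : (0 < N)%N by [].
have NR : 0 < N%:R :> R by rewrite ltr0n.
pose del : R := t / N%:R.
have d0 : 0 < del by exact: del_gt0.
have md0 : 0 <= mu * del by apply: mulr_ge0; exact: ltW.
have de : mu * del + mu * del <= e.
  have : 2 * mu * t / e < N%:R by exact: truncnS_gt.
  rewrite ltr_pdivrMr// => H.
  rewrite (_ : mu * del + mu * del = 2 * mu * t / N%:R); last by rewrite /del; ring.
  by rewrite ler_pdivrMr// [leRHS]mulrC ltW.
pose xk k : R := t - k%:R * del.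
(* On cell [k] the remaining time [t - arr n] lies between [yk k] and [xk k]. Only in the last cell
   is [xk k.+1] negative, and a tail formula requires a nonnegative threshold. *)
pose yk k : R := Num.max 0 (xk k.+1).
have xk0 (k : 'I_N.+1) : 0 <= xk k.
  rewrite subr_ge0 /del mulrA ler_pdivrMr// mulrC ler_pM2l// ler_nat -ltnS.
  exact: ltn_ord.
have yk0 k : 0 <= yk k by rewrite le_max lexx.
have xkS k : xk k = xk k.+1 + del by rewrite /xk -natr1; ring.
have xyk (k : 'I_N.+1) : yk k <= xk k /\ xk k - yk k <= del.
  split; first by rewrite ge_max xk0/= (xkS k) lerDl ltW.
  by rewrite lerBlDl (xkS k) lerD2r le_max lexx orbT.
have expd (k : 'I_N.+1) : expR (- mu * yk k) - expR (- mu * xk k) <= mu * del.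
  have [y1 y2] := xyk k.
  have n0 u : 0 <= u -> - mu * u <= 0 by move=> u0; rewrite mulNr oppr_le0 mulr_ge0// ltW.
  apply: le_trans (ler_norm _) _; apply: le_trans (expR_lip (n0 _ (yk0 _)) (n0 _ (xk0 _))) _.
  rewrite -mulrBr mulNr -mulrN opprB normrM (gtr0_norm mu_gt0) ler_pM2l//.
  by rewrite ger0_norm// subr_ge0.
pose A k := [set w | cell n N k w].
have mA k : @measurable _ AT (A k) by exact: cell_measurable.
have mAT k : @measurable _ T (A k).
  by apply: (sigma_sub_measurable (@epoch_gen_measurable _ _ _ _ arr mark)); exact: mA.
pose F y w : R := \1_(serv n @^-1` `]y, +oo[) w.
have mF y : measurable (serv n @^-1` `]y, +oo[).
  by rewrite -[X in measurable X]setTI; exact: measurable_funP.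
have bF y : bmeas (F y) by exact: bmeas_indic.
have FE y w : F y w = (y < serv n w)%R%:R.
  by rewrite /F (_ : _ @^-1` _ = [set w | y < serv n w]) ?indic_setE// preimage_itvoy.
have bAT k := bmeas_indic R (mAT k).
pose tl w : R[i] := (\1_(tail_event serv J x) w)%:C.
pose Q w : R[i] := Phi w * alive_prod n w * tl w.
have btl : cbmeas tl by apply: cbmeas_indic; exact: tail_event_measurable.
have bPhiT : @cbmeas _ T R Phi by apply: cbmeas_sub bPhi; exact: epoch_gen_measurable.
have bQ : cbmeas Q.
  by apply: cbmeasM => //; apply: cbmeasM => //; exact: cbmeas_alive_prod.
have nQ w : normc (Q w) <= 1.
  rewrite /Q ComplexField.Normc.normcM mulr_ile1 ?normc_ge0// ?normc_indic//.
  by rewrite ComplexField.Normc.normcM mulr_ile1 ?normc_ge0// normc_alive_prod.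
pose X1 w : R := \sum_(k < N.+1) \1_(A k) w * F (xk k) w.
pose dX w : R := \sum_(k < N.+1) \1_(A k) w * (F (yk k) w - F (xk k) w).
have bX1 : bmeas X1 by apply: bmeas_sum => k; exact: bmeasM.
have bdX : bmeas dX by apply: bmeas_sum => k; apply: bmeasM => //; exact: bmeasB.
(* Presence and its grid version differ only if the service falls between [yk k] and [xk k], an
   event of probability at most [mu * del] on each cell. *)
have aliveX w : `|(alive n w)%:R - X1 w| <= dX w.
  have AE k : \1_(A k) w = (cell n N k w)%:R :> R by rewrite indic_setE.
  have [k ck E1] := @cell_sum n N N0 R (fun k => F (xk k) w) w.
  have [k' ck' E2] := @cell_sum n N N0 R (fun k => F (yk k) w - F (xk k) w) w.
  rewrite /X1 /dX; under eq_bigr do rewrite AE.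
  under [leRHS]eq_bigr do rewrite AE.
  rewrite E1 E2; case: ifPn => at'; last first.
    by rewrite /alive (negbTE at')/= subrr normr0.
  have kk : k = k'.
    have := ck at'; have := ck' at'; rewrite /cell at'/= => /andP[a1 a2] /andP[b1 b2].
    apply/eqP; rewrite eqn_leq -[(k <= k')%N]ltnS -[(k' <= k)%N]ltnS -!(ltr_nat R) -(ltr_pM2r d0 k%:R) -(ltr_pM2r d0 k'%:R).
    by rewrite (le_lt_trans b1)// (le_lt_trans a1).
  rewrite -kk /alive at'/= !FE; move: (ck at'); rewrite /cell at'/= => /andP[a1 a2].
  have i1 : t - arr n w <= xk k by rewrite /xk lerD2l lerN2.
  have i2 : yk k <= t - arr n w.
    by rewrite /yk ge_max subr_ge0 at'/= /xk lerD2l lerN2 ltW.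
  rewrite -ltrBlDl.
  case: (ltP (xk k) (serv n w)) => s1.
    by rewrite (le_lt_trans i1 s1) (le_lt_trans i2 (le_lt_trans i1 s1)) !subrr normr0.
  case: (ltP (t - arr n w) (serv n w)) => s2.
    by rewrite (le_lt_trans i2 s2) !subr0 normr1.
  by rewrite subr0 normr0 subr0 ler0n.
have EdX : Ex dX <= mu * del.
  rewrite /dX Ex_sum; last by move=> k; apply: bmeasM => //; exact: bmeasB.
  apply: (@le_trans _ _ (\sum_(k < N.+1) Ex \1_(A k) * (mu * del))).
    apply: ler_sum => k _.
    rewrite (@eq_Ex _ _ _ _ _ (fun w => \1_(A k) w * F (yk k) w - \1_(A k) w * F (xk k) w)); last first.
      by move=> w; rewrite mulrBr.
    rewrite ExB; [|exact: bmeasM|exact: bmeasM].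
    rewrite !Ex_serv_tail// -mulrBr ler_wpM2l//.
    by apply: Rintegral_ge0 => w _; rewrite indicE ler0n.
  rewrite -big_distrl/= -Ex_sum// ler_piMl//.
  rewrite -(Ex_cst P 1); apply: le_Ex => [||w]; [exact: bmeas_sum|exact: bmeas_cst|].
  have [k _ E1] := @cell_sum n N N0 R (fun=> 1) w.
  rewrite (eq_bigr (fun k : 'I_N.+1 => (cell n N k w)%:R * 1)).
    by rewrite E1; case: ifP => _ //; exact: ler01.
  by move=> j _; rewrite indic_setE mulr1.
pose G w : R := \sum_(k < N.+1) \1_(A k) w * expR (- mu * xk k).
have GE w : `|G w - alive_mean n w| <= mu * del.
  have AE k : \1_(A k) w = (cell n N k w)%:R :> R by rewrite indic_setE.
  have [k ck E1] := @cell_sum n N N0 R (fun k => expR (- mu * xk k)) w.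
  rewrite /G; under eq_bigr do rewrite AE.
  rewrite E1 /alive_mean; case: ifPn => at'; last first.
    by rewrite subrr normr0.
  move: (ck at'); rewrite /cell at'/= => /andP[a1 a2].
  have i0 : 0 <= t - arr n w by rewrite subr_ge0.
  have i1 : t - arr n w <= xk k by rewrite /xk lerD2l lerN2.
  have i2 : xk k.+1 <= t - arr n w by rewrite /xk lerD2l lerN2 ltW.
  have n0 u : 0 <= u -> - mu * u <= 0 by move=> u0; rewrite mulNr oppr_le0 mulr_ge0// ltW.
  rewrite (le_trans (expR_lip (n0 _ (le_trans i0 i1)) (n0 _ i0)))//.
  rewrite -mulrBr normrM normrN (gtr0_norm mu_gt0) ler_pM2l//.
  by rewrite ger0_norm ?subr_ge0// lerBlDr addrC -lerBlDr (le_trans _ i2)// lerBlDr -xkS.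
have bG : @bmeas _ AT R G.
  apply: bmeas_sum => k; apply: bmeasM; first exact: bmeas_indic.
  exact: bmeas_cst.
pose U w : R[i] := Phi w * mean_prod n w.
have bU : @cbmeas _ AT R U by apply: cbmeasM => //; exact: cbmeas_mean_prod.
have bUT : @cbmeas _ T R U by apply: cbmeas_sub bU; exact: epoch_gen_measurable.
have nU w : normc (U w) <= 1.
  by rewrite /U ComplexField.Normc.normcM mulr_ile1 ?normc_ge0// normc_mean_prod.
have bGT : @bmeas _ T R G by apply: bmeas_sub bG; exact: epoch_gen_measurable.
have bmT : @bmeas _ T R (alive_mean n).
  by apply: bmeas_sub (bmeas_alive_mean n); exact: epoch_gen_measurable.
(* Cell by cell, the induction hypothesis is used with the indicator of the cell in the weight and
   with [n] added to [J] at threshold [xk k]. *)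
have EX1 : Ec (fun w => Q w * (X1 w)%:C) = Ec (fun w => U w * (G w)%:C) * q.
  rewrite (@eq_Ec _ _ _ _ _ (fun w => \sum_(k < N.+1) Q w * (\1_(A k) w * F (xk k) w)%:C)); last first.
    by move=> w; rewrite /X1 rmorph_sum big_distrr.
  rewrite Ec_sum; last first.
    by move=> k; apply: cbmeasM => //; apply: cbmeas_real; exact: bmeasM.
  rewrite (@eq_Ec _ _ _ _ (fun w => U w * (G w)%:C)
     (fun w => \sum_(k < N.+1) U w * (\1_(A k) w)%:C * (expR (- mu * xk k))%:C)); last first.
    by move=> w; rewrite /G rmorph_sum big_distrr/=; apply: eq_bigr => k _; rewrite rmorphM mulrA.
  have bUA k : cbmeas (fun w => U w * (\1_(A k) w)%:C).
    by apply: cbmeasM => //; exact: cbmeas_real.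
  rewrite Ec_sum; last by move=> k; apply: cbmeasM => //; exact: cbmeas_cst.
  rewrite big_distrl/=; apply: eq_bigr => k _.
  rewrite EcZr//.
  have bPA : @cbmeas _ AT R (fun w => Phi w * (\1_(A k) w)%:C).
    by apply: cbmeasM => //; exact: cbmeas_indic.
  have nPA w : normc (Phi w * (\1_(A k) w)%:C) <= 1.
    by rewrite ComplexField.Normc.normcM mulr_ile1 ?normc_ge0// normc_indic.
  have := IH _ (n |` J)%fset (fun j => if j == n then xk k else x j) bPA nPA.
  rewrite tail_eventU1// prod_tailU1// => /(_ _ _) H.
  rewrite -mulrA -rmorphM.
  transitivity (Ec (fun w => Phi w * (\1_(A k) w)%:C * alive_prod n w *
     (\1_((serv n @^-1` `]xk k, +oo[) `&` tail_event serv J x) w)%:C)).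
    by apply: eq_Ec => w; rewrite indicI /= /Q /tl /F !rmorphM; ring.
  rewrite H.
  - by congr (_ * _); apply: eq_Ec => w; rewrite /U; ring.
  - by move=> j; rewrite in_fset1U => /orP[/eqP ->//|/Jn/ltnW].
  - by move=> j; rewrite in_fset1U; case: eqP => // _ /= /x0.
have E0 : Ec (fun w => Phi w * alive_prod n w * (alive n w)%:R * tl w) =
    Ec (fun w => Q w * ((alive n w)%:R - X1 w)%:C) + Ec (fun w => Q w * (X1 w)%:C).
  rewrite -EcD.
  - by apply: eq_Ec => w; rewrite rmorphB/= rmorph_nat /Q; ring.
  - apply: cbmeasM => //; rewrite (_ : (fun _ => _) = fun w => (alive n w)%:R - (X1 w)%:C).
      by apply: cbmeasB; [exact: cbmeas_alive|exact: cbmeas_real].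
    by apply/funext => w; rewrite rmorphB/= rmorph_nat.
  - by apply: cbmeasM => //; exact: cbmeas_real.
rewrite -/tl E0 EX1 -addrA -mulrBl -EcB; last 2 first.
- by apply: cbmeasM => //; exact: cbmeas_real.
- by apply: cbmeasM => //; exact: cbmeas_real.
rewrite (le_trans _ de)// (le_trans (le_normcD _ _))// lerD//.
  apply: le_trans EdX; apply: normc_Ec => //.
    apply: cbmeasM => //; rewrite (_ : (fun _ => _) = fun w => (alive n w)%:R - (X1 w)%:C).
      by apply: cbmeasB; [exact: cbmeas_alive|exact: cbmeas_real].
    by apply/funext => w; rewrite rmorphB/= rmorph_nat.
  move=> w; rewrite ComplexField.Normc.normcM normc_real -[leRHS]mul1r.
  by rewrite ler_pM ?normc_ge0.
have nq : normc q <= 1.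
  rewrite normc_real ger0_norm; last by rewrite prodr_ge0// => j _; exact: expR_ge0.
  rewrite big_seq prodr_ile1// => j jJ.
  by rewrite expR_ge0/= discount_le1// x0.
rewrite ComplexField.Normc.normcM -[leRHS]mulr1 ler_pM ?normc_ge0//.
rewrite -(Ex_cst P (mu * del)); apply: normc_Ec.
- by apply: cbmeasB; apply: cbmeasM => //; exact: cbmeas_real.
- exact: bmeas_cst.
- move=> w; rewrite -mulrBr -rmorphB ComplexField.Normc.normcM normc_real -[leRHS]mul1r.
  by rewrite ler_pM ?normc_ge0.
Qed.

(** The last factor is [1 + (z - 1) * alive n]: the induction hypothesis treats the 1, and
    [thinned_alive] the rest. *)
Lemma thinnedP n : thinned n.
Proof.
elim: n => [|n IH]; first exact: thinned0.
move=> Phi J x bPhi nPhi Jn x0.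
have bPhiT : @cbmeas _ T R Phi by apply: cbmeas_sub bPhi; exact: epoch_gen_measurable.
have btl : cbmeas (fun w => (\1_(tail_event serv J x) w)%:C : R[i]).
  by apply: cbmeas_indic; exact: tail_event_measurable.
have bPm : @cbmeas _ T R (fun w => Phi w * mean_prod n w).
  apply: cbmeas_sub (cbmeasM bPhi (cbmeas_mean_prod n)); exact: epoch_gen_measurable.
have bPmm : @cbmeas _ T R (fun w => Phi w * mean_prod n w * (alive_mean n w)%:C).
  apply: cbmeasM => //; apply: cbmeas_real.
  by apply: bmeas_sub (bmeas_alive_mean n); exact: epoch_gen_measurable.
have bPa : cbmeas (fun w => Phi w * alive_prod n w).
  by apply: cbmeasM => //; exact: cbmeas_alive_prod.
rewrite (@eq_Ec _ _ _ _ _ (fun w =>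
   Phi w * alive_prod n w * (\1_(tail_event serv J x) w)%:C +
   Phi w * alive_prod n w * (alive n w)%:R * (\1_(tail_event serv J x) w)%:C * (z - 1))); last first.
  by move=> w; rewrite /alive_prod big_ord_recr/=; ring.
have bPaa : cbmeas (fun w => Phi w * alive_prod n w * (alive n w)%:R * (\1_(tail_event serv J x) w)%:C).
  by apply: cbmeasM => //; apply: cbmeasM => //; exact: cbmeas_alive.
rewrite EcD; last 2 first.
- exact: cbmeasM.
- by apply: cbmeasM => //; exact: cbmeas_cst.
rewrite EcZr// (IH _ _ _ bPhi nPhi)//; last by move=> j /Jn/ltnW.
rewrite (thinned_alive IH bPhi nPhi)//.
rewrite (@eq_Ec _ _ _ _ (fun w => Phi w * mean_prod n.+1 w) (fun w =>
   Phi w * mean_prod n w + Phi w * mean_prod n w * (alive_mean n w)%:C * (z - 1))); last first.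
  by move=> w; rewrite /mean_prod big_ord_recr/=; ring.
rewrite EcD//; last by apply: cbmeasM => //; exact: cbmeas_cst.
by rewrite EcZr//; ring.
Qed.

End thinning.

Lemma card_fset_set_count (p : pred nat) n : (forall i, p i -> (i < n)%N) ->
  #|` fset_set [set i | p i]| = (\sum_(i < n) p i)%N.
Proof.
move=> pn.
have fin : finite_set [set i | p i].
  by apply: sub_finite_set (finite_II n) => i /= /pn.
have -> : fset_set [set i | p i] = seq_fset tt [seq i <- iota 0 n | p i].
  apply/fsetP => i; rewrite in_fset_set// seq_fsetE mem_filter mem_iota/= add0n.
  apply/idP/idP => [/set_mem /= pi|/andP[pi _]]; first by rewrite pi pn.
  exact: mem_set.
rewrite size_seq_fset undup_id ?filter_uniq ?iota_uniq//.
by rewrite size_filter -sum1_count big_mkcond/= -(big_mkord xpredT (fun i => p i : nat)) /index_iota subn0; apply: eq_bigr => i _; case: (p i).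
Qed.

(** * From the number of customers to the service weights *)

Section assembly.
Context d (T : measurableType d) (R : realType) (P : probability T R).
Variables (arr mark serv : nat -> {RV P >-> R}) (mu lam r t : R) (z s : R[i]).
Hypothesis cp : counting_process arr.
Hypotheses (lam_gt0 : 0 < lam) (r_gt0 : 0 < r) (mu_gt0 : 0 < mu) (t_gt0 : 0 < t).
Hypotheses (z_le1 : normc z <= 1) (s_ge0 : 0 <= complex.Re s).
Hypothesis iid_serv : iid serv (exponential_prob mu).
Hypothesis indep_serv :
  independent_sigma P (gen_sigma (range (fun i => serv i : T -> R)))
    (gen_sigma (range (fun i => arr i : T -> R) `|` range (fun i => mark i : T -> R))).
Local Notation Ec := (cexpectation P).
Local Notation Ex := (Ex P).
Local Notation cnt := (arrivals arr).
Local Notation AT := (g_sigma_algebraType (epoch_gen arr mark)).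

(** Since presence is 0 or 1, [z] to its power is affine in it; customers beyond the count have not
    arrived and contribute factors 1. *)
Lemma in_systemE n w : (cnt t w <= n)%N ->
  z ^+ in_system arr serv t w = alive_prod arr serv t z n w.
Proof.
move=> cn; rewrite /in_system (@card_fset_set_count (fun i => alive arr serv t i w) n).
  rewrite /alive_prod -[RHS]mul1r; elim: n {cn} => [|n IH]; first by rewrite !big_ord0 mulr1.
  rewrite !big_ord_recr/= exprD IH !mul1r; congr (_ * _).
  by case: (alive _ _ _ _ _); rewrite ?expr1 ?expr0 ?mulr1 ?mulr0 ?addr0// addrC subrK.
by move=> i /andP[ai _]; rewrite (leq_trans _ cn)// lt_cnt.
Qed.

Lemma mean_prodE n w : (cnt t w <= n)%N ->
  mean_prod arr mu t z n w = wprod arr mu t z t w.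
Proof.
move=> cn; rewrite /wprod (@prod_cnt _ _ _ _ _ cp _ (fun i => gfun mu z (t - arr i w)) _ _ n)//.
by apply: eq_bigr => i _; rewrite /alive_mean; case: ifP; rewrite ?mulr0 ?addr0.
Qed.

Lemma cbmeas_in_system : cbmeas (fun w => z ^+ in_system arr serv t w).
Proof.
apply: (@cbmeasP _ _ _ _ 1); last first.
  by move=> w; rewrite normcX exprn_ile1// normc_ge0.
split.
  apply: (@measurable_fun_eventually _ _ _ (fun n w => complex.Re (alive_prod arr serv t z n w)) _ (cnt t)) => [n|n w cn].
    by have [[]] := cbmeas_alive_prod arr serv t z n.
  by rewrite (in_systemE cn).
apply: (@measurable_fun_eventually _ _ _ (fun n w => complex.Im (alive_prod arr serv t z n w)) _ (cnt t)) => [n|n w cn].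
  by have [_ []] := cbmeas_alive_prod arr serv t z n.
by rewrite (in_systemE cn).
Qed.

Lemma hist_gen_epoch : hist_gen arr mark t `<=` @measurable _ AT.
Proof.
move=> _ [i [u [Y [ut mY ->]]]].
rewrite (_ : mkset _ = [set w | arr i w <= u] `&` (mark i @^-1` Y))//.
have m1 : @measurable_fun _ _ AT R setT (arr i) by apply: gen_of_fun; left; exists i.
have m2 : @measurable_fun _ _ AT R setT (mark i) by apply: gen_of_fun; right; exists i.
apply: measurableI.
  by rewrite -[X in measurable X]setTI -preimage_itvNyc; exact: m1.
by rewrite -[X in measurable X]setTI; exact: m2.
Qed.

(** [thinnedP] needs a fixed number of factors. Counts above [n] have small probability; elsewhere
    the products with [n] factors coincide with the random ones on both sides. *)
Lemma Ec_thinning (Phi : T -> R[i]) : @cbmeas _ AT R Phi ->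
  (forall w, normc (Phi w) <= 1) ->
  Ec (fun w => z ^+ in_system arr serv t w * Phi w) =
  Ec (fun w => wprod arr mu t z t w * Phi w).
Proof.
move=> bPhi nPhi.
have bPhiT : @cbmeas _ T R Phi by apply: cbmeas_sub bPhi; exact: epoch_gen_measurable.
have bW : @cbmeas _ T R (wprod arr mu t z t).
  apply: cbmeas_sub (history_wprod mark cp mu_gt0 z_le1 (lexx t)).
  exact: hist_gen_measurable.
apply/eqP; rewrite -subr_eq0; apply/eqP/ComplexField.Normc.eq0_normc.
apply/eqP; rewrite eq_le normc_ge0 andbT; apply/ler_addgt0Pr => e e0; rewrite add0r.
have e4 : 0 < e / 4 by rewrite divr_gt0.
have mc := measurable_cnt cp t.
have [K K0 hK] := tail_small P mc e4.
pose n := (Num.truncn K).+1.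
have cn w : (cnt t w)%:R <= K -> (cnt t w <= n)%N.
  move=> cK; rewrite ltnW// -(ltr_nat R) (le_lt_trans cK)//.
  exact: truncnS_gt.
have mK : measurable [set w | K < (cnt t w)%:R].
  by rewrite -[X in measurable X]setTI -preimage_itvoy; exact: mc.
have b2 : bmeas (fun w => 2 * \1_[set w | K < (cnt t w)%:R] w : R).
  by apply: bmeasM; [exact: bmeas_cst|exact: bmeas_indic].
have E2 : Ex (fun w => 2 * \1_[set w | K < (cnt t w)%:R] w) <= e / 2.
  rewrite ExZl; last exact: bmeas_indic.
  by rewrite -ler_pdivlMl// (le_trans hK)// le_eqVlt; apply/orP; left; apply/eqP; field.
have close (X Y : T -> R[i]) : cbmeas X -> cbmeas Y -> (forall w, normc (X w) <= 1) ->
    (forall w, normc (Y w) <= 1) -> (forall w, (cnt t w <= n)%N -> X w = Y w) ->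
    normc (Ec (fun w => X w * Phi w) - Ec (fun w => Y w * Phi w)) <= e / 2.
  move=> bX bY nX nY XY; rewrite -EcB; try exact: cbmeasM.
  apply: le_trans E2; apply: normc_Ec => //; first by apply: cbmeasB; exact: cbmeasM.
  move=> w; rewrite -mulrBl ComplexField.Normc.normcM indic_setE.
  case: ltP => cK; last by rewrite XY ?cn// subrr ComplexField.Normc.normc0 mul0r mulr0.
  rewrite ler_pM ?normc_ge0// (le_trans (le_normcB _ _))//.
  by rewrite (natrD _ 1 1) lerD.
have bA := cbmeas_alive_prod arr serv t z n.
have bM : @cbmeas _ T R (mean_prod arr mu t z n).
  by apply: cbmeas_sub (cbmeas_mean_prod arr mark mu_gt0 t z n); exact: epoch_gen_measurable.
have nN w : normc (z ^+ in_system arr serv t w) <= 1 by rewrite normcX exprn_ile1// normc_ge0.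
have nA w : normc (alive_prod arr serv t z n w) <= 1 by exact: normc_alive_prod.
have nMp w : normc (mean_prod arr mu t z n w) <= 1 by exact: normc_mean_prod.
have nW w : normc (wprod arr mu t z t w) <= 1 by exact: normc_wprod.
have c1 := close _ _ cbmeas_in_system bA nN nA (fun w h => in_systemE h).
have c2 := close _ _ bM bW nMp nW (fun w h => mean_prodE h).
have arr_ge0 i w : 0 <= arr i w by rewrite ltW// arr_gt0.
have mid : Ec (fun w => alive_prod arr serv t z n w * Phi w) =
    Ec (fun w => mean_prod arr mu t z n w * Phi w).
  have thn := @thinnedP _ _ _ _ arr mark serv mu mu_gt0 iid_serv indep_serv t z t_gt0 z_le1 arr_ge0 n.
  have := thn Phi fset0 (fun=> 0) bPhi nPhi.
  rewrite big_seq_fset0 mulr1 => /(_ _ _) H.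
  rewrite (@eq_Ec _ _ _ _ (fun w => mean_prod arr mu t z n w * Phi w)
    (fun w => Phi w * mean_prod arr mu t z n w)); last by move=> w; rewrite mulrC.
  rewrite -H; [|by move=> j; rewrite in_fset0|by move=> j; rewrite in_fset0].
  have -> : tail_event serv fset0 (fun=> 0) = setT.
    by apply/seteqP; split => w // _ j /=; rewrite in_fset0.
  by apply: eq_Ec => w; rewrite indicT rmorph1 mulr1 mulrC.
rewrite (_ : _ - _ = (Ec (fun w => z ^+ in_system arr serv t w * Phi w) -
    Ec (fun w => alive_prod arr serv t z n w * Phi w)) +
   (Ec (fun w => mean_prod arr mu t z n w * Phi w) -
    Ec (fun w => wprod arr mu t z t w * Phi w))); last by rewrite mid; ring.
by rewrite (le_trans (le_normcD _ _))// (splitr e) lerD.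
Qed.

End assembly.

(** Existence is a separate conjunct, which keeps the identity from being vacuous; the identity is
    claimed for every solution, because no uniqueness is established for the ODE. *)
Theorem theorem3p1 (R : realType) (d : measure_display) (T : measurableType d)
    (P : probability T R) (lam r mu : R)
    (B : {RV P >-> R}) (arr mark serv : nat -> {RV P >-> R})
    (lam_gt0 : 0 < lam) (r_gt0 : 0 < r) (mu_gt0 : 0 < mu)
    (B_gt0 : P [set w | 0 < B w] = 1%E)
    (hawkes : markovian_hawkes lam r arr mark B)
    (services : exponential_services arr mark serv mu)
    (t : R) (z s : R[i]) (t_ge0 : 0 <= t) (z_le1 : `|z| <= 1)
    (s_ge0 : 0 <= complex.Re s) :
  (exists sol : R -> R[i], solves_ode r mu B z s t sol) /\
  (forall sol : R -> R[i], solves_ode r mu B z s t sol ->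
     zeta lam r arr mark serv t z s =
     cexp (- sol t * lam%:C) * cexp (- (lam * r)%:C * cintegral t sol)).
Proof.
have z1 : normc z <= 1 by have := z_le1; rewrite normcE_norm lecR.
split; first exact: (ode_solution_exists B_gt0 r_gt0 mu_gt0 t_ge0 z1 s_ge0).
move=> sol ode; have [sol0 _ _] := ode.
have [cp iid_mark indep_mark [_ multi none]] := hawkes.
have [iid_serv indep_serv] := services.
have mark_gt0 : {ae P, forall w, forall i, 0 < mark i w}.
  apply: ae_foralln => i; apply: ae_gt0.
  have [law _] := iid_mark.
  have := law i `]0, +oo[%classic (measurable_itv _).
  by rewrite /distribution /pushforward /= !preimage_itvoy => ->.
have cint0 : cintegral 0 sol = 0.
  by rewrite /cintegral set_itv1 !Rintegral_set1.
(* The grid of mesh [t / N] in the thinning degenerates at [t = 0]; there the system is empty and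
   the intensity is [lam]. *)
have := t_ge0; rewrite le_eqVlt => /predU1P[t0|t_gt0].
  rewrite -t0 sol0 cint0 mulr0 cexp0 mulr1 /zeta -[RHS](Ec_cst P); apply: eq_Ec => w.
  by rewrite in_system0// expr0 mul1r intensity0.
pose L := lint arr mark lam r.
pose Phi w : R[i] := cexp (- s * (L t w)%:C).
have bPhi : @cbmeas _ (g_sigma_algebraType (hist_gen arr mark t)) R Phi.
  apply: cbmeas_cexpNM => //; first exact: history_lint.
  by move=> w; exact: lint_ge0.
have bPhiT : @cbmeas _ T R Phi by apply: cbmeas_sub bPhi; exact: hist_gen_measurable.
have bPhiA : @cbmeas _ (g_sigma_algebraType (epoch_gen arr mark)) R Phi.
  apply: (@cbmeas_sub _ (g_sigma_algebraType (epoch_gen arr mark)) R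
    (hist_gen arr mark t) Phi) => //.
  exact: (@hist_gen_epoch _ _ _ _ arr mark t).
have nPhi w : normc (Phi w) <= 1.
  by apply: normc_cexp_le1; rewrite ReMr cReN mulNr oppr_le0 mulr_ge0// lint_ge0.
have bN : @cbmeas _ T R (fun w => z ^+ in_system arr serv t w).
  by exact: cbmeas_in_system.
(* At the fixed time [t] the intensity is almost surely [lint], which is nonnegative everywhere and
   a function of epochs and marks alone. *)
transitivity (cexpectation P (fun w => z ^+ in_system arr serv t w * Phi w)).
  apply: Ec_ae; last first.
  - apply: filterS (ae_intensity_lint cp lam_gt0 r_gt0 mark_gt0 none t_ge0) => w ->.
    by [].
  - exact: cbmeasM.
  - apply: cmeasM; first by case: bN => [[m1 _] [m2 _]].
    by apply/cmeas_cexp/cmeas_scale; exact: measurable_intensity.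
rewrite (Ec_thinning cp mu_gt0 t_gt0 z1 iid_serv indep_serv bPhiA nPhi).
have := mart_const cp B_gt0 lam_gt0 r_gt0 mu_gt0 t_ge0 z1 ode iid_mark indep_mark
  mark_gt0 none multi.
(* At time [t] the solution is back at its initial value [s] and the integral is empty, so [mart] is
   exactly the weight times [Phi]. *)
rewrite (@eq_Ec _ _ _ _ _ (fun w => wprod arr mu t z t w * Phi w)); last first.
  by move=> w; rewrite /mart subrr sol0 cint0 mulr0 cexp0 mulr1.
move=> ->; rewrite -[RHS](Ec_cst P); apply: eq_Ec => w.
rewrite /mart (_ : wprod arr mu t z 0 w = 1); last exact: wprod0.
by rewrite (_ : lint arr mark lam r 0 w = lam) ?subr0 ?mul1r//; exact: lint0.
Qed.
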